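(* Let $(P^n,g_0)$ be a complete Riemannian manifold and set $r(x)=\operatorname{dist}_P(o,x)$ for some fixed origin $o\in P$. Suppose that, for some $0\le\sigma<2$, $$\lim_{r\to+\infty}\frac{\log\operatorname{vol}_P(B_r)}{r^{2-\sigma}}=0.$$ Then there are no translating soliton graphs $\Gamma_u:P\to\mathbb R\times P$ (with constant $c<0$) lying above the graphs $$\iota_\beta(x)=(-\beta\,r(x)^\sigma,x)$$ at infinity, for any $\beta\in\mathbb R$.
   Context: $B_r$ is the geodesic ball of $P$ of radius $r$ centered at $o$. For $u\in C^\infty(P)$, $\Gamma_u(x)=(u(x),x)$ is a translating soliton graph in the Riemannian product $\mathbb R\times P$ (a mean curvature flow soliton with respect to the parallel field $\partial_t$) if $u$ solves on $P$ $$\operatorname{div}_P\Big(\frac{\nabla^Pu}{W}\Big)=\frac cW,\qquad W=\sqrt{1+|\nabla^Pu|^2},$$ for some constant $c\in\mathbb R$; throughout it is assumed, without loss of generality (up to reversing orientation of $\mathbb{R}$), that $c<0$. ''$\Gamma_u$ lies above $\iota_\beta$ at infinity'' means that $u(x)\ge-\beta\,r(x)^\sigma$ for all $x$ outside some compact subset of $P$. *)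

(* Defs.v *)
From HB Require Import structures.
From mathcomp Require Import all_boot all_order all_algebra.
From mathcomp Require Import all_classical all_reals all_analysis.

Set Implicit Arguments.
Unset Strict Implicit.
Unset Printing Implicit Defensive.

Import Order.TTheory GRing.Theory Num.Theory.
Import numFieldNormedType.Exports.

Local Open Scope classical_set_scope.
Local Open Scope ring_scope.

Section Euclidean.
Context {R : realType}.

Definition basis_vec {n : nat} (k : 'I_n) : 'rV[R]_n := delta_mx 0 k.

Definition iter_partial {n : nat} (s : seq 'I_n) (f : 'rV[R]_n -> R) :
    'rV[R]_n -> R :=
  foldr (fun k g x => 'D_(basis_vec k) g x) f s.

(* C^oo on an open set U: all iterated partial derivatives exist and are
   continuous at every point of U. *)
Definition smooth_on {n : nat} (U : set 'rV[R]_n) (f : 'rV[R]_n -> R) : Prop :=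
  forall (s : seq 'I_n) (x : 'rV[R]_n), U x ->
    {for x, continuous (iter_partial s f)} /\
    forall k : 'I_n, derivable (iter_partial s f) x (basis_vec k).

(* The Lebesgue integral over R^n of a nonnegative Borel function, as an
   iterated one-dimensional integral (Tonelli). *)
Fixpoint integral_rV {n : nat} : ('rV[R]_n -> \bar R) -> \bar R :=
  match n return ('rV[R]_n -> \bar R) -> \bar R with
  | 0%N => fun f => f 0
  | m.+1 => fun f =>
      (\int[lebesgue_measure]_t
         integral_rV (fun v : 'rV[R]_m => f (row_mx (t%:M : 'M[R]_1) v)))%E
  end.

End Euclidean.

(* A connected smooth Riemannian n-manifold (without boundary) structure on the
   space P, given by an atlas and, in each chart, the Gram matrix of the metric
   as a function of the coordinates.  [param i] is the inverse of the chart
   [chart_map i]; only its values on [chart_map i @` dom i] matter.  Tangent vectors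
   are row vectors, so a coordinate change acts by v |-> v *m 'J tau x. *)
Record riemannianManifold (R : realType) (n : nat) (P : topologicalType) := {
  manifold_hausdorff : hausdorff_space P;
  manifold_second_countable : @second_countable P;
  manifold_connected : connected [set: P];
  chart_index : Type;
  dom : chart_index -> set P;
  chart_map : chart_index -> P -> 'rV[R]_n;
  param : chart_index -> 'rV[R]_n -> P;
  gram : chart_index -> 'rV[R]_n -> 'M[R]_n;
  dom_open : forall i, open (dom i);
  range_open : forall i, open (chart_map i @` dom i);
  chart_mapK : forall i p, dom i p -> param i (chart_map i p) = p;
  chart_map_continuous : forall i p, dom i p -> {for p, continuous (chart_map i)};
  param_continuous : forall i p, dom i p ->
    {for chart_map i p, continuous (param i)};
  dom_cover : forall p, exists i, dom i p;
  transition_smooth : forall i j (k : 'I_n),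
    smooth_on (chart_map i @` (dom i `&` dom j))
      (fun x => chart_map j (param i x) 0 k);
  gram_smooth : forall i (k l : 'I_n),
    smooth_on (chart_map i @` dom i) (fun x => gram i x k l);
  gram_sym : forall i x, (chart_map i @` dom i) x -> (gram i x)^T = gram i x;
  gram_pos : forall i x (v : 'rV[R]_n), (chart_map i @` dom i) x -> v != 0 ->
    0 < (v *m gram i x *m v^T) 0 0;
  gram_transition : forall i j x, (chart_map i @` (dom i `&` dom j)) x ->
    let tau := chart_map j \o param i in
    gram i x = 'J tau x *m gram j (tau x) *m ('J tau x)^T
}.

Section Riemannian.
Context {R : realType} {n : nat} {P : topologicalType}.
Variable M : riemannianManifold R n P.

Definition chart_range (i : chart_index M) : set 'rV[R]_n := chart_map i @` dom i.

Definition sqnorm (i : chart_index M) (x v : 'rV[R]_n) : R :=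
  (v *m gram i x *m v^T) 0 0.

Definition chart_at (p : P) : chart_index M := projT1 (cid (dom_cover M p)).

Definition C1_curve (gamma : R -> P) : Prop :=
  continuous gamma /\
  forall (i : chart_index M) (t : R), dom i (gamma t) ->
    derivable (chart_map i \o gamma) t 1 /\
    {for t, continuous (fun s => 'D_1 (chart_map i \o gamma) s)}.

(* By [gram_transition], the choice of the chart around gamma t is immaterial
   for C^1 curves. *)
Definition speed (gamma : R -> P) (t : R) : R :=
  let i := chart_at (gamma t) in
  Num.sqrt (sqnorm i (chart_map i (gamma t)) ('D_1 (chart_map i \o gamma) t)).

Definition curve_length (gamma : R -> P) : \bar R :=
  (\int[lebesgue_measure]_(t in `[0%R, 1%R]) (speed gamma t)%:E)%E.

(* Zero velocity is allowed, so piecewise C^1 curves reparametrize to C^1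
   curves defined on the whole of R, with the same trace and length on [0, 1].
   The infimum is finite because the manifold is connected. *)
Definition rdist (p q : P) : R :=
  fine (ereal_inf [set curve_length gamma | gamma in
    [set gamma | [/\ C1_curve gamma, gamma 0 = p & gamma 1 = q]]]).

Definition rball (p : P) (r : R) : set P := [set q | rdist p q < r].

Definition rcomplete : Prop :=
  forall x : nat -> P,
    (forall e : R, 0 < e -> exists N : nat, forall k l : nat,
       (N <= k)%N -> (N <= l)%N -> rdist (x k) (x l) < e) ->
    exists p : P, rdist p (x k) @[k --> \oo] --> (0 : R).

Definition smooth_fun (u : P -> R) : Prop :=
  forall i : chart_index M, smooth_on (chart_range i) (u \o param i).

Definition grad (i : chart_index M) (u : P -> R) (x : 'rV[R]_n) : 'rV[R]_n :=
  (\row_k 'D_(basis_vec k) (u \o param i) x) *m invmx (gram i x).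

(* div X = (det g)^(-1/2) \sum_k d_k ((det g)^(1/2) X^k). *)
Definition divergence (i : chart_index M) (X : 'rV[R]_n -> 'rV[R]_n)
    (x : 'rV[R]_n) : R :=
  (Num.sqrt (\det (gram i x)))^-1 *
  \sum_(k < n)
    'D_(basis_vec k) (fun y => Num.sqrt (\det (gram i y)) * X y 0 k) x.

Definition slope_factor (i : chart_index M) (u : P -> R) (x : 'rV[R]_n) : R :=
  Num.sqrt (1 + sqnorm i x (grad i u x)).

Definition translating_soliton_graph (c : R) (u : P -> R) : Prop :=
  smooth_fun u /\
  forall (i : chart_index M) (x : 'rV[R]_n), chart_range i x ->
    divergence i (fun y => (slope_factor i u y)^-1 *: grad i u y) x = c / slope_factor i u x.

Definition lies_above_at_infinity (o : P) (sigma beta : R) (u : P -> R) : Prop :=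
  exists2 K : set P, compact K &
    forall x : P, ~ K x -> - beta * rdist o x `^ sigma <= u x.

End Riemannian.

(* P is pointed only because the library's measurable types are. *)
Definition borel (P : ptopologicalType) := g_sigma_algebraType (@open P).

(* vol is the Riemannian measure sqrt(det g) dx; since countably many charts
   cover P, this determines vol. *)
Definition is_riemannian_volume (R : realType) (n : nat) (P : ptopologicalType)
    (M : riemannianManifold R n P)
    (vol : {measure set (borel P) -> \bar R}) : Prop :=
  forall (i : chart_index M) (A : set (borel P)),
    measurable A -> A `<=` dom i ->
    vol A = integral_rV (fun x : 'rV[R]_n =>
      (\1_(chart_map i @` A) x * Num.sqrt (\det (gram i x)))%:E).

(* Main.v *)
(* Put a = - c > 0, W = sqrt (1 + |grad u|^2) and X = e^(- lam u) grad u / W.  The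
   soliton equation becomes div X = - S with source S = e^(- lam u) (a + lam |grad u|^2) / W,
   and if (4 kap)^2 <= a lam then |X| <= min (S / (4 kap), 2 e^(- lam u)) by AM-GM.
   Integrating against the cutoff phi = max (0, e^(- kap r) - e^(- kap rad)), whose
   slope is at most kap (phi + e^(- kap rad)) on B_rad and 0 outside, and absorbing
   the part of |grad phi| |X| controlled by phi S, one gets
     int phi S <= 8 kap e^(- kap rad) int_(B_(rad + 1)) e^(- lam u).
   Now let lam = k rad^(2 - 2 sigma) and kap = sqrt (a k) rad^(1 - sigma) / 4, so that
   kap rad = sqrt (a k) rad^(2 - sigma) / 4.  As u >= - C - b r^sigma and by the volume
   growth, the right-hand side is at most
     exp ((- sqrt (a k) / 4 + O(k) + o(1)) rad^(2 - sigma)),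
   whereas the left-hand side, restricted to a fixed ball, is at least
   exp (- (O(k) + o(1)) rad^(2 - sigma)).  For k small and rad large this is absurd.

   The distance r is merely Lipschitz and its gradient is never used: in a chart the
   derivative is moved onto X by translating difference quotients of phi, and the
   charts are combined by smooth bumps, finitely many because balls of a complete
   manifold are relatively compact (Hopf-Rinow). *)

Require Import Defs.
From HB Require Import structures.
From mathcomp Require Import all_boot all_order all_algebra.
From mathcomp Require Import all_classical all_reals all_analysis.
From mathcomp Require Import measurable_realfun ring lra.

Set Implicit Arguments.
Unset Strict Implicit.
Unset Printing Implicit Defensive.

Import Order.TTheory GRing.Theory Num.Theory.
Import numFieldNormedType.Exports.

Local Open Scope classical_set_scope.
Local Open Scope ring_scope.

(** * Functions of class C^1 *)

(** Translating difference quotients differentiates along a constant vector, whereas X varies; and a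
    chart distorts lengths by an uncontrolled factor, whereas absorption requires the exact
    Riemannian norm of X. So X is frozen at the centre of a small coordinate ball: the constant part
    carries its exact norm, and the oscillation is so small that crude coordinate bounds suffice for
    it. Room for this error exists because |X| is strictly below min (S / (4 kap), 2 e^(- lam u)).
    Each chart yields a one-sided inequality that is linear in the localizing function theta. Such
    inequalities add up to one for a theta equal to 1 near the ball, where grad theta vanishes and
    theta disappears. Finite increments in place of derivatives of phi cost a factor 2 and one unit
    of radius: the slope bound is 2 kap e^(- kap r) on B_(rad + 1). This is the origin of the
    constant 4 kap: 2 kap |X| <= S / 2 absorbs half of the left-hand side. *)

Lemma continuous_sumr (R : realType) (T : topologicalType) (I : Type) (r : seq I)
    (f : I -> T -> R) (x : T) : (forall i, {for x, continuous (f i)}) ->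
  {for x, continuous (fun y => \sum_(i <- r) f i y)}.
Proof.
by move=> cf; apply: cvg_big => [|i _]; [exact: add_continuous|exact: cf].
Qed.

Lemma continuous_pointwise {T U : topologicalType} (f : T -> U) :
  (forall x, {for x, continuous f}) -> continuous f.
Proof. by move=> cf x; exact: cf. Qed.

Section PointwiseContinuity.
Context {R : realType} {T : topologicalType}.
Implicit Types (f g : T -> R) (x : T).

Lemma continuousD_at f g x : {for x, continuous f} -> {for x, continuous g} ->
  {for x, continuous (fun y => f y + g y)}.
Proof. by move=> cf cg; exact: cvgD. Qed.

Lemma continuousB_at f g x : {for x, continuous f} -> {for x, continuous g} ->
  {for x, continuous (fun y => f y - g y)}.
Proof. by move=> cf cg; exact: cvgB. Qed.

Lemma continuousM_at f g x : {for x, continuous f} -> {for x, continuous g} ->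
  {for x, continuous (fun y => f y * g y)}.
Proof. by move=> cf cg; exact: cvgM. Qed.

Lemma continuousV_at f x : f x != 0 -> {for x, continuous f} ->
  {for x, continuous (fun y => (f y)^-1)}.
Proof. by move=> f0 cf; exact: cvgV. Qed.

Lemma continuous_cst_at (k : R) x : {for x, continuous (fun _ : T => k)}.
Proof. exact: cst_continuous. Qed.

Lemma continuous_comp_at f (g : R -> R) x : {for x, continuous f} -> continuous g ->
  {for x, continuous (fun y => g (f y))}.
Proof. by move=> cf cg; apply: continuous_comp; [exact: cf|exact: cg]. Qed.

End PointwiseContinuity.

Lemma continuousBv_at {R : realType} {T : topologicalType} {V : normedModType R} (f g : T -> V) x :
  {for x, continuous f} -> {for x, continuous g} -> {for x, continuous (fun y => f y - g y)}.
Proof. by move=> cf cg; exact: cvgB. Qed.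

Lemma near_continuous (T U : topologicalType) (f g : T -> U) (x : T) :
  (\forall y \near x, f y = g y) -> {for x, continuous f} -> {for x, continuous g}.
Proof.
move=> fg; have /= E := nbhs_singleton fg.
rewrite /prop_for/continuous_at/= -E; apply: cvg_trans.
exact: near_eq_cvg.
Qed.

Lemma open_near (T : topologicalType) (U : set T) (x : T) (P : T -> Prop) :
  open U -> U x -> (forall y, U y -> P y) -> \forall y \near x, P y.
Proof. by move=> oU Ux UP; apply: filterS UP _; exact: open_nbhs_nbhs. Qed.

Section DirectionalCalculus.
Context {R : realType} {V : normedModType R}.
Implicit Types (f g : V -> R) (U : set V).

Lemma is_derive_line f (q v : V) (s : R) : derivable f (q + s *: v) v ->
  is_derive s 1 (fun t => f (q + t *: v)) ('D_v f (q + s *: v)).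
Proof.
move=> df.
have E : (fun h : R => h^-1 *: (((fun t => f (q + t *: v)) \o shift s) (h *: 1)
     - f (q + s *: v))) =
  (fun h => h^-1 *: ((f \o shift (q + s *: v)) (h *: v) - f (q + s *: v))).
  apply/funext => h /=; congr (_ *: (f _ - _)).
  by rewrite scaler1 scalerDl addrCA.
by split; [rewrite /derivable E|rewrite /derive E].
Qed.

(** The mean value theorem on the line through [q], relative to a reference slope [d]: a partial
    derivative in the proof of differentiability, 0 when difference quotients are to be bounded. *)
Lemma derive_mean_value f (q v : V) (t d e : R) :
  (forall s : R, `|s| <= `|t| -> derivable f (q + s *: v) v /\
     `|'D_v f (q + s *: v) - d| <= e) ->
  `|f (q + t *: v) - f q - t * d| <= e * `|t|.
Proof.
move=> H; pose g (s : R) := f (q + s *: v).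
have dg (s : R) : `|s| <= `|t| -> is_derive s 1 g ('D_v f (q + s *: v)).
  by move=> /H [? _]; exact: is_derive_line.
have cg (s : R) : `|s| <= `|t| -> {for s, continuous g}.
  by move=> /dg ?; apply: differentiable_continuous; apply/derivable1_diffP.
have g0 : g 0 = f q by rewrite /g scale0r addr0.
have [t0|t0|t0] := ltgtP 0 t.
- have [|c|c cab E] := @MVT _ g (fun s => 'D_v f (q + s *: v)) 0 t t0.
  + move=> x /[!in_itv]/= /andP[x0 xt]; apply: dg.
    by rewrite !gtr0_norm// ltW.
  + apply: continuous_in_subspaceT => x /[!inE]/= /[!in_itv]/= /andP[x0 xt].
    by apply: cg; rewrite !ger0_norm// ltW.
  + move: cab => /[!in_itv]/= /andP[x0 xt].
    rewrite -g0 -/(g t) E subr0 [t * d]mulrC -mulrBl normrM ler_wpM2r//.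
    by apply: (H _ _).2; rewrite !gtr0_norm// ltW.
- have [|c|c cab E] := @MVT _ g (fun s => 'D_v f (q + s *: v)) t 0 t0.
  + move=> x /[!in_itv]/= /andP[x0 xt]; apply: dg.
    by rewrite !ltr0_norm// lerN2 ltW.
  + apply: continuous_in_subspaceT => x /[!inE]/= /[!in_itv]/= /andP[x0 xt].
    by apply: cg; rewrite !ler0_norm ?lerN2// ltW.
  + move: cab => /[!in_itv]/= /andP[x0 xt].
    rewrite -g0 -/(g t) -[g t - _]opprB E sub0r mulrN opprK [t * d]mulrC -mulrBl normrM ler_wpM2r//.
    by apply: (H _ _).2; rewrite !ltr0_norm// lerN2 ltW.
- by rewrite -t0 scale0r addr0 subrr mul0r subrr normr0 mulr0.
Qed.

Lemma differentiable_eps {W : normedModType R} (f : V -> W) (L : {linear V -> W}) x :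
  continuous L ->
  (forall e, 0 < e -> \forall h \near 0, `|f (h + x) - (f x + L h)| <= e * `|h|) ->
  differentiable f x /\ 'd f x = L :> (V -> W).
Proof.
move=> cL H.
have E : f \o shift x = cst (f x) + L +o_ 0 id by apply/eqaddoP => e e0; exact: H.
have D := diff_unique cL E.
by split=> //; apply/diff_locallyP; rewrite D.
Qed.

(** Differentiability is Fréchet's and all directions are quantified, so that one notion serves
    functions on the line and on row vectors and passes through compositions. *)
Definition C1_on U f := forall x, U x ->
  differentiable f x /\ forall v, {for x, continuous (fun y => 'D_v f y)}.

Lemma C1_on_sub U U' f : U' `<=` U -> C1_on U f -> C1_on U' f.
Proof. by move=> s c x /s /c. Qed.

Lemma C1_on_cst U (k : R) : C1_on U (cst k).
Proof.
move=> x _; split=> [|v]; first exact: differentiable_cst.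
rewrite (_ : (fun y => _) = cst 0); first exact: cst_continuous.
by apply/funext => y; rewrite derive_cst.
Qed.

Lemma C1_on_near U f g : open U -> (forall x, U x -> f x = g x) ->
  C1_on U f -> C1_on U g.
Proof.
move=> oU fg Cf x Ux.
have nfg y : U y -> \forall z \near y, f z = g z.
  by move=> Uy; exact: open_near fg.
have [dfx cfx] := Cf _ Ux; split.
  (* The little-o expansion of [f] at [x] is also one of [g], with the same differential. *)
  have /diffP[cd E] := dfx; apply/diffP.
  apply: (@getPex _ (fun (df : {linear V -> R}) => continuous df /\
    forall y, g y = g (lim (nbhs x)) + df (y - lim (nbhs x))
                  +o_(y \near x) (y - lim (nbhs x)))).
  exists ('d f x); split=> //; apply: eqaddoEx => y0.
  have {}E : f = cst (f x) + ('d f x \o center x) +o_x (center x).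
    by apply/funext => z; rewrite [LHS]E lim_id.
  rewrite lim_id//; move: y0; apply/funeqP/eqaddoP => e e0.
  move/eqaddoP: E => /(_ e e0); apply: filterS2 (nfg _ Ux) => z /= E3.
  rewrite -[(f - _) z]/(f z - (f x + 'd f x (z - x))).
  by rewrite -[(g - _) z]/(g z - (g x + 'd f x (z - x))) E3 fg.
move=> v; have Ev y : U y -> 'D_v f y = 'D_v g y.
  have [->|v0] := eqVneq v 0; first by rewrite !derive0.
  by move=> Uy; apply: near_eq_derive => //; exact: nfg.
by apply: near_continuous (cfx v); exact: open_near Ev.
Qed.

Lemma C1_on_continuous U f x : C1_on U f -> U x -> {for x, continuous f}.
Proof. by move=> c /c [/differentiable_continuous]. Qed.

Lemma C1_on_intro U f (D : V -> V -> R) : open U ->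
  (forall x, U x -> differentiable f x) ->
  (forall v x, U x -> 'D_v f x = D v x) ->
  (forall v x, U x -> {for x, continuous (D v)}) -> C1_on U f.
Proof.
move=> oU df E c x Ux; split=> [|v]; first exact: df.
by apply: near_continuous (c v x Ux); apply: open_near Ux _ => // y /E.
Qed.

Lemma C1_onD U f g : open U -> C1_on U f -> C1_on U g -> C1_on U (f \+ g).
Proof.
move=> oU Cf Cg; apply: (@C1_on_intro _ _ (fun v y => 'D_v f y + 'D_v g y)) => //.
- by move=> x Ux; apply: differentiableD; [have [] := Cf x Ux|have [] := Cg x Ux].
- by move=> v y Uy; rewrite deriveD//; apply: diff_derivable;
    [have [] := Cf y Uy|have [] := Cg y Uy].
- by move=> v x Ux; exact: cvgD ((Cf x Ux).2 v) ((Cg x Ux).2 v).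
Qed.

Lemma C1_onM U f g : open U -> C1_on U f -> C1_on U g -> C1_on U (f \* g).
Proof.
move=> oU Cf Cg; apply: (@C1_on_intro _ _ (fun v y => f y * 'D_v g y + g y * 'D_v f y)) => //.
- by move=> x Ux; apply: differentiableM; [have [] := Cf x Ux|have [] := Cg x Ux].
- by move=> v y Uy; rewrite deriveM//; apply: diff_derivable;
    [have [] := Cf y Uy|have [] := Cg y Uy].
- move=> v x Ux; exact: cvgD (cvgM (C1_on_continuous Cf Ux) ((Cg x Ux).2 v))
    (cvgM (C1_on_continuous Cg Ux) ((Cf x Ux).2 v)).
Qed.

Lemma C1_on_sum (I : Type) (s : seq I) (P : pred I) U (F : I -> V -> R) :
  open U -> (forall i, P i -> C1_on U (F i)) ->
  C1_on U (fun x => \sum_(i <- s | P i) F i x).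
Proof.
move=> oU CF; elim: s => [|i s IH].
  by rewrite (_ : (fun _ => _) = cst 0); [exact: C1_on_cst|apply/funext => x; rewrite big_nil].
case Pi : (P i); last first.
  by move: IH; congr (C1_on U _); apply/funext => x; rewrite big_cons Pi.
rewrite (_ : (fun _ => _) = F i \+ (fun x => \sum_(j <- s | P j) F j x)).
  by apply: C1_onD => //; exact: CF.
by apply/funext => x; rewrite big_cons Pi.
Qed.

Lemma C1_on_prod (I : Type) (s : seq I) (P : pred I) U (F : I -> V -> R) :
  open U -> (forall i, P i -> C1_on U (F i)) ->
  C1_on U (fun x => \prod_(i <- s | P i) F i x).
Proof.
move=> oU CF; elim: s => [|i s IH].
  by rewrite (_ : (fun _ => _) = cst 1); [exact: C1_on_cst|apply/funext => x; rewrite big_nil].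
case Pi : (P i); last first.
  by move: IH; congr (C1_on U _); apply/funext => x; rewrite big_cons Pi.
rewrite (_ : (fun _ => _) = F i \* (fun x => \prod_(j <- s | P j) F j x)).
  by apply: C1_onM => //; exact: CF.
by apply/funext => x; rewrite big_cons Pi.
Qed.

End DirectionalCalculus.

Section Composition.
Context {R : realType} {V : normedModType R}.

Lemma derive_comp {W Z : normedModType R} (f : V -> W) (g : W -> Z) x v :
  differentiable f x -> differentiable g (f x) ->
  'D_v (g \o f) x = 'D_('D_v f x) g (f x).
Proof.
move=> df dg; rewrite deriveE; last exact: differentiable_comp.
by rewrite diff_comp//= -!deriveE.
Qed.

Lemma derive_comp1 (f : V -> R) (g : R -> R) x v :
  differentiable f x -> derivable g (f x) 1 ->
  'D_v (g \o f) x = 'D_v f x * 'D_1 g (f x).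
Proof.
move=> df /derivable1_diffP dg; rewrite derive_comp//.
rewrite ['D_('D_v f x) g _]deriveE// ['D_1 g _]deriveE//.
by rewrite -[X in 'd g _ X]mulr1 -[X in 'd g _ X]/(_ *: _) linearZ.
Qed.

Lemma C1_on_comp1 (U : set V) (B : set R) (f : V -> R) (g : R -> R) :
  open U -> (forall x, U x -> B (f x)) ->
  (forall t, B t -> derivable g t 1 /\ {for t, continuous (fun s => 'D_1 g s)}) ->
  C1_on U f -> C1_on U (g \o f).
Proof.
move=> oU UB Cg Cf.
apply: (@C1_on_intro _ _ _ _ (fun v y => 'D_v f y * 'D_1 g (f y))) => //.
- move=> x Ux; apply: differentiable_comp; first by have [] := Cf x Ux.
  by apply/derivable1_diffP; have [] := Cg _ (UB _ Ux).
- by move=> v y Uy; apply: derive_comp1; [have [] := Cf y Uy|have [] := Cg _ (UB _ Uy)].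
- move=> v x Ux; exact: cvgM ((Cf x Ux).2 v)
    (continuous_comp (C1_on_continuous Cf Ux) (Cg _ (UB _ Ux)).2).
Qed.

Lemma C1_onV (U : set V) (f : V -> R) : open U -> (forall x, U x -> f x != 0) ->
  C1_on U f -> C1_on U (fun x => (f x)^-1).
Proof.
move=> oU f0; apply: (@C1_on_comp1 _ [set t | t != 0] f (@GRing.inv R)) => // t t0.
have E (s : R) : s != 0 -> 'D_1 (@GRing.inv R) s = - s ^- 2.
  by move=> s0; rewrite (deriveV (f := id))// derive_id scaler1.
split; first exact: (derivableV (f := id)).
apply: (@near_continuous R R (fun s : R => - s ^- 2 : R)).
  by apply: open_near (open_neq (y := 0)) t0 _ => s /E.
by apply: cvgN; apply: cvgV; [rewrite expf_neq0|exact: exprn_continuous].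
Qed.

Lemma C1_on_sqrt (U : set V) (f : V -> R) : open U -> (forall x, U x -> 0 < f x) ->
  C1_on U f -> C1_on U (fun x => Num.sqrt (f x)).
Proof.
move=> oU f0; apply: (@C1_on_comp1 _ [set t | 0 < t] f Num.sqrt) => // t t0.
have E (s : R) : 0 < s -> 'D_1 Num.sqrt s = (2 * Num.sqrt s)^-1.
  exact: derive_sqrt.
split; first by have [] := is_derive1_sqrt t0.
apply: (@near_continuous R R (fun s : R => (2 * Num.sqrt s)^-1 : R)).
  by apply: open_near (open_gt (y := 0)) t0 _ => s /E.
apply: cvgV; first by rewrite mulf_neq0// gt_eqF// sqrtr_gt0.
by apply: cvgM; [exact: cvg_cst|exact: sqrt_continuous].
Qed.

Lemma C1_on_expR (U : set V) (f : V -> R) : open U ->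
  C1_on U f -> C1_on U (fun x => expR (f x)).
Proof.
move=> oU; apply: (@C1_on_comp1 _ setT f expR) => // t _; split.
  exact: derivable_expR.
by rewrite derive_expR; exact: continuous_expR.
Qed.

End Composition.

Section PartialDerivatives.
Context {R : realType} {n : nat}.
Implicit Types (f : 'rV[R]_n -> R) (U : set 'rV[R]_n).

Definition row_form (c : 'I_n -> R) (h : 'rV[R]_n) : R := \sum_k h 0 k * c k.

Lemma row_form_linear c : linear (row_form c).
Proof.
move=> a x y; rewrite /row_form scaler_sumr -big_split/=; apply: eq_bigr => k _.
by rewrite !mxE mulrDl -mulrA.
Qed.

HB.instance Definition _ c :=
  GRing.isLinear.Build R 'rV[R]_n R _ (row_form c) (row_form_linear c).

Lemma coord_norm_le (h : 'rV[R]_n) k : `|h 0 k| <= `|h|.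
Proof. by rewrite /Num.Def.normr/= mx_normrE; exact: (le_bigmax _ (fun i : 'I_1 * 'I_n => `|h i.1 i.2|) (0, k)). Qed.

Lemma row_norm_le (h : 'rV[R]_n) (e : R) : 0 <= e -> (forall k, `|h 0 k| <= e) -> `|h| <= e.
Proof.
by move=> e0 he; rewrite /Num.Def.normr/= mx_normrE bigmax_le// => -[i k] _ /=; rewrite ord1.
Qed.

Lemma row_form_continuous c : continuous (row_form c).
Proof.
move=> h; apply: (continuous_sumr (f := fun k (h : 'rV[R]_n) => h 0 k * c k)) => k.
by apply: continuousM; [exact: coord_continuous|exact: cst_continuous].
Qed.

Lemma row_sum_basis (h : 'rV[R]_n) : h = \sum_k h 0 k *: basis_vec k.
Proof. exact: row_sum_delta. Qed.

(* [f (x + h) - f x] telescopes along the partial truncations of [h]. *)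
Definition row_trunc (h : 'rV[R]_n) (j : nat) : 'rV[R]_n :=
  \row_k (if (k < j)%N then h 0 k else 0).

Lemma row_trunc_step h (j : 'I_n) :
  row_trunc h j.+1 = row_trunc h j + h 0 j *: basis_vec j.
Proof.
apply/rowP => k; rewrite !mxE eqxx/= ltnS.
case: (ltngtP k j) => [kj|kj|/val_inj->]; last by rewrite eqxx mulr1 add0r.
  by rewrite (_ : (k == j) = false) ?mulr0 ?addr0//; apply/negbTE/eqP => E; rewrite E ltnn in kj.
by rewrite (_ : (k == j) = false) ?mulr0 ?addr0//; apply/negbTE/eqP => E; rewrite E ltnn in kj.
Qed.

(** In the telescoped increment each coordinate step has, by the mean value theorem, an error of at
    most e / (n + 1) times |h|, and there are n steps. Dividing by n + 1 covers dimension 0. *)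
Lemma partial_differentiable f (x : 'rV[R]_n) :
  (forall k, \forall y \near x, derivable f y (basis_vec k)) ->
  (forall k, {for x, continuous (fun y => 'D_(basis_vec k) f y)}) ->
  differentiable f x /\ forall v, 'D_v f x = \sum_k v 0 k * 'D_(basis_vec k) f x.
Proof.
move=> df cf; pose c k := 'D_(basis_vec k) f x.
have [|df' D] := @differentiable_eps _ _ _ f (row_form c) x (@row_form_continuous c).
  move=> e e0.
  have e1 : 0 < e / n.+1%:R by rewrite divr_gt0.
  have : \forall y \near x, forall k, derivable f y (basis_vec k) /\
      `|'D_(basis_vec k) f y - c k| <= e / n.+1%:R.
    apply: (@filter_forall _ _ (fun k y => derivable f y (basis_vec k) /\
      `|'D_(basis_vec k) f y - c k| <= e / n.+1%:R) _ (nbhs_filter x)) => k.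
    have /cvgrPdist_le/(_ _ e1) := cf k; apply: filterS2 (df k) => y dy.
    by rewrite distrC.
  move=> /nbhs_ballP[r /= r0 Hr].
  apply/nbhs_ballP; exists r => //= h; rewrite -ball_normE /ball_/= sub0r normrN => hr.
  have Hj (j : 'I_n) : `|f (x + row_trunc h j.+1) - f (x + row_trunc h j) - h 0 j * c j|
      <= e / n.+1%:R * `|h|.
    rewrite row_trunc_step addrA.
    apply: (@le_trans _ _ (e / n.+1%:R * `|h 0 j|)); last first.
      by rewrite ler_pM2l//; exact: coord_norm_le.
    apply: derive_mean_value => s hs.
    suff Hb : ball x r (x + row_trunc h j + s *: basis_vec j) by have := Hr _ Hb j.
     rewrite -ball_normE /ball_/= -addrA opprD addNKr normrN.
    apply: le_lt_trans hr; apply: row_norm_le => // k.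
    rewrite !mxE eqxx/=; case: (ltnP k j) => kj.
      rewrite (_ : (k == j) = false) ?mulr0 ?addr0; first exact: coord_norm_le.
      by apply/negbTE/eqP => E; rewrite E ltnn in kj.
    rewrite add0r; case: eqP => [_|_]; last by rewrite mulr0 normr0.
    by rewrite mulr1; apply: (le_trans hs); exact: coord_norm_le.
  have -> : f (h + x) - (f x + row_form c h) = \sum_(j < n)
     (f (x + row_trunc h j.+1) - f (x + row_trunc h j) - h 0 j * c j).
    rewrite big_split/= sumrN -/(row_form c h).
    rewrite -(big_mkord xpredT (fun j => f (x + row_trunc h j.+1) - f (x + row_trunc h j))).
    rewrite telescope_sumr//.
    have -> : row_trunc h n = h by apply/rowP => k; rewrite !mxE ltn_ord.
    have -> : row_trunc h 0 = 0 by apply/rowP => k; rewrite !mxE.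
    by rewrite addr0 (addrC h) opprD addrA.
  apply: (le_trans (ler_norm_sum _ _ _)).
  apply: (le_trans (ler_sum _ (fun j _ => Hj j))).
  have -> : \sum_(i < n) e / n.+1%:R * `|h| = (n%:R / n.+1%:R) * (e * `|h|).
    by rewrite sumr_const card_ord -[LHS]mulr_natl; ring.
  by rewrite ler_piMl ?mulr_ge0 ?(ltW e0)// ler_pdivrMr// mul1r ler_nat.
by split=> // v; rewrite deriveE// D.
Qed.

Lemma C1_on_partial U f : open U ->
  (forall k x, U x -> derivable f x (basis_vec k)) ->
  (forall k x, U x -> {for x, continuous (fun y => 'D_(basis_vec k) f y)}) ->
  C1_on U f.
Proof.
move=> oU df cf.
have H x : U x -> differentiable f x /\ forall v, 'D_v f x = \sum_k v 0 k * 'D_(basis_vec k) f x.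
  by move=> Ux; apply: partial_differentiable => k; [exact: open_near (df k)|exact: cf].
apply: (@C1_on_intro _ _ _ _ (fun v x : 'rV[R]_n => \sum_k v 0 k * 'D_(basis_vec k) f x)) => //.
- by move=> x /H[].
- by move=> v x /H[].
- move=> v x Ux; apply: (continuous_sumr (f := fun k (y : 'rV[R]_n) => v 0 k * 'D_(basis_vec k) f y)) => k.
  by apply: continuousM; [exact: cst_continuous|exact: cf].
Qed.

Lemma smooth_on_C1 U f : open U -> smooth_on U f -> C1_on U f.
Proof.
move=> oU sf; apply: C1_on_partial => // k x Ux; first exact: (sf [::] x Ux).2.
exact: (sf [:: k] x Ux).1.
Qed.

Lemma smooth_on_partial U f k : smooth_on U f ->
  smooth_on U (fun x => 'D_(basis_vec k) f x).
Proof.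
(* The last letter of a word is the first derivative that [foldr] takes, hence [rcons]. *)
move=> sf s x Ux; have := sf (rcons s k) x Ux.
by rewrite /iter_partial foldr_rcons.
Qed.

Lemma derive_sum_basis f x v : differentiable f x ->
  'D_v f x = \sum_k v 0 k * 'D_(basis_vec k) f x.
Proof.
move=> df; rewrite deriveE// {1}[v]row_sum_basis linear_sum; apply: eq_bigr => k _.
by rewrite linearZ/= deriveE.
Qed.

Lemma row_differentiable {V : normedModType R} (F : V -> 'rV[R]_n) x :
  (forall k, differentiable (fun y => F y 0 k) x) -> differentiable F x.
Proof.
move=> dF; rewrite (_ : F = \sum_k (fun y => F y 0 k *: basis_vec k)).
  by apply: differentiable_sum => k; exact: differentiableZl.
by apply/funext => y; rewrite {1}[F y]row_sum_basis fct_sumE.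
Qed.

Lemma row_derive {V : normedModType R} (F : V -> 'rV[R]_n) x v k :
  differentiable F x -> ('D_v F x) 0 k = 'D_v (fun y => F y 0 k) x.
Proof. by move=> dF; rewrite derive_mx ?mxE//; exact: diff_derivable. Qed.

Lemma C1_on_comp_row {V : normedModType R} (U : set V) (U' : set 'rV[R]_n)
   (F : V -> 'rV[R]_n) f : open U -> (forall x, U x -> U' (F x)) ->
  (forall k, C1_on U (fun x => F x 0 k)) -> C1_on U' f -> C1_on U (f \o F).
Proof.
move=> oU UU' CF Cf.
have dF x : U x -> differentiable F x.
  by move=> Ux; apply: row_differentiable => k; have [] := CF k x Ux.
apply: (@C1_on_intro _ _ _ _ (fun v x => \sum_k 'D_v (fun y => F y 0 k) x *
    'D_(basis_vec k) f (F x))) => //.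
- by move=> x Ux; apply: differentiable_comp; [exact: dF|have [] := Cf _ (UU' _ Ux)].
- move=> v x Ux; have [df _] := Cf _ (UU' _ Ux).
  rewrite derive_comp//; last exact: dF.
  rewrite derive_sum_basis//; apply: eq_bigr => k _.
  by rewrite row_derive//; exact: dF.
- move=> v x Ux; apply: (continuous_sumr (f := fun k (y : V) => 'D_v (fun z => F z 0 k) y *
    'D_(basis_vec k) f (F y))) => k.
  apply: continuousM; first exact: (CF k x Ux).2.
  apply: (@continuous_comp _ _ _ F (fun y => 'D_(basis_vec k) f y)).
    exact: differentiable_continuous (dF x Ux).
  exact: (Cf _ (UU' _ Ux)).2.
Qed.

End PartialDerivatives.

Section Restriction.
Context {R : realType} {V : normedModType R}.

Lemma near_derive (U : set V) (f g : V -> R) x v : open U -> U x ->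
  (forall x, U x -> f x = g x) -> 'D_v f x = 'D_v g x.
Proof.
move=> oU Ux fg; have [->|v0] := eqVneq v 0; first by rewrite !derive0.
by apply: near_eq_derive => //; exact: open_near fg.
Qed.

Lemma C1_on_restrict (U K : set V) (f : V -> R) : open U -> closed K -> K `<=` U ->
  (forall x, U x -> ~ K x -> f x = 0) -> C1_on U f ->
  C1_on setT (f \_ U) /\ forall v x, 'D_v (f \_ U) x = ((fun y => 'D_v f y) \_ U) x.
Proof.
move=> oU cK KU f0 Cf.
have fU x : U x -> f x = (f \_ U) x by move=> Ux; rewrite patchE mem_set.
have f0' x : (~` K) x -> cst 0 x = (f \_ U) x.
  rewrite patchE => nK; case: ifPn => // /set_mem Ux; by rewrite f0.
have oK : open (~` K) by exact: closed_openC.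
split=> [x _|v x].
  have [Ux|nUx] := pselect (U x); first exact: (C1_on_near oU fU Cf Ux).
  have nK : (~` K) x by move=> /KU.
  exact: (C1_on_near oK f0' (@C1_on_cst _ _ (~` K) 0) nK).
rewrite [RHS]patchE; case: ifPn => [/set_mem Ux|/negP nUx].
  by rewrite -(near_derive v oU Ux fU).
have nK : (~` K) x by move=> /KU /mem_set.
by rewrite -(near_derive v oK nK f0') derive_cst.
Qed.

End Restriction.

(** * Steps and bumps of class C^1 *)

Section SmoothStep.
Context {R : realType}.

Lemma is_derive_pos_sqr (x : R) :
  is_derive x 1 (fun t => Num.max 0 t ^+ 2) (2 * Num.max 0 x).
Proof.
have [x0|x0|x0] := ltgtP x 0.
- rewrite mulr0.
  apply: (@near_eq_is_derive _ _ _ (cst 0)) => //.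
    by apply: open_near (open_lt (y := 0)) x0 _ => y /= y0; rewrite max_l ?expr0n// ltW.
  apply: (@near_eq_is_derive _ _ _ (fun t : R => t ^+ 2)).
    by apply: open_near (open_gt (y := 0)) x0 _ => y /= y0; rewrite max_r// ltW.
  by apply: is_derive_eq; rewrite /= -![_ *: _]/(_ * _); ring.
(* At the corner the difference quotient of the squared positive part is the positive part itself,
   which is continuous. *)
- rewrite x0 mulr0; apply/is_derive1_caratheodory.
  exists (fun z => Num.max 0 z); split; last by rewrite maxxx.
    by move=> z; rewrite maxxx; case: (leP 0 z) => z0; ring.
  by apply: continuous_max; [exact: cst_continuous|exact: cvg_id].
Qed.

(** The quadratic spline whose derivative is the tent of height 2 on [0, 1]. It rises from 0 to 1
    and is flat outside [0, 1]; it serves as profile of the bumps and as a reparametrization that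
    lets curves start and stop at rest. *)
Definition smoothstep (x : R) : R :=
  2 * Num.max 0 x ^+ 2 - 4 * Num.max 0 (x - 2^-1) ^+ 2 + 2 * Num.max 0 (x - 1) ^+ 2.

Definition dsmoothstep (x : R) : R :=
  4 * Num.max 0 x - 8 * Num.max 0 (x - 2^-1) + 4 * Num.max 0 (x - 1).

Lemma is_derive_smoothstep (x : R) : is_derive x 1 smoothstep (dsmoothstep x).
Proof.
have H (c : R) : is_derive x 1 (fun t => Num.max 0 (t - c) ^+ 2) (2 * Num.max 0 (x - c)).
  have D : is_derive x 1 (fun t : R => t - c) 1.
    by apply: is_derive_eq; rewrite subr0.
  have dt : differentiable (fun t : R => t - c) x by apply/derivable1_diffP; have [] := D.
  have [dd dv] := is_derive_pos_sqr (x - c).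
  have E : (fun t => Num.max 0 (t - c) ^+ 2) =
    (fun t => Num.max 0 t ^+ 2) \o (fun t => t - c) by [].
  split.
    apply/derivable1_diffP; rewrite E; apply: differentiable_comp => //.
    exact/derivable1_diffP.
  by rewrite E derive_comp1// dv derive_val mul1r.
have H0 := is_derive_pos_sqr x; have H1 := H 2^-1; have H2 := H 1.
rewrite /smoothstep; apply: is_derive_eq.
by rewrite /dsmoothstep; rewrite -![_ *: _]/(_ * _); ring.
Qed.

Lemma dsmoothstep_continuous : continuous (dsmoothstep : R -> R).
Proof.
have H (c x : R) : {for x, continuous (fun x : R => Num.max 0 (x - c))}.
  apply: (@continuous_max _ _ (cst 0) (fun x : R => x - c) x); first exact: continuous_cst_at.
  by apply: continuousB_at; [exact: cvg_id|exact: continuous_cst_at].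
have H0 (x : R) : {for x, continuous (fun x : R => Num.max 0 x)}.
  by apply: (@continuous_max _ _ (cst 0) id x); [exact: continuous_cst_at|exact: cvg_id].
apply: continuous_pointwise => x; apply: continuousD_at; last by apply: continuousM_at; [exact: continuous_cst_at|exact: H].
by apply: continuousB_at; apply: continuousM_at; [exact: continuous_cst_at|exact: H0|exact: continuous_cst_at|exact: H].
Qed.

Lemma smoothstep_C1 : C1_on setT smoothstep.
Proof.
apply: (@C1_on_intro _ _ _ _ (fun v x : R => v * dsmoothstep x)) => //.
- exact: openT.
- by move=> x _; apply/derivable1_diffP; have [] := is_derive_smoothstep x.
- move=> v x _; have [dd dv] := is_derive_smoothstep x.
  rewrite -[smoothstep in LHS]/(smoothstep \o id) derive_comp1 ?derive_id ?dv//.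
- by move=> v x _; apply: continuousM_at; [exact: continuous_cst_at|exact: dsmoothstep_continuous].
Qed.

Lemma smoothstep_le0 x : x <= 0 -> smoothstep x = 0.
Proof. by move=> x0; rewrite /smoothstep !max_l; lra. Qed.

Lemma smoothstep_ge1 x : 1 <= x -> smoothstep x = 1.
Proof. by move=> x1; rewrite /smoothstep !max_r; lra. Qed.

Lemma dsmoothstep_ge0 x : 0 <= dsmoothstep x.
Proof.
by rewrite /dsmoothstep; case: (leP 0 x) => ?; case: (leP 0 (x - 2^-1)) => ?;
  case: (leP 0 (x - 1)) => ?; lra.
Qed.

Lemma dsmoothstep_out x : x <= 0 \/ 1 <= x -> dsmoothstep x = 0.
Proof.
by move=> [?|?]; rewrite /dsmoothstep; [rewrite !max_l; lra|rewrite !max_r; lra].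
Qed.

Lemma smoothstep_01 x : 0 <= smoothstep x <= 1.
Proof.
by rewrite /smoothstep; case: (leP 0 x) => ?; case: (leP 0 (x - 2^-1)) => ?;
  case: (leP 0 (x - 1)) => ?; apply/andP; split; nra.
Qed.

End SmoothStep.

Section Bump.
Context {R : realType} {n : nat}.

(** A product over the coordinates because row vectors carry the maximum norm. With t = (y_k - x_k)
    / r both steps equal 1 for |t| <= 1/2, and one of them vanishes for |t| >= 1. *)
Definition bump (x : 'rV[R]_n) (r : R) (y : 'rV[R]_n) : R :=
  \prod_k (smoothstep (2 - 2 * ((y 0 k - x 0 k) / r)) *
           smoothstep (2 + 2 * ((y 0 k - x 0 k) / r))).

Lemma bump_C1 x r : C1_on setT (bump x r).
Proof.
apply: C1_on_prod => [|k _]; first exact: openT.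
have C0 (a b c : R) : C1_on setT (fun y : 'rV[R]_n => a + b * ((y 0 k - x 0 k) / c)).
  apply: C1_onD; [exact: openT|exact: C1_on_cst|].
  apply: C1_onM; [exact: openT|exact: C1_on_cst|].
  apply: C1_onM; [exact: openT| |exact: C1_on_cst].
  apply: (@C1_onD _ _ _ (fun y : 'rV[R]_n => y 0 k) (cst (- x 0 k))); [exact: openT| |exact: C1_on_cst].
  apply: (@C1_on_intro _ _ _ _ (fun v y : 'rV[R]_n => v 0 k)) => //.
  - exact: openT.
  - by move=> y _; exact: differentiable_coord.
  - move=> v y _; rewrite -(@row_derive _ _ _ id y v k) ?derive_id//.
  - by move=> v y _; exact: continuous_cst_at.
have CS (f : 'rV[R]_n -> R) : C1_on setT f -> C1_on setT (smoothstep \o f).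
  move=> Cf; apply: (@C1_on_comp1 _ _ _ setT) => //; first exact: openT.
  move=> t _; have [dd _] := is_derive_smoothstep t; split=> //.
  exact: (smoothstep_C1 I).2.
apply: C1_onM; [exact: openT| |exact: (CS _ (C0 2 2 r))].
have := CS _ (C0 2 (-2) r); congr (C1_on _ _).
by apply/funext => y /=; congr smoothstep; ring.
Qed.

Lemma bump_01 x r y : 0 <= bump x r y <= 1.
Proof.
have H k : 0 <= smoothstep (2 - 2 * ((y 0 k - x 0 k) / r)) *
           smoothstep (2 + 2 * ((y 0 k - x 0 k) / r)) <= 1.
  have /andP[a0 a1] := smoothstep_01 (2 - 2 * ((y 0 k - x 0 k) / r)).
  have /andP[b0 b1] := smoothstep_01 (2 + 2 * ((y 0 k - x 0 k) / r)).
  by rewrite mulr_ge0//= mulr_ile1.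
apply: (big_ind (fun t : R => 0 <= t <= 1)) => [|a b /andP[a0 a1] /andP[b0 b1]|k _].
- by rewrite ler01 lexx.
- by rewrite mulr_ge0//= mulr_ile1.
- exact: H.
Qed.

Lemma bump1 x r y : 0 < r -> `|y - x| <= r / 2 -> bump x r y = 1.
Proof.
move=> r0 h; rewrite /bump big1// => k _.
have : `|(y 0 k - x 0 k) / r| <= 2^-1.
  rewrite normrM normfV (gtr0_norm r0) ler_pdivrMr// mulrC.
  by apply: le_trans h; have := coord_norm_le (y - x) k; rewrite !mxE.
by set t := (_ / r); rewrite ler_norml => /andP[h1 h2]; rewrite !smoothstep_ge1 ?mulr1//; lra.
Qed.

Lemma bump0 x r y : 0 < r -> r <= `|y - x| -> bump x r y = 0.
Proof.
move=> r0 h.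
have [k hk] : exists k, r <= `|y 0 k - x 0 k|.
  apply: contrapT => /forallNP H.
  have : `|y - x| < r.
    rewrite /Num.Def.normr/= mx_normrE; apply: bigmax_lt => // -[i k] _ /=.
    by rewrite ord1 !mxE ltNge; apply/negP; exact: H.
  by rewrite ltNge h.
have : 1 <= `|(y 0 k - x 0 k) / r| by rewrite normrM normfV (gtr0_norm r0) ler_pdivlMr ?mul1r.
rewrite /bump (bigD1 k)//=; set t := (_ / r); rewrite ler_normr => /orP[h1|h1].
  have -> : smoothstep (2 - 2 * t) = 0 by apply: smoothstep_le0; lra.
  by rewrite !mul0r.
have -> : smoothstep (2 + 2 * t) = 0 by apply: smoothstep_le0; lra.
by rewrite mulr0 mul0r.
Qed.

End Bump.

(** * Lebesgue measure on row vectors *)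

Section BorelMeasurability.

Lemma borel_open (T : ptopologicalType) (U : set T) : open U -> measurable (U : set (borel T)).
Proof. by move=> oU; exact: sub_sigma_algebra. Qed.

Lemma borel_closed (T : ptopologicalType) (U : set T) : closed U -> measurable (U : set (borel T)).
Proof.
by move=> cU; rewrite -[U]setCK; apply: measurableC; apply: borel_open; exact: closed_openC.
Qed.

Lemma continuous_borelR (R : realType) (T : ptopologicalType) (f : T -> R) : continuous f ->
  measurable_fun setT (f : borel T -> R).
Proof.
move=> /continuousP cf; apply: (measurability _ (RGenOpens.measurableE R)).
by move=> _ [_ [a [b ->] <-]]; rewrite setTI; apply: borel_open; exact/cf/interval_open.
Qed.

(** Chart parametrizations and densities are continuous on an open set and extended by a constant.
    The preimage of an open set is then open, possibly enlarged by the closed complement of [D]. *)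
Lemma patch_borel (T U : ptopologicalType) (D : set T) (f : T -> U) (c : U) : open D ->
  (forall x, D x -> {for x, continuous f}) ->
  measurable_fun setT ((fun x => if x \in D then f x else c) : borel T -> borel U).
Proof.
move=> oD cf; apply: (@measurability _ _ (borel T) (borel U) _ _ (@open U)) => //.
move=> _ [B oB <-]; rewrite setTI.
have -> : (fun x => if x \in D then f x else c) @^-1` B =
    (D `&` f @^-1` B) `|` (if c \in B then ~` D else set0).
  apply/seteqP; split=> x /=.
    case: ifPn => [/set_mem Dx Bx|/negP nD Bc]; first by left.
    by right; rewrite mem_set//= => Dx; apply: nD; exact: mem_set.
  case=> [[Dx Bx]|]; first by rewrite mem_set.
  case: ifPn => [/set_mem Bc /= nDx|//].
  by case: ifPn => // /set_mem.
apply: measurableU.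
  apply: borel_open; rewrite openE => x /= [Dx Bx].
  apply: filterI; first exact: open_nbhs_nbhs.
  by apply: (cf x Dx); exact: open_nbhs_nbhs.
case: ifPn => _; last exact: measurable0.
by apply: borel_closed; exact: open_closedC.
Qed.

Lemma patch_borelR (R : realType) (T : ptopologicalType) (D : set T) (f : T -> R) (c : R) : open D ->
  (forall x, D x -> {for x, continuous f}) ->
  measurable_fun setT ((fun x => if x \in D then f x else c) : borel T -> R).
Proof.
move=> oD cf.
apply: (@measurableT_comp _ _ _ (borel T) (borel R) R (fun x => x)); last exact: patch_borel.
by apply: continuous_borelR => x; exact: cvg_id.
Qed.

End BorelMeasurability.

Section BorelRow.
Context {R : realType} {n : nat}.

Let cube (p : 'rV[rat]_n * nat) : set 'rV[R]_n :=
  [set y | forall k, `|y 0 k - ratr (p.1 0 k)| < p.2.+1%:R^-1].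

(** Cubes with rational centres and radii 1 / (N + 1) form a countable base, which reduces
    measurability of a row-valued map to that of its coordinates. *)
Lemma open_bigcup_cubes (U : set 'rV[R]_n) : open U ->
  U = \bigcup_(p in [set p | cube p `<=` U]) cube p.
Proof.
move=> oU; apply/seteqP; split=> [x Ux|x [p pU px]]; last exact: pU.
have /nbhs_ballP[r /= r0 rU] : nbhs x U by exact: open_nbhs_nbhs.
(* Both [x] and any point of the cube will be within 1 / (N + 1) < r / 2 of the rational centre. *)
have [N] := ltr_add_invr (y := 0) (divr_gt0 r0 (ltr0n R 2)); rewrite add0r => hN.
have N0 : 0 < N.+1%:R^-1 :> R by rewrite invr_gt0.
have /choice[q hq] : forall k, exists q : rat, `|x 0 k - ratr q| < N.+1%:R^-1.
  move=> k.
  have /rat_in_itvoo[q] : x 0 k - N.+1%:R^-1 < x 0 k + N.+1%:R^-1.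
    by rewrite ltrBlDr -addrA ltrDl addr_gt0.
  by rewrite in_itv/= => /andP[q1 q2]; exists q; rewrite ltr_distlC; apply/andP.
exists (\row_k q k, N) => [y /= hy|k /=]; last by rewrite mxE.
apply: rU; rewrite -ball_normE /ball_/=.
apply: (@le_lt_trans _ _ (N.+1%:R^-1 + N.+1%:R^-1)); last by rewrite [ltRHS]splitr ltrD.
apply: row_norm_le => [|k]; first by rewrite addr_ge0// ltW.
rewrite !mxE -[_ - _](subrKA (ratr (q k))); apply: (le_trans (ler_normD _ _)).
apply: lerD; first exact: ltW.
by have := hy k; rewrite mxE distrC => /ltW.
Qed.

Lemma measurable_row d (T : measurableType d) (f : T -> 'rV[R]_n) :
  (forall k, measurable_fun setT (fun x => f x 0 k)) ->
  measurable_fun setT (f : T -> borel 'rV[R]_n).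
Proof.
move=> mf; apply: (@measurability _ _ T (borel 'rV[R]_n) _ _ (@open 'rV[R]_n)) => //.
move=> _ [U oU <-]; rewrite setTI (open_bigcup_cubes oU) preimage_bigcup bigcup_mkcond.
apply: countable_bigcupT_measurable; first exact: countableP.
move=> p; case: ifPn => _; last exact: measurable0.
have -> : f @^-1` cube p = \bigcap_(k in [set: 'I_n])
    ((fun x => f x 0 k) @^-1` (ball (ratr (p.1 0 k) : R) p.2.+1%:R^-1)).
  apply/seteqP; split=> [x /= h k _|x h k]; first by rewrite /= -ball_normE /ball_/= distrC.
  by have := h k I; rewrite /= -ball_normE /ball_/= distrC.
apply: fin_bigcap_measurable => // k _; rewrite -[X in measurable X]setTI; apply: mf => //.
by apply: open_measurable; exact: ball_open.
Qed.

Lemma measurable_coord k : measurable_fun setT ((fun y : 'rV[R]_n => y 0 k) : borel 'rV[R]_n -> R).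
Proof. by apply: continuous_borelR; exact: coord_continuous. Qed.

End BorelRow.

Section MeasurePreserving.
Local Open Scope ereal_scope.
Context d (T : measurableType d) (R : realType) (mu : {measure set T -> \bar R}).
Variable phi : T -> T.
Hypothesis mphi : measurable_fun setT phi.
Hypothesis phi_mu : forall A, measurable A -> mu (phi @^-1` A) = mu A.

Lemma ge0_integral_preserving (f : T -> \bar R) : measurable_fun setT f ->
  (forall x, 0 <= f x) -> \int[mu]_x f (phi x) = \int[mu]_x f x.
Proof.
move=> mf f0.
have := @ge0_integral_pushforward _ _ _ _ R phi mphi mu setT f measurableT mf (fun y _ => f0 y).
rewrite preimage_setT => <-; apply: eq_measure_integral => A mA _.
exact: phi_mu.
Qed.

Lemma integral_preserving (f : T -> \bar R) : measurable_fun setT f ->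
  \int[mu]_x f (phi x) = \int[mu]_x f x.
Proof.
move=> mf; rewrite integralE [RHS]integralE.
have E1 : (fun x => f (phi x))^\+ = (f^\+ \o phi) := funepos_comp f phi.
have E2 : (fun x => f (phi x))^\- = (f^\- \o phi) := funeneg_comp f phi.
rewrite E1 E2; congr (_ - _).
- by apply: ge0_integral_preserving => //; exact: measurable_funepos.
- by apply: ge0_integral_preserving => //; exact: measurable_funeneg.
Qed.

End MeasurePreserving.

Section SigmaFiniteOf.
Context d (T : measurableType d) (R : realType) (mu : {measure set T -> \bar R}).

(** An alias that carries the proof [sf], so that a sigma-finite structure can be attached to a
    measure obtained from an existential statement; product measures ask for it. *)
Definition sigma_finite_of of sigma_finite setT mu : set T -> \bar R := mu.

Variable sf : sigma_finite setT mu.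
HB.instance Definition _ := Measure.copy (sigma_finite_of sf) mu.
HB.instance Definition _ := Measure_isSigmaFinite.Build _ _ _ (sigma_finite_of sf) sf.

End SigmaFiniteOf.

Section LebesgueRow.
Context {R : realType}.
Local Notation leb := (@lebesgue_measure R).

(** By uniqueness of Lebesgue measure: the pushforward under the translation gives half-open
    intervals their length. *)
Lemma lebesgue_measure_shift (c : R) (A : set (measurableTypeR R)) : measurable A ->
  leb ((fun t => t + c) @^-1` A) = leb A.
Proof.
move=> mA.
have mf : measurable_fun setT ((fun t : R => t + c) : measurableTypeR R -> measurableTypeR R).
  by apply: measurable_funD.
apply/esym/(@lebesgue_measure_unique R
  (measure_function_pushforward__canonical__measure_function_Measure leb mf)) => //=.
move=> _ [[a b]] _ <-; rewrite /pushforward.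
have -> : (fun t : R => t + c) @^-1` `]a, b]%classic = `](a - c)%R, (b - c)%R]%classic.
  by apply/seteqP; split=> t /=; rewrite !in_itv/= ltrBlDr lerBrDr.
rewrite !lebesgue_measure_itv/= !lte_fin ltrD2r.
by case: ifPn => // _; rewrite -!EFinB; congr EFin; ring.
Qed.

Lemma row_mx_measurable m : measurable_fun setT
  ((fun p : R * 'rV[R]_m => row_mx (p.1%:M : 'M[R]_1) p.2) :
    (measurableTypeR R * borel 'rV[R]_m)%type -> borel 'rV[R]_(1 + m)).
Proof.
apply: measurable_row => k.
case: (split_ordP k) => j ->.
  rewrite (_ : (fun x => _) = fst); first exact: measurable_fst.
  by apply/funext => p; rewrite row_mxEl mxE ord1 eqxx.
rewrite (_ : (fun x => _) = (fun y : 'rV[R]_m => y 0 j) \o snd).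
  exact: (measurableT_comp (@measurable_coord R m j) (@measurable_snd _ _ (measurableTypeR R) (borel 'rV[R]_m))).
by apply/funext => p; rewrite row_mxEr.
Qed.

Lemma shift_measurable n (v : 'rV[R]_n) :
  measurable_fun setT ((fun x => x + v) : borel 'rV[R]_n -> borel 'rV[R]_n).
Proof.
apply: measurable_row => k.
rewrite (_ : (fun x => _) = fun x : 'rV[R]_n => x 0 k + v 0 k); last by apply/funext => x; rewrite mxE.
by apply: measurable_funD; [exact: measurable_coord|exact: measurable_cst].
Qed.

Lemma norm_row_mx m (t : R) (v : 'rV[R]_m) (M : R) : 0 <= M ->
  (`|row_mx (t%:M : 'M[R]_1) v| <= M) = (`|t| <= M) && (`|v| <= M).
Proof.
move=> M0; apply/idP/andP => [h|[ht hv]].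
  split.
    have := le_trans (coord_norm_le (row_mx t%:M v) (lshift m 0)) h.
    by rewrite row_mxEl mxE eqxx.
  apply: row_norm_le => // k.
  have := le_trans (coord_norm_le (row_mx (t%:M : 'M[R]_1) v) (rshift 1 k)) h.
  by rewrite row_mxEr.
apply: row_norm_le => // k; case: (split_ordP k) => j ->.
  by rewrite row_mxEl mxE ord1 eqxx.
by rewrite row_mxEr; apply: le_trans hv; exact: coord_norm_le.
Qed.

Lemma closed_norm_le n (M : R) : closed [set x : 'rV[R]_n | `|x| <= M].
Proof.
rewrite (_ : [set _ | _] = (fun x : 'rV[R]_n => `|x|) @^-1` [set t | t <= M])//.
by apply: closed_comp; [move=> x _; exact: norm_continuous|exact: closed_le].
Qed.

(** The iterated integral that prescribes volumes is realized as integration against a measure,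
    built by induction: a Dirac mass in dimension 0, then the pushforward under [row_mx] of the
    product with the line. The chart formula uses the second property, integration by parts the
    other two. *)
Lemma lebesgue_rV_exists n : exists mu : {measure set (borel 'rV[R]_n) -> \bar R},
  [/\ forall M : R, (mu [set x : 'rV[R]_n | (`|x| <= M)%R] < +oo)%E,
      forall f, measurable_fun setT (f : borel 'rV[R]_n -> \bar R) ->
        (forall x, 0 <= f x)%E -> integral_rV f = (\int[mu]_x f x)%E &
      forall (v : 'rV[R]_n) (A : set (borel 'rV[R]_n)), measurable A -> mu ((fun x : 'rV[R]_n => x + v) @^-1` A) = mu A].
Proof.
elim: n => [|m [mu [mu_fin mu_int mu_shift]]].
  exists (dirac (0 : borel 'rV[R]_0)); split=> [M|f mf f0|v A mA].
  - by rewrite /= diracE ltry.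
  - by rewrite integral_dirac//= diracT mul1e.
  - by rewrite (_ : (fun x => x + v) = id)//; apply/funext => x; rewrite thinmx0 [RHS]thinmx0.
have sf : sigma_finite setT mu.
  exists (fun k => [set x | `|x| <= k%:R]).
    apply/esym; rewrite -subTset => x _; exists (Num.truncn `|x|).+1 => //=.
    exact/ltW/truncnS_gt.
  by move=> k; split=> //; apply: borel_closed; exact: closed_norm_le.
pose mu' : {sigma_finite_measure set (borel 'rV[R]_m) -> \bar R} := sigma_finite_of sf.
pose nu : {measure set (borel 'rV[R]_m.+1) -> \bar R} :=
  measure_function_pushforward__canonical__measure_function_Measure (leb \x mu')%E
   (@row_mx_measurable m).
have nuE f : measurable_fun setT (f : borel 'rV[R]_m.+1 -> \bar R) ->
    (forall x, 0 <= f x)%E ->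
    (\int[nu]_x f x = \int[leb]_t \int[mu']_v f (row_mx (t%:M : 'M[R]_1) v))%E.
  move=> mf f0.
  rewrite (ge0_integral_pushforward (@row_mx_measurable m))//=.
  rewrite preimage_setT (@fubini_tonelli1 _ _ _ _ _ leb mu')//=.
  exact: (measurableT_comp mf (@row_mx_measurable m)).
have msec f t : measurable_fun setT (f : borel 'rV[R]_m.+1 -> \bar R) ->
  measurable_fun setT ((fun v => f (row_mx (t%:M : 'M[R]_1) v)) : borel 'rV[R]_m -> \bar R).
  move=> mf; apply: (measurableT_comp mf).
  exact: (measurableT_comp (@row_mx_measurable m) (@measurable_pair1 _ _ (measurableTypeR R) (borel 'rV[R]_m) t)).
exists nu; split=> [M|f mf f0|v A mA].
- have [M0|M0] := ltP M 0.
    rewrite (_ : [set _ | _] = set0) ?measure0 ?ltry//.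
    by apply/seteqP; split=> x //=; rewrite leNgt (lt_le_trans M0).
  rewrite /nu/= /pushforward.
  rewrite (_ : _ @^-1` _ = [set t : R | `|t| <= M] `*` [set v : 'rV[R]_m | `|v| <= M]); last first.
    by apply/seteqP; split=> -[t v] /=; rewrite norm_row_mx//; [move=> /andP[]|move=> [-> ->]].
  have E : [set t : R | `|t| <= M] = `[- M, M]%classic.
    by apply/seteqP; split=> t /=; rewrite in_itv/= ler_norml.
  rewrite E product_measure1E//; last by apply: borel_closed; exact: closed_norm_le.
  have L : (leb `[(- M)%R, M]%classic \is a fin_num)%E.
    by rewrite lebesgue_measure_itv/=; case: ifPn.
  by apply: lte_mul_pinfty => //; exact: mu_fin.
- rewrite nuE// -[LHS]/(\int[leb]_t integral_rV (fun v : 'rV[R]_m => f (row_mx (t%:M : 'M[R]_1) v)))%E; apply: eq_integral => t _; rewrite mu_int//.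
  exact: msec.
- have mf : measurable_fun setT ((fun x => (\1_A x)%:E) : borel 'rV[R]_m.+1 -> \bar R).
    by apply/measurable_EFinP; exact: measurable_indic.
  have mf' : measurable_fun setT ((fun x => (\1_A (x + v))%:E) : borel 'rV[R]_m.+1 -> \bar R).
    exact: (measurableT_comp mf (shift_measurable v)).
  have mA' : measurable ((fun x => x + v) @^-1` A : set (borel 'rV[R]_m.+1)).
    by rewrite -[X in measurable X]setTI; exact: shift_measurable.
  have I (B : set (borel 'rV[R]_m.+1)) : measurable B -> nu B = (\int[nu]_x (\1_B x)%:E)%E.
    by move=> mB; rewrite integral_indic// setIT.
  rewrite (I _ mA) (I _ mA').
  rewrite (eq_integral (fun x : borel 'rV[R]_m.+1 => (\1_A ((x : 'rV[R]_m.+1) + v))%:E)) => [|x _]; last by rewrite !indicE.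
  have ge0 x : (0 <= (\1_A x)%:E :> \bar R)%E by rewrite lee_fin.
  rewrite (nuE _ mf ge0) (nuE _ mf' (fun x => ge0 _)).
  pose w : 'rV[R]_(1 + m) := v.
  pose v1 := w 0 (lshift m 0); pose v2 : 'rV[R]_m := \row_k w 0 (rshift 1 k).
  pose G (t : measurableTypeR R) := (\int[mu']_w (\1_A (row_mx (t%:M : 'M[R]_1) w))%:E)%E.
  have mG : measurable_fun setT G.
    pose h (p : measurableTypeR R * borel 'rV[R]_m) :=
      (\1_A (row_mx (p.1%:M : 'M[R]_1) (p.2 : 'rV[R]_m)))%:E : \bar R.
    have mh : measurable_fun setT h := measurableT_comp mf (@row_mx_measurable m).
    have h0 p : (0 <= h p)%E by rewrite lee_fin.
    by have := measurable_fun_fubini_tonelli_F (m2 := mu') h mh h0.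
  (* The inner integral absorbs the shift [v2] of the last m coordinates, the outer one the shift
     [v1] of the first. *)
  transitivity (\int[leb]_t G (t + v1)%R)%E.
    apply: eq_integral => t _; rewrite /G.
    rewrite -[RHS](@ge0_integral_preserving _ _ _ mu' (fun w => w + v2))//.
    * apply: eq_integral => z _; congr ((\1_A _)%:E).
      apply/(@rowP _ (1 + m)) => k; rewrite mxE; case: (split_ordP k) => j ->.
        rewrite (row_mxEl (t%:M : 'M[R]_1) z) row_mxEl [_%:M _ _]mxE [_%:M _ _]mxE ord1 eqxx.
        by [].
      by rewrite (row_mxEr (t%:M : 'M[R]_1) z) row_mxEr !mxE.
    * exact: shift_measurable.
    * by move=> B mB; exact: mu_shift.
    * exact: (msec (fun x => (\1_A x)%:E) (t + v1) mf).
  apply: (@ge0_integral_preserving _ _ _ leb (fun t => t + v1)) => //.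
  + exact: measurable_funD.
  + exact: lebesgue_measure_shift.
  + by move=> t; apply: integral_ge0 => z _; rewrite lee_fin.
Qed.

End LebesgueRow.

Lemma compact_continuous_bounded (R : realType) (T : topologicalType) (K : set T) (f : T -> R) :
  compact K -> (forall x, K x -> {for x, continuous f}) ->
  exists2 C, 0 <= C & forall x, K x -> `|f x| <= C.
Proof.
move=> cK cf.
have /compact_bounded[M [_ hM]] : compact (f @` K).
  apply: continuous_compact => //; apply: continuous_in_subspaceT => x.
  by rewrite inE; exact: cf.
exists (`|M| + 1) => [|x Kx]; first by rewrite addr_ge0.
by apply: (hM (`|M| + 1) _ (f x)); [rewrite (le_lt_trans (ler_norm M))// ltrDl|exists x].
Qed.

Lemma integrable_indic_fin d (T : measurableType d) (R : realType)
    (mu : {measure set T -> \bar R}) (B : set T) :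
  measurable B -> (mu B < +oo)%E -> mu.-integrable setT (fun x => (\1_B x)%:E).
Proof.
move=> mB muB; apply/integrableP; split; first exact/measurable_EFinP.
rewrite (eq_integral (fun x => (\1_B x)%:E)) => [|x _]; last by rewrite gee0_abs// lee_fin.
by rewrite integral_indic// setIT.
Qed.

Lemma bounded_support_integrable d (T : measurableType d) (R : realType)
    (mu : {measure set T -> \bar R}) (B : set T) (C : R) (f : T -> R) :
  measurable B -> (mu B < +oo)%E -> measurable_fun setT f ->
  (forall x, `|f x| <= C) -> (forall x, ~ B x -> f x = 0) ->
  mu.-integrable setT (EFin \o f).
Proof.
move=> mB muB mf fC f0.
have iB : mu.-integrable setT (fun x => (C%:E * (\1_B x)%:E)%E).
  by apply: integrableZl => //; exact: integrable_indic_fin.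
apply: le_integrable iB => //; first exact/measurable_EFinP.
move=> x _ /=; rewrite lee_fin indicE.
have [Bx|nBx] := pselect (B x).
  by rewrite mem_set//= mulr1; apply: le_trans (fC x) _; exact: ler_norm.
by rewrite f0// normr0.
Qed.

(** * Integration by parts against a function without derivative *)

Section IntegrationByParts.
Context {R : realType} {n : nat} (mu : {measure set (borel 'rV[R]_n) -> \bar R}).
Hypothesis mu_fin : forall M : R, (mu [set x : 'rV[R]_n | (`|x| <= M)%R] < +oo)%E.
Hypothesis mu_shift : forall (v : 'rV[R]_n) (A : set (borel 'rV[R]_n)),
  measurable A -> mu ((fun x : 'rV[R]_n => x + v) @^-1` A) = mu A.

(* Translating the difference quotient of [F] onto [phi] replaces a derivative
   of [phi], which need not exist, by a bound on its difference quotients. *)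
Lemma integral_by_parts_ge (phi F G : 'rV[R]_n -> R) (v : 'rV[R]_n) (M C delta : R) :
  0 < delta ->
  measurable_fun setT (phi : borel 'rV[R]_n -> R) -> (forall x, `|phi x| <= C) ->
  C1_on setT F -> (forall x, M < `|x| -> F x = 0) ->
  mu.-integrable setT (EFin \o (G : borel 'rV[R]_n -> R)) ->
  (forall t y, 0 < t < delta -> `|phi (y - t *: v) - phi y| * `|F y| <= t * G y) ->
  - (\int[mu]_y G y) <= \int[mu]_y (phi y * 'D_v F y).
Proof.
move=> delta0 mphi phiC CF F0 iG H.
have cF : continuous F by move=> x; exact: (C1_on_continuous CF).
have cDF : continuous (fun x => 'D_v F x) by move=> x; exact: (CF x I).2.
have mF : measurable_fun setT (F : borel 'rV[R]_n -> R) by exact: continuous_borelR.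
have mDF : measurable_fun setT ((fun x => 'D_v F x) : borel 'rV[R]_n -> R) by exact: continuous_borelR.
have cB (r : R) : compact [set x : 'rV[R]_n | `|x| <= r].
  apply: bounded_closed_compact; last exact: closed_norm_le.
  by exists r; split; [exact: num_real|move=> s rs x /= /le_trans; apply; exact: ltW].
have mB (r : R) : measurable ([set x : 'rV[R]_n | `|x| <= r] : set (borel 'rV[R]_n)).
  by apply: borel_closed; exact: closed_norm_le.
have C0 : 0 <= C by apply: le_trans (phiC 0).
have [CF0 CF0_ge0 hCF0] : exists2 c, 0 <= c & forall x, `|F x| <= c.
  have [c c0 hc] := compact_continuous_bounded (cB M) (fun x _ => cF x).
  by exists c => // x; case: (leP `|x| M) => [/hc//|/F0->]; rewrite normr0.
have oM : open [set x : 'rV[R]_n | M < `|x|].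
  rewrite (_ : [set x | _] = (fun x : 'rV[R]_n => `|x|) @^-1` [set t | M < t])//.
  by apply: open_comp; [move=> x _; exact: norm_continuous|exact: open_gt].
have DF0 x : M < `|x| -> 'D_v F x = 0.
  by move=> hx; rewrite (near_derive v oM hx (g := cst 0)) ?derive_cst.
have [CD CD0 hCD] : exists2 c, 0 <= c & forall x, `|'D_v F x| <= c.
  have [c c0 hc] := compact_continuous_bounded (cB M) (fun x _ => cDF x).
  by exists c => // x; case: (leP `|x| M) => [/hc//|/DF0->]; rewrite normr0.
(* With m + 2 in the denominator the steps are strictly below [delta] already for m = 0. *)
pose t_ (m : nat) := delta / m.+2%:R.
have t0 m : 0 < t_ m by rewrite divr_gt0.
have td m : t_ m < delta by rewrite ltr_pdivrMr// ltr_pMr// ltr1n.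
have tv m : 0 < t_ m < delta by rewrite t0 td.
(* Outside the ball of radius [M'] both [F] and its translates by [t_ m *: v] vanish, so that all
   integrands below live on one ball of finite measure. *)
pose M' := M + delta * `|v|.
have MM' : M <= M' by rewrite lerDl mulr_ge0// ltW.
have Fshift0 m x : M' < `|x| -> F (x + t_ m *: v) = 0.
  move=> hx; apply: F0; rewrite ltNge; apply/negP => h.
  have : `|x| <= M'.
    rewrite -[x](addrK (t_ m *: v)); apply: (le_trans (ler_normB _ _)).
    by rewrite lerD// normrZ (gtr0_norm (t0 m)) ler_wpM2r// ltW.
  by rewrite leNgt hx.
have mshift (w : 'rV[R]_n) (f : 'rV[R]_n -> R) :
   measurable_fun setT (f : borel 'rV[R]_n -> R) ->
   measurable_fun setT ((fun x => f (x + w)) : borel 'rV[R]_n -> R).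
  by move=> mf; exact: (measurableT_comp mf (shift_measurable w)).
pose f_ m y := phi y * ((t_ m)^-1 * (F (y + t_ m *: v) - F y)).
have mf_ m : measurable_fun setT (f_ m : borel 'rV[R]_n -> R).
  apply: measurable_funM => //; apply: measurable_funM => //.
  by apply: measurable_funB => //; exact: mshift.
have i1 m : mu.-integrable setT (EFin \o ((fun y => phi y * F (y + t_ m *: v)) : borel 'rV[R]_n -> R)).
  apply: (@bounded_support_integrable _ _ _ _ _ (C * CF0)) (mB M') (mu_fin M') _ _ _.
  - by apply: measurable_funM => //; exact: mshift.
  - by move=> x; rewrite normrM ler_pM.
  - by move=> x /negP; rewrite -ltNge => /Fshift0->; rewrite mulr0.
have i2 : mu.-integrable setT (EFin \o ((fun y => phi y * F y) : borel 'rV[R]_n -> R)).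
  apply: (@bounded_support_integrable _ _ _ _ _ (C * CF0)) (mB M) (mu_fin M) _ _ _.
  - exact: measurable_funM.
  - by move=> x; rewrite normrM ler_pM.
  - by move=> x /negP; rewrite -ltNge => /F0->; rewrite mulr0.
have i3 m : mu.-integrable setT (EFin \o ((fun y => phi (y - t_ m *: v) * F y) : borel 'rV[R]_n -> R)).
  apply: (@bounded_support_integrable _ _ _ _ _ (C * CF0)) (mB M) (mu_fin M) _ _ _.
  - by apply: measurable_funM => //; exact: mshift.
  - by move=> x; rewrite normrM ler_pM.
  - by move=> x /negP; rewrite -ltNge => /F0->; rewrite mulr0.
(* Discrete integration by parts: invariance of [mu] moves the increment from [F] to [phi]. *)
have E m : \int[mu]_y f_ m y =
    (t_ m)^-1 * \int[mu]_y ((phi (y - t_ m *: v) - phi y) * F y).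
  transitivity ((t_ m)^-1 * (\int[mu]_y (phi y * F (y + t_ m *: v)) - \int[mu]_y (phi y * F y))).
    rewrite -RintegralB// -RintegralZl//; last first.
      by apply: (integrableB _ (i1 m) i2).
    by apply: eq_Rintegral => y _; rewrite /f_; ring.
  congr (_ * _).
  have -> : \int[mu]_y (phi y * F (y + t_ m *: v)) = \int[mu]_y (phi (y - t_ m *: v) * F y).
    rewrite /Rintegral; congr fine.
    rewrite -[RHS](@integral_preserving _ _ _ mu (fun y => y + t_ m *: v))/=.
    - by apply: eq_integral => y _; rewrite addrK.
    - exact: shift_measurable.
    - by move=> A mA; exact: mu_shift.
    - by have /integrableP[] := i3 m.
  by rewrite -RintegralB//; apply: eq_Rintegral => y _; ring.
have Em m : (- (\int[mu]_y G y)%:E <= \int[mu]_y (f_ m y)%:E)%E.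
  have i4 : mu.-integrable setT (EFin \o (f_ m : borel 'rV[R]_n -> R)).
    have := integrableZl measurableT ((t_ m)^-1) (integrableB measurableT (i1 m) i2).
    by apply: eq_integrable => // y _ /=; rewrite -EFinB -EFinM /f_; congr EFin; ring.
  have i5 : mu.-integrable setT (EFin \o ((fun y => (phi (y - t_ m *: v) - phi y) * F y) : borel 'rV[R]_n -> R)).
    have := integrableB measurableT (i3 m) i2.
    by apply: eq_integrable => // y _ /=; rewrite -EFinB; congr EFin; ring.
  rewrite -[X in (_ <= X)%E](@fineK R); last exact: integrable_fin_num.
  rewrite lee_fin -/(Rintegral mu setT (f_ m)) E.
  have -> : - (\int[mu]_y G y) = (t_ m)^-1 * - (\int[mu]_y (t_ m * G y)).
    by rewrite RintegralZl// mulrN mulKf// gt_eqF.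
  rewrite ler_pM2l ?invr_gt0// lerNl.
  apply: (le_trans (ler_norm _)); rewrite normrN.
  apply: (le_trans (le_normr_Rintegral measurableT i5)).
  apply: le_Rintegral => //.
  - exact: (@integrable_norm _ _ _ _ _ _ i5).
  - exact: (integrableZl measurableT (t_ m) iG).
  - by move=> y _; rewrite normrM; apply: H.
(* As the steps tend to 0, the quotients of [F] converge to its derivative and are bounded by [CD]
   through the mean value theorem, which gives a dominating constant on the ball of radius [M']. *)
have [] := @dominated_convergence _ (borel 'rV[R]_n) R mu setT measurableT
  (fun m y => (f_ m y)%:E) (fun y => (phi y * 'D_v F y)%:E)
  (fun y => ((C * CD)%:E * (\1_([set x : 'rV[R]_n | (`|x| <= M')%R]) y)%:E)%E).
- by move=> m; exact/measurable_EFinP.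
- by apply/measurable_EFinP; exact: measurable_funM.
- apply: aeW => /= y _; apply: cvg_EFin; first by near=> m.
  rewrite /f_; apply: cvgM; first exact: cvg_cst.
  have := (@diff_derivable _ _ _ F y v (CF y I).1).
  move=> /cvg_ex[l hl]; have -> : 'D_v F y = l by exact: cvg_lim hl.
  have ht : t_ m @[m --> \oo] --> 0^'.
    have t_0 : t_ m @[m --> \oo] --> 0.
      rewrite -(mulr0 delta); apply: cvgM; first exact: cvg_cst.
      by have := @cvg_harmonic R; rewrite -(cvg_shiftS (@harmonic R : nat -> R^o)).
    move=> A hA; apply: (@filterS _ \oo _ _ _ _ (t_0 _ hA)) => m; apply.
    exact: lt0r_neq0.
  have := cvg_comp _ _ ht hl; apply: cvg_trans; apply: near_eq_cvg; near=> m.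
  by rewrite /= [y + _]addrC.
- by apply: integrableZl => //; exact: integrable_indic_fin.
- apply: aeW => /= y m _; rewrite -EFinM lee_fin indicE.
  case: (leP `|y| M') => hy.
    rewrite mem_set//= mulr1 normrM ler_pM// normrM normfV (gtr0_norm (t0 m)) ler_pdivrMl//.
    have := @derive_mean_value _ _ F y v (t_ m) 0 CD.
    rewrite mulr0 subr0 (gtr0_norm (t0 m)) mulrC; apply=> s _.
    by split; [exact: diff_derivable (CF _ I).1|rewrite subr0].
  rewrite /f_ Fshift0// F0 ?(le_lt_trans MM')// subrr !mulr0 normr0 mulr_ge0//.
  by rewrite mulr_ge0.
move=> iphi _ cvgf.
rewrite -lee_fin EFinN /Rintegral [X in (_ <= X)%E]fineK; last exact: integrable_fin_num.
rewrite -/(Rintegral mu setT G) -(cvg_lim _ cvgf)//.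
apply: lime_ge; first by apply/cvg_ex; exists (\int[mu]_y (phi y * 'D_v F y)%:E)%E.
by apply: nearW => m; exact: Em.
Unshelve. all: by end_near. Qed.

End IntegrationByParts.

(** * Gradients in charts *)

Section PositiveMatrices.
Context {R : realType} {n : nat}.

Definition posdef (g : 'M[R]_n) := forall v : 'rV[R]_n, v != 0 -> 0 < (v *m g *m v^T) 0 0.

Lemma posdef_unit g : posdef g -> g \in unitmx.
Proof.
move=> pg; rewrite -row_free_unit -kermx_eq0; apply/negPn/negP => /rowV0Pn[v].
by move=> /sub_kermxP vg v0; have := pg v v0; rewrite vg mul0mx mxE ltxx.
Qed.

Lemma C1_on_det {V : normedModType R} m (U : set V) (A : V -> 'M[R]_m) : open U ->
  (forall i j, C1_on U (fun x => A x i j)) -> C1_on U (fun x => \det (A x)).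
Proof.
move=> oU CA; apply: C1_on_sum => // s _; apply: C1_onM => //; first exact: C1_on_cst.
by apply: C1_on_prod => // i _; exact: CA.
Qed.

(** Every matrix on the segment from the identity to [g] is positive definite, so the determinant
    has no zero there. As it starts from 1, the intermediate value theorem keeps it positive. *)
Lemma posdef_det_gt0 g : posdef g -> 0 < \det g.
Proof.
move=> pg; pose A (t : R) : 'M[R]_n := (1 - t)%:M + t *: g.
have dA t : 0 <= t <= 1 -> \det (A t) != 0.
  move=> /andP[t0 t1]; rewrite -unitfE -unitmxE; apply: posdef_unit => v v0.
  have vv : 0 < (v *m v^T) 0 0.
    have [k vk] : exists k, v 0 k != 0.
      apply: contrapT => /forallNP H; move/eqP: v0; apply; apply/rowP => k.
      by rewrite mxE; apply/eqP/negPn/negP; exact: H.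
    rewrite mxE (bigD1 k)//= mxE -expr2 ltr_pwDl// ?exprn_even_gt0//.
    by apply: sumr_ge0 => j _; rewrite mxE -expr2 sqr_ge0.
  have -> : (v *m A t *m v^T) 0 0 = (1 - t) * (v *m v^T) 0 0 + t * (v *m g *m v^T) 0 0.
    by rewrite /A mulmxDr mulmxDl mul_mx_scalar -scalemxAl -scalemxAr -scalemxAl
      mxE [X in X + _]mxE [X in _ + X]mxE.
  have gv := pg v v0; nra.
have Adet : A 1 = g by rewrite /A subrr scale1r raddf0 add0r.
rewrite ltNge; apply/negP => dg.
have cA : C1_on setT (fun t : R => \det (A t)).
  apply: C1_on_det => [|i j]; first exact: openT.
  rewrite (_ : (fun x => _) = fun t : R => (1 - t) *+ (i == j) + t * g i j); last first.
    by apply/funext => t; rewrite /A !mxE.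
  have Cid : C1_on setT (fun t : R => t).
    apply: (@C1_on_intro _ _ _ _ (fun v x : R => v)) => //; first exact: openT.
      by move=> v x _; rewrite derive_id.
    by move=> v x _; exact: continuous_cst_at.
  rewrite (_ : (fun t => _) = fun t : R => ((i == j)%:R : R) + t * (g i j - (i == j)%:R)); last first.
    by apply/funext => t; case: (i == j); rewrite /=; ring.
  apply: C1_onD; [exact: openT|exact: C1_on_cst|].
  by apply: C1_onM; [exact: openT| |exact: C1_on_cst].
have [||t tI] := @IVT R (fun t => \det (A t)) 0 1 0 ler01.
- apply: continuous_in_subspaceT => x _; exact: (C1_on_continuous cA).
- rewrite Adet (_ : A 0 = 1%:M) ?det1; last by rewrite /A subr0 scale0r addr0.
  by rewrite ge_min le_max dg ler01 orbT.
by move: tI; rewrite in_itv/= => /dA/eqP.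
Qed.

Lemma C1_on_invmx {V : normedModType R} (U : set V) (A : V -> 'M[R]_n) : open U ->
  (forall x, U x -> A x \in unitmx) ->
  (forall i j, C1_on U (fun x => A x i j)) -> forall i j, C1_on U (fun x => invmx (A x) i j).
Proof.
move=> oU uA CA i j.
apply: (@C1_on_near _ _ U (fun x => (\det (A x))^-1 * ((-1) ^+ (j + i) * \det (row' j (col' i (A x))))) _ oU).
  by move=> x Ux; rewrite /invmx uA// !mxE.
apply: C1_onM => //.
  apply: C1_onV => //; last exact: C1_on_det.
  by move=> x Ux; rewrite -unitfE -unitmxE uA.
apply: C1_onM => //; first exact: C1_on_cst.
apply: C1_on_det => // k l.
rewrite (_ : (fun x => _) = fun x => A x (lift j k) (lift i l)); first exact: CA.
by apply/funext => x; rewrite !mxE.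
Qed.

End PositiveMatrices.

Section Charts.
Context {R : realType} {n : nat} {P : topologicalType}.
Variable M : riemannianManifold R n P.
Implicit Types (i j : chart_index M) (p : P) (x : 'rV[R]_n) (f a b : P -> R).

Lemma chart_range_param i x : chart_range i x ->
  dom i (param i x) /\ chart_map i (param i x) = x.
Proof. by move=> [p dp <-]; rewrite chart_mapK. Qed.

Lemma dom_chart_range i p : dom i p -> chart_range i (chart_map i p).
Proof. by move=> dp; exists p. Qed.

Lemma param_continuous_range i x : chart_range i x -> {for x, continuous (param i)}.
Proof. by move=> [p dp <-]; exact: param_continuous. Qed.

Lemma dom_chart_at p : dom (chart_at M p) p.
Proof. exact: (projT2 (cid (dom_cover M p))). Qed.

Definition overlap i j : set 'rV[R]_n := chart_map i @` (dom i `&` dom j).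

Lemma overlapP i j x : overlap i j x <-> chart_range i x /\ dom j (param i x).
Proof.
split=> [[p [di dj] <-]|[rx dj]]; first by rewrite chart_mapK//; split=> //; exists p.
by have [di <-] := chart_range_param rx; exists (param i x).
Qed.

Lemma open_overlap i j : open (overlap i j).
Proof.
rewrite openE => x /overlapP[rx dj].
have h1 : \forall y \near x, chart_range i y by apply: open_nbhs_nbhs; split=> //; exact: range_open.
have h2 : \forall y \near x, dom j (param i y).
  by apply: (param_continuous_range rx); apply: open_nbhs_nbhs; split=> //; exact: dom_open.
by apply: filterS2 h1 h2 => y ? ?; apply/overlapP.
Qed.

Definition transition i j x := chart_map j (param i x).

Lemma overlap_range i j x : overlap i j x -> chart_range i x.
Proof. by move=> /overlapP[]. Qed.

Lemma transition_range i j x : overlap i j x -> chart_range j (transition i j x).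
Proof. by move=> /overlapP[_ dj]; exists (param i x). Qed.

Lemma param_transition i j x : overlap i j x -> param j (transition i j x) = param i x.
Proof. by move=> /overlapP[_ dj]; rewrite /transition chart_mapK. Qed.

Lemma transition_C1 i j k : C1_on (overlap i j) (fun x => transition i j x 0 k).
Proof. by apply: smooth_on_C1; [exact: open_overlap|exact: transition_smooth]. Qed.

Lemma transition_differentiable i j x : overlap i j x -> differentiable (transition i j) x.
Proof. by move=> ox; apply: row_differentiable => k; have [] := transition_C1 k ox. Qed.

Lemma gram_posdef i x : chart_range i x -> posdef (gram i x).
Proof. by move=> rx v v0; exact: gram_pos. Qed.

Lemma gram_unit i x : chart_range i x -> gram i x \in unitmx.
Proof. by move=> rx; exact: posdef_unit (gram_posdef rx). Qed.

Lemma det_gram_gt0 i x : chart_range i x -> 0 < \det (gram i x).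
Proof. by move=> rx; exact: posdef_det_gt0 (gram_posdef rx). Qed.

Lemma gram_C1 i k l : C1_on (chart_range i) (fun x => gram i x k l).
Proof. by apply: smooth_on_C1; [exact: range_open|exact: gram_smooth]. Qed.

Lemma gram_change i j x : overlap i j x ->
  gram i x = 'J (transition i j) x *m gram j (transition i j x) *m ('J (transition i j) x)^T.
Proof. exact: gram_transition. Qed.

(** The transformation law of the dual metric. From G_i = J G_j J^T, the matrix G_i^-1 J G_j is a
    left inverse of J^T, hence also a right inverse, and G_j is cancelled. *)
Lemma invmx_gram_change i j x : overlap i j x ->
  ('J (transition i j) x)^T *m invmx (gram i x) *m 'J (transition i j) x =
  invmx (gram j (transition i j x)).
Proof.
move=> ox; set J := 'J _ x; set gj := gram j _.
have uj : gj \in unitmx by apply: gram_unit; exact: transition_range.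
have ui := gram_unit (overlap_range ox).
have E : gram i x = J *m gj *m J^T := gram_change ox.
have uJ : J \in unitmx by move: ui; rewrite E !unitmx_mul -andbA => /and3P[].
have uJT : J^T \in unitmx by rewrite unitmx_tr.
have E1 : invmx (gram i x) *m (J *m gj) *m J^T = 1%:M by rewrite -mulmxA -E mulVmx.
have E2 : J^T *m (invmx (gram i x) *m (J *m gj)) = 1%:M by exact: mulmx1C.
by apply: (can_inj (mulmxK uj)); rewrite mulVmx// -E2 !mulmxA.
Qed.

Definition C1P f := forall i, C1_on (chart_range i) (f \o param i).

Definition chart_grad i f x : 'rV[R]_n := \row_k 'D_(basis_vec k) (f \o param i) x.

Lemma chart_grad_change i j f x : C1P f -> overlap i j x ->
  chart_grad i f x = chart_grad j f (transition i j x) *m ('J (transition i j) x)^T.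
Proof.
move=> Cf ox; apply/rowP => k; rewrite !mxE.
have dt := transition_differentiable ox.
have df : differentiable (f \o param j) (transition i j x).
  by have [] := Cf j _ (transition_range ox).
rewrite (near_derive (basis_vec k) (@open_overlap i j) ox
  (g := (f \o param j) \o transition i j)); last first.
  by move=> y oy /=; rewrite param_transition.
rewrite derive_comp// derive_sum_basis//; apply: eq_bigr => l _.
rewrite deriveEjacobian// /basis_vec -rowE [row _ _ _ _]mxE [chart_grad _ _ _ _ _]mxE [_^T _ _]mxE.
by rewrite mulrC.
Qed.

(** The inner product of the gradients of [a] and [b], computed on covectors with the inverse Gram
    matrix. [dpair] below is the same function on P; by [gpair_change] its choice of charts is
    immaterial for functions of class C^1. *)
Definition gpair i a b x : R :=
  (chart_grad i a x *m invmx (gram i x) *m (chart_grad i b x)^T) 0 0.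

Lemma gpair_change i j a b x : C1P a -> C1P b -> overlap i j x ->
  gpair i a b x = gpair j a b (transition i j x).
Proof.
move=> Ca Cb ox; rewrite /gpair (chart_grad_change Ca ox) (chart_grad_change Cb ox).
by rewrite trmx_mul trmxK -(invmx_gram_change ox) !mulmxA.
Qed.

Definition dpair a b p : R := gpair (chart_at M p) a b (chart_map (chart_at M p) p).

Lemma dpairE i a b p : C1P a -> C1P b -> dom i p ->
  dpair a b p = gpair i a b (chart_map i p).
Proof.
move=> Ca Cb di; have da := dom_chart_at p.
have oi : overlap i (chart_at M p) (chart_map i p) by exists p.
by rewrite (gpair_change Ca Cb oi) /transition chart_mapK.
Qed.

Lemma dpair_param i a b x : C1P a -> C1P b -> chart_range i x ->
  dpair a b (param i x) = gpair i a b x.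
Proof.
by move=> Ca Cb rx; have [di E] := chart_range_param rx; rewrite (dpairE Ca Cb di) E.
Qed.

Lemma invmx_gram_sym i x : chart_range i x -> (invmx (gram i x))^T = invmx (gram i x).
Proof. by move=> rx; rewrite trmx_inv gram_sym. Qed.

Lemma sqnorm_grad i f x : chart_range i x -> sqnorm i x (grad i f x) = gpair i f f x.
Proof.
move=> rx; rewrite /sqnorm /grad /gpair -/(chart_grad i f x).
by rewrite mulmxKV ?gram_unit// trmx_mul invmx_gram_sym// !mulmxA.
Qed.

Lemma sqnorm_ge0 i x (v : 'rV[R]_n) : chart_range i x -> 0 <= sqnorm i x v.
Proof.
move=> rx; have [->|v0] := eqVneq v 0; first by rewrite /sqnorm !mul0mx mxE.
exact/ltW/gram_pos.
Qed.

Lemma gpair_ge0 i f x : chart_range i x -> 0 <= gpair i f f x.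
Proof. by move=> rx; rewrite -sqnorm_grad//; exact: sqnorm_ge0. Qed.

Lemma dpair_ge0 f p : 0 <= dpair f f p.
Proof. by apply: gpair_ge0; exact/dom_chart_range/dom_chart_at. Qed.

Lemma continuous_chart f :
  (forall i x, chart_range i x -> {for x, continuous (f \o param i)}) -> continuous f.
Proof.
move=> cf; apply: continuous_pointwise => p; pose i := chart_at M p.
have di : dom i p := dom_chart_at p.
apply: (@near_continuous _ _ ((f \o param i) \o chart_map i)).
  by apply: open_near (dom_open i) di _ => q dq /=; rewrite chart_mapK.
apply: continuous_comp; first exact: chart_map_continuous.
by apply: cf; exact: dom_chart_range.
Qed.

Lemma C1P_continuous f : C1P f -> continuous f.
Proof. by move=> Cf; apply: continuous_chart => i x rx; exact: C1_on_continuous (Cf i) rx. Qed.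

Lemma invmx_gram_C1 i k l : C1_on (chart_range i) (fun x => invmx (gram i x) k l).
Proof.
apply: C1_on_invmx => [|x rx|k' l']; [exact: range_open|exact: gram_unit|exact: gram_C1].
Qed.

Lemma gpair_sum i a b x : gpair i a b x = \sum_l (\sum_k
  'D_(basis_vec k) (a \o param i) x * invmx (gram i x) k l) * 'D_(basis_vec l) (b \o param i) x.
Proof.
rewrite /gpair mxE; apply: eq_bigr => l _; rewrite mxE [_^T _ _]mxE [X in _ * X]mxE; congr (_ * _).
by apply: eq_bigr => k _; rewrite mxE.
Qed.

Lemma gpair_continuous i a b x : C1P a -> C1P b -> chart_range i x ->
  {for x, continuous (fun y => gpair i a b y)}.
Proof.
move=> Ca Cb rx; have -> : (fun y => gpair i a b y) = (fun y => \sum_l (\sum_k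
  'D_(basis_vec k) (a \o param i) y * invmx (gram i y) k l) * 'D_(basis_vec l) (b \o param i) y).
  by apply/funext => y; exact: gpair_sum.
apply: continuous_sumr => l; apply: continuousM_at; last exact: (Cb i x rx).2.
apply: continuous_sumr => k; apply: continuousM_at; first exact: (Ca i x rx).2.
exact: (C1_on_continuous (@invmx_gram_C1 i k l)).
Qed.

Lemma dpair_continuous a b : C1P a -> C1P b -> continuous (dpair a b).
Proof.
move=> Ca Cb; apply: continuous_chart => i x rx.
apply: near_continuous (gpair_continuous Ca Cb rx).
by apply: (@open_near _ (chart_range i)) => [|//|y ry /=]; [exact: range_open|rewrite dpair_param].
Qed.

Lemma C1P_cst (k : R) : C1P (cst k).
Proof. by move=> i; exact: C1_on_cst. Qed.

Lemma C1P_D a b : C1P a -> C1P b -> C1P (a \+ b).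
Proof. by move=> Ca Cb i; apply: C1_onD; [exact: range_open|exact: Ca|exact: Cb]. Qed.

Lemma C1P_M a b : C1P a -> C1P b -> C1P (a \* b).
Proof. by move=> Ca Cb i; apply: C1_onM; [exact: range_open|exact: Ca|exact: Cb]. Qed.

Lemma chart_grad_D i a b x : C1P a -> C1P b -> chart_range i x ->
  chart_grad i (a \+ b) x = chart_grad i a x + chart_grad i b x.
Proof.
move=> Ca Cb rx; apply/rowP => k; rewrite !mxE deriveD//; apply: diff_derivable.
- by have [] := Ca i x rx.
- by have [] := Cb i x rx.
Qed.

Lemma dpairDr u a b p : C1P a -> C1P b -> dpair u (a \+ b) p = dpair u a p + dpair u b p.
Proof.
move=> Ca Cb; rewrite /dpair /gpair chart_grad_D//; last exact/dom_chart_range/dom_chart_at.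
by rewrite raddfD/= mulmxDr mxE.
Qed.

(** Where a localizing function is constant its gradient term drops out. *)
Lemma dpair_near0 u a (U : set P) (k : R) p : open U -> U p ->
  (forall q, U q -> a q = k) -> dpair u a p = 0.
Proof.
move=> oU Up aU; set i := chart_at M p.
have di : dom i p := dom_chart_at p; have rp := dom_chart_range di.
have E : chart_grad i a (chart_map i p) = 0.
  apply/rowP => l; rewrite !mxE -[RHS](derive_cst k (chart_map i p) (basis_vec l)).
  have H : nbhs (param i (chart_map i p)) [set q | a q = k].
    by rewrite chart_mapK//; exact: open_near oU Up aU.
  have H' : nbhs (chart_map i p) (param i @^-1` [set q | a q = k]).
    exact: (param_continuous_range rp H).
  by apply: near_eq_derive; exact: H'.
by rewrite /dpair /gpair -/i E trmx0 mulmx0 mxE.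
Qed.

End Charts.

(** * Curves and the Riemannian distance *)

Section Curves.
Context {R : realType} {n : nat} {P : topologicalType}.
Variable M : riemannianManifold R n P.
Implicit Types (i j : chart_index M) (p : P) (x : 'rV[R]_n) (gamma : R -> P) (s t : R).

(** The coordinatewise form of [C1_curve], to which the calculus of [C1_on] applies. *)
Definition curve_C1 gamma := continuous gamma /\
  forall i k, C1_on (gamma @^-1` dom i) (fun t => chart_map i (gamma t) 0 k).

Lemma open_curve_dom gamma i : continuous gamma -> open (gamma @^-1` dom i).
Proof. by move=> cg; apply: open_comp => [t _|]; [exact: cg|exact: dom_open]. Qed.

Lemma derive_scale1 {V : normedModType R} (f : R -> V) t (v : R) : differentiable f t ->
  'D_v f t = v *: 'D_1 f t.
Proof.
move=> df; rewrite deriveE// ['D_1 f t]deriveE// -linearZ/=.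
by congr ('d f t _); rewrite -[v *: 1]/(v * 1) mulr1.
Qed.

Lemma C1_on_1d (U : set R) (f : R -> R) : open U ->
  (forall t, U t -> derivable f t 1) ->
  (forall t, U t -> {for t, continuous (fun s => 'D_1 f s)}) -> C1_on U f.
Proof.
move=> oU df cf; apply: (@C1_on_intro _ _ _ _ (fun v t : R => v * 'D_1 f t)) => //.
- by move=> t /df /derivable1_diffP.
- by move=> v t /df /derivable1_diffP dt; rewrite derive_scale1.
- by move=> v t Ut; apply: continuousM_at; [exact: continuous_cst_at|exact: cf].
Qed.

Lemma C1_curveE gamma : C1_curve M gamma <-> curve_C1 gamma.
Proof.
split=> [[cg Cg]|[cg Cg]]; split=> //.
- move=> i k; apply: C1_on_1d => [|t dt|t dt]; first exact: open_curve_dom.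
    by have [/derivable_mxP/(_ 0 k)] := Cg i t dt.
  have [dg ccg] := Cg i t dt.
  apply: (@near_continuous _ _ (fun s => ('D_1 (chart_map i \o gamma) s) 0 k)).
    apply: open_near (open_curve_dom (i := i) cg) dt _ => s ds /=.
    rewrite row_derive//; apply: (iffLR (derivable1_diffP _ _)).
    by have [] := Cg i s ds.
  apply: (@continuous_comp _ _ _ (fun s => 'D_1 (chart_map i \o gamma) s) (fun y : 'rV[R]_n => y 0 k)) => //.
  exact: coord_continuous.
- move=> i t dt.
  have df s : dom i (gamma s) -> differentiable (chart_map i \o gamma) s.
    by move=> ds; apply: row_differentiable => k; have [] := Cg i k s ds.
  split; first exact/derivable1_diffP/df.
  apply: (@near_continuous _ _ (fun s => \sum_k ('D_1 (fun s => chart_map i (gamma s) 0 k) s) *: basis_vec k)).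
    apply: open_near (open_curve_dom (i := i) cg) dt _ => s ds /=.
    rewrite [RHS]row_sum_basis; apply: eq_bigr => k _.
    by rewrite row_derive//; exact: df.
  apply: cvg_big => [|k _]; first exact: add_continuous.
  by apply: cvgZl; exact: (Cg i k t dt).2.
Qed.

Lemma C1_on_local {V : normedModType R} (U : set V) (f : V -> R) :
  (forall y, U y -> exists2 U', U' y & C1_on U' f) -> C1_on U f.
Proof. by move=> H y /H[U' U'y]; exact. Qed.

(** One chart around each time is enough, since any other chart is reached through a transition map
    of class C^1. *)
Lemma curve_C1_intro gamma : continuous gamma ->
  (forall t, exists i, exists U, [/\ open U, U t, U `<=` gamma @^-1` dom i &
     forall k, C1_on U (fun s => chart_map i (gamma s) 0 k)]) -> curve_C1 gamma.
Proof.
move=> cg H; split=> // j k; apply: C1_on_local => t djt.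
have [i [U [oU Ut Ui CU]]] := H t.
pose U' := U `&` gamma @^-1` dom j.
have oU' : open U' by apply: openI => //; exact: open_curve_dom.
exists U' => //.
apply: (@C1_on_near _ _ U' (fun s => transition i j (chart_map i (gamma s)) 0 k)) => //.
  by move=> s [Us djs]; rewrite /transition chart_mapK//; exact: Ui.
apply: (@C1_on_comp_row _ _ _ U' (overlap i j) (fun s => chart_map i (gamma s))
   (fun x => transition i j x 0 k)) => //.
- by move=> s [Us djs]; exists (gamma s) => //; split=> //; exact: Ui.
- by move=> l; apply: C1_on_sub (CU l) => s [].
- exact: transition_C1.
Qed.

Lemma chart_curve_differentiable gamma i t : curve_C1 gamma -> dom i (gamma t) ->
  differentiable (chart_map i \o gamma) t.
Proof. by move=> [cg Cg] dt; apply: row_differentiable => k; have [] := Cg i k t dt. Qed.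

Definition velocity i gamma t : 'rV[R]_n := 'D_1 (chart_map i \o gamma) t.

Lemma velocityE i gamma t k : curve_C1 gamma -> dom i (gamma t) ->
  velocity i gamma t 0 k = 'D_1 (fun s => chart_map i (gamma s) 0 k) t.
Proof. by move=> Cg dt; rewrite /velocity row_derive//; exact: chart_curve_differentiable. Qed.

Lemma near_derive_vec {V W : normedModType R} (U : set V) (f g : V -> W) (y : V) v :
  open U -> U y -> (forall z, U z -> f z = g z) -> 'D_v f y = 'D_v g y.
Proof.
move=> oU Ux fg; have [->|v0] := eqVneq v 0; first by rewrite !derive0.
by apply: near_eq_derive => //; exact: open_near fg.
Qed.

(** The chain rule multiplies the velocity by the Jacobian of the transition map, which is exactly
    how the Gram matrices are related. *)
Lemma speed_chart i gamma t : curve_C1 gamma -> dom i (gamma t) ->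
  speed M gamma t = Num.sqrt (sqnorm i (chart_map i (gamma t)) (velocity i gamma t)).
Proof.
move=> Cg di; rewrite /speed; set j := chart_at M (gamma t).
have dj : dom j (gamma t) := dom_chart_at M (gamma t).
have oij : overlap i j (chart_map i (gamma t)) by exists (gamma t).
have E : chart_map j (gamma t) = transition i j (chart_map i (gamma t)).
  by rewrite /transition chart_mapK.
have -> : 'D_1 (chart_map j \o gamma) t =
    velocity i gamma t *m 'J (transition i j) (chart_map i (gamma t)).
  have oU := open_curve_dom (i := i) Cg.1.
  rewrite (near_derive_vec 1 oU di (g := transition i j \o (chart_map i \o gamma))).
    rewrite derive_comp; [|exact: chart_curve_differentiable|exact: transition_differentiable].
    by rewrite deriveEjacobian//; exact: transition_differentiable.
  by move=> s ds; rewrite /transition/= chart_mapK.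
congr Num.sqrt; rewrite /sqnorm [in RHS](gram_change oij) E trmx_mul !mulmxA.
by [].
Qed.

Lemma sqnorm_sum i x (v : 'rV[R]_n) :
  sqnorm i x v = \sum_l (\sum_k v 0 k * gram i x k l) * v 0 l.
Proof. by rewrite /sqnorm mxE; apply: eq_bigr => l _; rewrite mxE [v^T _ _]mxE. Qed.

Lemma speed_continuous gamma : curve_C1 gamma -> continuous (speed M gamma).
Proof.
move=> Cg; apply: continuous_pointwise => t.
pose i := chart_at M (gamma t); have di : dom i (gamma t) := dom_chart_at M (gamma t).
apply: (@near_continuous _ _ (fun s => Num.sqrt (\sum_l (\sum_k
    'D_1 (fun r => chart_map i (gamma r) 0 k) s * gram i (chart_map i (gamma s)) k l) *
    'D_1 (fun r => chart_map i (gamma r) 0 l) s))).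
  apply: open_near (open_curve_dom (i := i) Cg.1) di _ => s ds.
  rewrite (speed_chart Cg ds) sqnorm_sum; congr Num.sqrt; apply: eq_bigr => l _.
  rewrite velocityE//; congr (_ * _); apply: eq_bigr => k _.
  by rewrite velocityE.
apply: (@continuous_comp_at R R _ Num.sqrt t); last exact: sqrt_continuous.
apply: continuous_sumr => l; apply: continuousM_at; last exact: (Cg.2 i l t di).2.
apply: continuous_sumr => k; apply: continuousM_at; first exact: (Cg.2 i k t di).2.
apply: (@continuous_comp _ _ _ (fun s => chart_map i (gamma s)) (fun y => gram i y k l)).
  by apply: continuous_comp; [exact: Cg.1|exact: chart_map_continuous].
exact: (C1_on_continuous (@gram_C1 _ _ _ M i k l) (dom_chart_range di)).
Qed.

Lemma speed_ge0 gamma t : 0 <= speed M gamma t.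
Proof. exact: sqrtr_ge0. Qed.

(** The interval ]-1, 2[ leaves room around [0, 1], so that arc length has two-sided derivatives at
    both ends. *)
Lemma antiderivative (f : R -> R) : continuous f ->
  exists L : R -> R, forall t, -1 < t < 2 -> is_derive t 1 L (f t).
Proof.
move=> cf; exists (fun s => \int[lebesgue_measure]_(t in [set` `[(-1), s]]) f t) => t /andP[t1 t2].
have [] := @continuous_FTC1_closed R f (-1) t 2 t2 _ t1 (cf t).
  apply: continuous_compact_integrable; first exact: segment_compact.
  exact: continuous_subspaceT.
by move=> dF; rewrite derive1E => E; split.
Qed.

(** Lengths can hereafter be handled as increments of a primitive of the speed. *)
Lemma curve_lengthE gamma (L : R -> R) : curve_C1 gamma ->
  (forall t, 0 <= t <= 1 -> is_derive t 1 L (speed M gamma t)) ->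
  curve_length M gamma = (L 1 - L 0)%:E.
Proof.
move=> Cg dL; have cL t : 0 <= t <= 1 -> {for t, continuous L}.
  by move=> /dL [d _]; apply: differentiable_continuous; exact/derivable1_diffP.
rewrite /curve_length (@continuous_FTC2 _ _ L) ?EFinB//.
- by apply: continuous_subspaceT; exact: speed_continuous.
- split.
  + by move=> t; rewrite in_itv/= => /andP[t0 t1]; have [|] := dL t; rewrite ?ltW.
  + by apply: cvg_at_right_filter; apply: cL; rewrite lexx ler01.
  + by apply: cvg_at_left_filter; apply: cL; rewrite lexx ler01.
- move=> t; rewrite in_itv/= => /andP[t0 t1]; rewrite derive1E.
  by have [|] := dL t; rewrite ?ltW.
Qed.

Lemma is_derive_le (f g f' g' : R -> R) (a b : R) : a <= b ->
  (forall t, a <= t <= b -> is_derive t 1 f (f' t)) ->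
  (forall t, a <= t <= b -> is_derive t 1 g (g' t)) ->
  (forall t, a <= t <= b -> f' t <= g' t) -> f b - f a <= g b - g a.
Proof.
move=> ab df dg fg.
have dh t : a <= t <= b -> is_derive t 1 (g \- f) (g' t - f' t).
  by move=> tab; have ? := df t tab; have ? := dg t tab; apply: is_deriveB.
suff : (g \- f) a <= (g \- f) b by rewrite /=; lra.
have [||c + E] := @MVT_segment R (g \- f) (fun t => g' t - f' t) a b ab.
- by move=> t; rewrite in_itv/= => /andP[ta tb]; apply: dh; rewrite !ltW.
- apply: continuous_in_subspaceT => t; rewrite inE/= in_itv/= => tab.
  by apply: differentiable_continuous; apply/derivable1_diffP; have [] := dh t tab.
rewrite in_itv/= => cab.
by rewrite -subr_ge0 E mulr_ge0 ?subr_ge0//; exact: fg.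
Qed.

End Curves.

(** * Reversing, cutting and concatenating curves *)

Section Joining.
Context {R : realType} {n : nat} {P : topologicalType}.
Variable M : riemannianManifold R n P.
Implicit Types (i j : chart_index M) (p q : P) (gamma : R -> P) (s t : R).
Local Notation speed := (speed M).
Local Notation curve_C1 := (curve_C1 M).

Lemma sqnormZ i (x v : 'rV[R]_n) (c : R) : sqnorm i x (c *: v) = c ^+ 2 * sqnorm i x v.
Proof.
rewrite /sqnorm -scalemxAl -scalemxAl linearZ/= -scalemxAr scalerA.
by rewrite mxE expr2.
Qed.

Lemma speed_near (U : set R) gamma gamma' t : open U -> U t ->
  (forall s, U s -> gamma s = gamma' s) -> speed gamma t = speed gamma' t.
Proof.
move=> oU Ut E; rewrite /speed (E t Ut).
by rewrite (near_derive_vec (g := chart_map (chart_at M (gamma' t)) \o gamma') 1 oU Ut)// => s Us /=; rewrite E.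
Qed.

Lemma C1_curve_comp gamma (s : R -> R) : curve_C1 gamma -> C1_on setT s ->
  curve_C1 (gamma \o s).
Proof.
move=> [cg Cg] Cs; have cs : continuous s by move=> t; exact: (C1_on_continuous Cs).
have cgs : continuous (gamma \o s) by move=> t; apply: continuous_comp; [exact: cs|exact: cg].
split=> // i k.
apply: (@C1_on_comp1 _ _ _ (gamma @^-1` dom i) s (fun t => chart_map i (gamma t) 0 k)) => //.
- exact: open_curve_dom.
- move=> t dt; have [df cf] := Cg i k t dt; split; last exact: cf.
  exact/derivable1_diffP.
- exact: C1_on_sub Cs.
Qed.

Lemma velocity_comp i gamma (s : R -> R) t : curve_C1 gamma -> C1_on setT s ->
  dom i (gamma (s t)) -> velocity i (gamma \o s) t = 'D_1 s t *: velocity i gamma (s t).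
Proof.
move=> Cg Cs di; have dg := chart_curve_differentiable Cg di.
rewrite /velocity -[chart_map i \o _]/((chart_map i \o gamma) \o s) derive_comp//.
  exact: derive_scale1.
by have [] := Cs t I.
Qed.

Lemma speed_comp gamma (s : R -> R) t : curve_C1 gamma -> C1_on setT s ->
  speed (gamma \o s) t = `|'D_1 s t| * speed gamma (s t).
Proof.
move=> Cg Cs; pose i := chart_at M (gamma (s t)).
have di : dom i (gamma (s t)) := dom_chart_at M _.
rewrite (speed_chart (i := i) (C1_curve_comp Cg Cs))// (speed_chart Cg di).
by rewrite velocity_comp// sqnormZ sqrtrM ?sqr_ge0// sqrtr_sqr.
Qed.

Lemma derive_sum_zero (f g h : R -> R) (c t : R) : (forall s, h s = f s + (g s - c)) ->
  derivable f t 1 -> derivable g t 1 -> 'D_1 f t = 0 -> 'D_1 g t = 0 -> 'D_1 h t = 0.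
Proof.
move=> E df dg f0 g0; have -> : h = f \+ (g \+ cst (- c)) by apply/funext => s; rewrite E.
have dc : derivable (cst (- c) : R -> R) t 1 by exact: derivable_cst.
by rewrite (deriveD df (derivableD dg dc)) (deriveD dg dc) f0 g0 derive_cst !addr0.
Qed.

Definition joined p q (l : R) := exists gamma,
  [/\ curve_C1 gamma, gamma 0 = p, gamma 1 = q & curve_length M gamma = l%:E].

Definition arclength gamma (L : R -> R) :=
  forall t, -1 < t < 2 -> is_derive t 1 L (speed gamma t).

Lemma arclength_exists gamma : curve_C1 gamma -> exists L, arclength gamma L.
Proof. by move=> Cg; apply: antiderivative; exact: speed_continuous. Qed.

Lemma is_derive_comp1 (L s : R -> R) t (l : R) : is_derive (s t) 1 L l -> C1_on setT s ->
  is_derive t 1 (L \o s) ('D_1 s t * l).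
Proof.
move=> [dL <-] Cs; have [ds _] := Cs t I.
have dL' : differentiable L (s t) by exact/derivable1_diffP.
split; last by rewrite derive_comp1.
by apply/derivable1_diffP; exact: differentiable_comp.
Qed.

Lemma arclength_joined gamma L : curve_C1 gamma -> arclength gamma L ->
  joined (gamma 0) (gamma 1) (L 1 - L 0).
Proof.
move=> Cg aL; exists gamma; split=> //; apply: curve_lengthE => // t /andP[t0 t1].
by apply: aL; apply/andP; split; lra.
Qed.

Lemma joined_reparam gamma L (s : R -> R) : curve_C1 gamma -> arclength gamma L ->
  C1_on setT s -> (forall t, 0 <= t <= 1 -> 0 <= s t <= 1) ->
  (forall t, 0 <= t <= 1 -> 0 <= 'D_1 s t) ->
  joined (gamma (s 0)) (gamma (s 1)) (L (s 1) - L (s 0)).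
Proof.
move=> Cg aL Cs s01 ds0; exists (gamma \o s); split=> //; first exact: C1_curve_comp.
apply: (@curve_lengthE _ _ _ M _ (L \o s)); first exact: C1_curve_comp.
move=> t t01; rewrite speed_comp// ger0_norm ?ds0//.
apply: is_derive_comp1 => //; apply: aL; have /andP[? ?] := s01 t t01.
by apply/andP; split; lra.
Qed.

Lemma C1_affine (a b : R) : C1_on setT (fun t : R => a + b * t) /\
  forall t : R, 'D_1 (fun t : R => a + b * t) t = b.
Proof.
have D t v : is_derive t v (fun t : R => a + b * t) (v * b).
  by apply: is_derive_eq; rewrite /= -![_ *: _]/(_ * _); ring.
split=> [|t]; last by have [_ ->] := D t 1; rewrite mul1r.
apply: (@C1_on_intro _ _ _ _ (fun v t : R => v * b)) => //; first exact: openT.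
- by move=> v t _; have [] := D t v.
- by move=> v t _; exact: continuous_cst_at.
Qed.

Lemma joined_refl p : joined p p 0.
Proof.
have C : curve_C1 (cst p).
  split=> [t|i k]; first exact: cst_continuous.
  exact: (@C1_on_cst _ _ _ (chart_map i p 0 k)).
have H t : 0 <= t <= 1 -> is_derive t 1 (cst 0 : R -> R) (speed (cst p) t).
  move=> _; suff -> : speed (cst p) t = 0 by exact: is_derive_cst.
  rewrite /speed -[_ \o _]/(cst (chart_map (chart_at M p) p)) derive_cst /sqnorm.
  by rewrite !mul0mx mxE sqrtr0.
by exists (cst p); split=> //; rewrite (curve_lengthE C H) subrr.
Qed.

Lemma joined_ge0 p q l : joined p q l -> 0 <= l.
Proof.
move=> [g [_ _ _ E]]; rewrite -lee_fin -E; apply: integral_ge0 => t _.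
by rewrite lee_fin speed_ge0.
Qed.

Lemma joinedP p q l : joined p q l -> exists gamma L,
  [/\ curve_C1 gamma, arclength gamma L, gamma 0 = p, gamma 1 = q & l = L 1 - L 0].
Proof.
move=> [g [Cg g0 g1 gl]]; have [L aL] := arclength_exists Cg.
have H t : 0 <= t <= 1 -> is_derive t 1 L (speed g t).
  by move=> /andP[? ?]; apply: aL; apply/andP; split; lra.
by exists g, L; split=> //; apply: EFin_inj; rewrite -gl (curve_lengthE Cg H).
Qed.

Lemma joined_sym p q l : joined p q l -> joined q p l.
Proof.
move=> /joinedP[g [L [Cg aL <- <- ->]]].
have [Ca Da] := C1_affine 1 (-1).
have Cgs := C1_curve_comp Cg Ca.
have H t : 0 <= t <= 1 -> is_derive t 1 (fun t => - (L (1 + (-1) * t)))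
    (speed (g \o (fun t => 1 + (-1) * t)) t).
  move=> /andP[t0 t1]; rewrite speed_comp// Da normrN1 mul1r.
  have H1 : is_derive (1 + (-1) * t) 1 L (speed g (1 + (-1) * t)).
    by apply: aL; apply/andP; split; lra.
  have := @is_derive_comp1 L (fun t => 1 + (-1) * t) t _ H1 Ca; rewrite Da => H2.
  by have := is_deriveN H2; rewrite (mulN1r (speed g _)) opprK.
exists (g \o (fun t => 1 + (-1) * t)); split => //.
- by rewrite /= mulr0 addr0.
- by rewrite /= mulr1 subrr.
rewrite (curve_lengthE Cgs H); congr EFin.
by rewrite mulr1 mulr0 subrr addr0; ring.
Qed.

(** Arc length is continuous, so some time cuts off exactly the length [c]; both pieces are then
    reparametrized affinely. *)
Lemma joined_split p q l (c : R) : joined p q l -> 0 <= c <= l ->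
  exists w, joined p w c /\ joined w q (l - c).
Proof.
move=> /joinedP[g [L [Cg aL <- <- ->]]] /andP[c0 cl].
have [||t0 /[!in_itv]/= /andP[ta tb] Et] := @IVT R L 0 1 (L 0 + c) ler01.
- apply: continuous_in_subspaceT => t; rewrite inE/= in_itv/= => /andP[ta tb].
  apply: differentiable_continuous; apply/derivable1_diffP.
  by have [|d _] := aL t; [apply/andP; split; lra|exact: d].
- by rewrite ge_min le_max; apply/andP; split; apply/orP; [left|right]; lra.
have [C1 D1] := C1_affine 0 t0; have [C2 D2] := C1_affine t0 (1 - t0).
exists (g t0); split.
- have h t : 0 <= t <= 1 -> 0 <= 0 + t0 * t <= 1 by move=> /andP[? ?]; nra.
  have d t : 0 <= t <= 1 -> 0 <= 'D_1 (fun t : R => 0 + t0 * t) t by rewrite D1.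
  have := joined_reparam Cg aL C1 h d.
  by rewrite mulr0 mulr1 !add0r Et [L 0 + c]addrC addrK.
- have h t : 0 <= t <= 1 -> 0 <= t0 + (1 - t0) * t <= 1 by move=> /andP[? ?]; nra.
  have d t : 0 <= t <= 1 -> 0 <= 'D_1 (fun t : R => t0 + (1 - t0) * t) t by rewrite D2 subr_ge0.
  have := joined_reparam Cg aL C2 h d.
  by rewrite mulr0 mulr1 addr0 subrKC Et opprD addrA.
Qed.

Lemma C1_smoothstep_affine (a b : R) :
  C1_on setT (fun t : R => smoothstep (a + b * t)) /\
  forall t : R, 'D_1 (fun t : R => smoothstep (a + b * t)) t = b * dsmoothstep (a + b * t).
Proof.
have [Ca Da] := C1_affine a b; split=> [|t].
  apply: (@C1_on_comp1 _ _ _ setT (fun t : R => a + b * t) smoothstep); [exact: openT|by []| |exact: Ca].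
  move=> t _; have [d _] := is_derive_smoothstep t; split=> //.
  exact: (smoothstep_C1 I).2.
have [d E] := is_derive_smoothstep (a + b * t).
have := @derive_comp1 _ _ (fun t : R => a + b * t) smoothstep t 1 (Ca t I).1 d.
by rewrite Da E.
Qed.

(** The concatenation has to be of class C^1, so both curves are slowed down by [smoothstep]: the
    first one comes to rest at [q] at time 1/2, when the second one starts from rest. *)
Lemma joined_concat p q z l l' : joined p q l -> joined q z l' -> joined p z (l + l').
Proof.
move=> /joinedP[g1 [L1 [C1 aL1 g10 g11 ->]]] /joinedP[g2 [L2 [C2 aL2 g20 g21 ->]]].
pose s1 (t : R) := smoothstep (0 + 2 * t); pose s2 (t : R) := smoothstep (-1 + 2 * t).
have [Cs1 Ds1] : C1_on setT s1 /\ _ := C1_smoothstep_affine 0 2.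
have [Cs2 Ds2] : C1_on setT s2 /\ _ := C1_smoothstep_affine (-1) 2.
have s1_1 t : 2^-1 <= t -> s1 t = 1 by move=> ?; apply: smoothstep_ge1; lra.
have s2_0 t : t <= 2^-1 -> s2 t = 0 by move=> ?; apply: smoothstep_le0; lra.
have ds1_0 t : 2^-1 <= t -> 'D_1 s1 t = 0.
  by move=> ?; rewrite Ds1 dsmoothstep_out ?mulr0//; right; lra.
have ds2_0 t : t <= 2^-1 -> 'D_1 s2 t = 0.
  by move=> ?; rewrite Ds2 dsmoothstep_out ?mulr0//; left; lra.
pose d t := if t <= 2^-1 then g1 (s1 t) else g2 (s2 t).
have dl (t : R) : t <= 2^-1 -> d t = g1 (s1 t) by rewrite /d => ->.
have dr (t : R) : 2^-1 <= t -> d t = g2 (s2 t).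
  rewrite le_eqVlt => /predU1P[<-|h]; last by rewrite /d leNgt h.
  by rewrite dl// s1_1// s2_0// g11 g20.
have Cd1 := C1_curve_comp C1 Cs1; have Cd2 := C1_curve_comp C2 Cs2.
have sp1 t : speed (g1 \o s1) t = `|'D_1 s1 t| * speed g1 (s1 t) := speed_comp t C1 Cs1.
have sp2 t : speed (g2 \o s2) t = `|'D_1 s2 t| * speed g2 (s2 t) := speed_comp t C2 Cs2.
(* At each time one of the two slowed curves rests at [q]. Hence the coordinates of [d] are the sum
   of theirs minus those of [q], an expression that is differentiable across the junction as
   well. *)
have dE i k t : chart_map i (d t) 0 k = chart_map i (g1 (s1 t)) 0 k +
    (chart_map i (g2 (s2 t)) 0 k - chart_map i q 0 k).
  case: (leP t 2^-1) => h; first by rewrite dl// s2_0// g20; ring.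
  by rewrite dr ?(ltW h)// s1_1 ?(ltW h)// g11; ring.
have cd : continuous d.
  apply: continuous_pointwise => t; have [h|h|h] := ltgtP t 2^-1.
  - apply: near_continuous (Cd1.1 t).
    by apply: open_near (open_lt (y := 2^-1)) h _ => s /= hs; rewrite dl// ltW.
  - apply: near_continuous (Cd2.1 t).
    by apply: open_near (open_gt (y := 2^-1)) h _ => s /= hs; rewrite dr// ltW.
  - move=> A; rewrite dl ?h// => hA.
    have hA1 : nbhs t ((g1 \o s1) @^-1` A) by apply: Cd1.1; rewrite /= h.
    have hA2 : nbhs t ((g2 \o s2) @^-1` A).
      by apply: Cd2.1; rewrite /= h -dr// dl.
    rewrite h in hA1 hA2; apply: filterS2 hA1 hA2 => s /= A1 A2.
    by rewrite /d; case: ifP.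
have Cd : curve_C1 d.
  apply: curve_C1_intro => // t; pose i := chart_at M (d t); exists i.
  have oi := open_curve_dom (i := i) cd.
  have di : dom i (d t) := dom_chart_at M _.
  have [h|h|h] := ltgtP t 2^-1.
  - exists ((d @^-1` dom i) `&` [set s | s < 2^-1]).
    have oU : open ((d @^-1` dom i) `&` [set s | s < 2^-1]) by apply: openI => //; exact: open_lt.
    split; [exact: oU|by []|by move=> s []|move=> k].
    apply: (C1_on_near oU (f := fun s => chart_map i (g1 (s1 s)) 0 k)).
      by move=> s /= [_ hs]; rewrite dl// ltW.
    by apply: C1_on_sub (Cd1.2 i k) => s /= [+ hs]; rewrite dl// ltW.
  - exists ((d @^-1` dom i) `&` [set s | s > 2^-1]).
    have oU : open ((d @^-1` dom i) `&` [set s | s > 2^-1]) by apply: openI => //; exact: open_gt.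
    split; [exact: oU|by []|by move=> s []|move=> k].
    apply: (C1_on_near oU (f := fun s => chart_map i (g2 (s2 s)) 0 k)).
      by move=> s /= [_ hs]; rewrite dr// ltW.
    by apply: C1_on_sub (Cd2.2 i k) => s /= [+ hs]; rewrite dr// ltW.
  - have le1 : t <= 2^-1 by rewrite h.
    have ge1 : 2^-1 <= t by rewrite h.
    have dt : d t = q by rewrite dl// s1_1// g11.
    pose U := ((g1 \o s1) @^-1` dom i) `&` ((g2 \o s2) @^-1` dom i).
    have oU : open U by apply: openI; [exact: (open_curve_dom Cd1.1)|exact: (open_curve_dom Cd2.1)].
    exists U; split=> //.
    + by split => /=; [rewrite -dl|rewrite -dr].
    + by move=> s [/= h1 h2]; rewrite /d; case: ifP.
    + move=> k; rewrite (_ : (fun s => _) = fun s => chart_map i (g1 (s1 s)) 0 k +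
        (chart_map i (g2 (s2 s)) 0 k - chart_map i q 0 k)); last by apply/funext => s; exact: dE.
      apply: C1_onD => //; first by apply: C1_on_sub (Cd1.2 i k) => s [].
      apply: C1_onD => //; last exact: C1_on_cst.
      by apply: C1_on_sub (Cd2.2 i k) => s [].
have spd t : speed d t = speed (g1 \o s1) t + speed (g2 \o s2) t.
  have [h|h|h] := ltgtP t 2^-1.
  - rewrite sp2 ds2_0 ?(ltW h)// normr0 mul0r addr0.
    by apply: speed_near (open_lt (y := 2^-1)) h _ => s /= hs; rewrite dl// ltW.
  - rewrite sp1 ds1_0 ?(ltW h)// normr0 mul0r add0r.
    by apply: speed_near (open_gt (y := 2^-1)) h _ => s /= hs; rewrite dr// ltW.
  - have le1 : t <= 2^-1 by rewrite h.
    have ge1 : 2^-1 <= t by rewrite h.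
    have z1 : speed (g1 \o s1) t = 0 by rewrite sp1 (ds1_0 _ ge1) normr0 mul0r.
    have z2 : speed (g2 \o s2) t = 0 by rewrite sp2 (ds2_0 _ le1) normr0 mul0r.
    rewrite z1 z2 addr0.
    pose i := chart_at M (d t); have di : dom i (d t) := dom_chart_at M _.
    rewrite (speed_chart Cd di).
    have -> : velocity i d t = 0; last by rewrite /sqnorm !mul0mx mxE sqrtr0.
    have di1 : dom i ((g1 \o s1) t) by rewrite /= -dl.
    have di2 : dom i ((g2 \o s2) t) by rewrite /= -dr.
    apply/rowP => k; rewrite velocityE// mxE.
    have d1 : derivable (fun s => chart_map i (g1 (s1 s)) 0 k) t 1.
      by apply: diff_derivable; have [] := Cd1.2 i k t di1.
    have d2 : derivable (fun s => chart_map i (g2 (s2 s)) 0 k) t 1.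
      by apply: diff_derivable; have [] := Cd2.2 i k t di2.
    have v1 : 'D_1 (fun s => chart_map i (g1 (s1 s)) 0 k) t = 0.
      by rewrite -[LHS](velocityE k Cd1 di1) velocity_comp// ds1_0// scale0r mxE.
    have v2 : 'D_1 (fun s => chart_map i (g2 (s2 s)) 0 k) t = 0.
      by rewrite -[LHS](velocityE k Cd2 di2) velocity_comp// ds2_0// scale0r mxE.
    exact: (derive_sum_zero (dE i k) d1 d2 v1 v2).
have H t : 0 <= t <= 1 -> is_derive t 1 ((L1 \o s1) \+ (L2 \o s2)) (speed d t).
  move=> t01; rewrite spd sp1 sp2.
  have e1 : 0 <= 'D_1 s1 t by rewrite Ds1 mulr_ge0// dsmoothstep_ge0.
  have e2 : 0 <= 'D_1 s2 t by rewrite Ds2 mulr_ge0// dsmoothstep_ge0.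
  rewrite !ger0_norm//.
  have f1 : is_derive t 1 (L1 \o s1) ('D_1 s1 t * speed g1 (s1 t)).
    apply: is_derive_comp1 => //; apply: aL1; have /andP[? ?] := smoothstep_01 (0 + 2 * t).
    by apply/andP; rewrite /s1; split; lra.
  have f2 : is_derive t 1 (L2 \o s2) ('D_1 s2 t * speed g2 (s2 t)).
    apply: is_derive_comp1 => //; apply: aL2; have /andP[? ?] := smoothstep_01 (-1 + 2 * t).
    by apply/andP; rewrite /s2; split; lra.
  exact: (is_deriveD f1 f2).
have h0 : (0:R) <= 2^-1 by rewrite invr_ge0.
have h1 : 2^-1 <= (1:R) by lra.
have s10 : s1 0 = 0 by apply: smoothstep_le0; lra.
have s21 : s2 1 = 1 by apply: smoothstep_ge1; lra.
exists d; split=> //; first by rewrite dl// s10.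
  by rewrite dr// s21.
rewrite (curve_lengthE Cd H) /= s10 s21 s1_1// s2_0//; congr EFin; ring.
Qed.

End Joining.

(** * Coordinate segments and comparison of norms *)

Section Segments.
Context {R : realType} {n : nat} {P : topologicalType}.
Variable M : riemannianManifold R n P.
Implicit Types (i j : chart_index M) (p q : P) (gamma : R -> P) (s t : R).

(** A curve is defined at all real times, while only the segment is known to stay in the chart:
    travelling with [smoothstep] confines the curve to the segment. Its speed is at most [kappa]
    times the tent of integral 1. *)
Lemma joined_segment i (y h : 'rV[R]_n) (kappa : R) :
  (forall s, 0 <= s <= 1 -> chart_range i (y + s *: h) /\
     Num.sqrt (sqnorm i (y + s *: h) h) <= kappa) ->
  exists2 l, l <= kappa & joined M (param i y) (param i (y + h)) l.
Proof.
move=> H; pose c t := y + smoothstep t *: h; pose g t := param i (c t).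
have rc t : chart_range i (c t) by have [] := H _ (smoothstep_01 t).
have cS : continuous (@smoothstep R) by move=> t; exact: (C1_on_continuous smoothstep_C1 I).
have cc : continuous c.
  apply: continuous_pointwise => t; apply: cvgD; first exact: cvg_cst.
  by apply: cvgZl; exact: cS.
have cg : continuous g.
  by move=> t; apply: continuous_comp; [exact: cc|exact: param_continuous_range].
have dg t : dom i (g t) by have [] := chart_range_param (rc t).
have gE t : chart_map i (g t) = c t by have [] := chart_range_param (rc t).
have cE k t : chart_map i (g t) 0 k = y 0 k + smoothstep t * h 0 k by rewrite gE !mxE.
have D k t : is_derive t 1 (fun t => chart_map i (g t) 0 k) (dsmoothstep t * h 0 k).
  have dS := is_derive_smoothstep t.
  rewrite (_ : (fun t => _) = fun t => y 0 k + smoothstep t * h 0 k); last by apply/funext => s; exact: cE.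
  by apply: is_derive_eq; rewrite /= -![_ *: _]/(_ * _); ring.
have Cg : curve_C1 M g.
  apply: curve_C1_intro => // t; exists i, setT; split; [exact: openT|by []|by move=> s _; exact: dg|move=> k].
  apply: (@C1_on_1d R setT); first exact: openT.
    by move=> s _; have [] := D k s.
  move=> s _; rewrite (_ : (fun s => _) = fun s => dsmoothstep s * h 0 k).
    by apply: continuousM_at; [exact: dsmoothstep_continuous|exact: continuous_cst_at].
  by apply/funext => r; have [_ ->] := D k r.
have [L aL] := arclength_exists Cg.
have g0 : g 0 = param i y by rewrite /g /c smoothstep_le0// scale0r addr0.
have g1 : g 1 = param i (y + h) by rewrite /g /c smoothstep_ge1// scale1r.
exists (L 1 - L 0); last by rewrite -g0 -g1; exact: arclength_joined.
have vel t : velocity i g t = dsmoothstep t *: h.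
  by apply/rowP => k; rewrite velocityE// mxE; have [_ ->] := D k t.
have := @is_derive_le _ L (fun t => kappa * smoothstep t) (speed M g)
  (fun t => kappa * dsmoothstep t) 0 1 ler01.
rewrite smoothstep_ge1// smoothstep_le0// mulr1 mulr0 subr0; apply.
- by move=> t /andP[? ?]; apply: aL; apply/andP; split; lra.
- move=> t _; have dS := is_derive_smoothstep t.
  by apply: is_derive_eq; rewrite /= -![_ *: _]/(_ * _); ring.
- move=> t _; rewrite (speed_chart Cg (dg t)) vel sqnormZ sqrtrM ?sqr_ge0// sqrtr_sqr.
  rewrite ger0_norm ?dsmoothstep_ge0// mulrC ler_wpM2r ?dsmoothstep_ge0//.
  by rewrite gE; have [] := H _ (smoothstep_01 t).
Qed.

Lemma sqnorm_continuous i (x v : 'rV[R]_n) : chart_range i x ->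
  {for x, continuous (fun y => sqnorm i y v)}.
Proof.
move=> rx; rewrite (_ : (fun y => _) = fun y => \sum_l (\sum_k v 0 k * gram i y k l) * v 0 l).
  apply: continuous_sumr => l; apply: continuousM_at; last exact: continuous_cst_at.
  apply: continuous_sumr => k; apply: continuousM_at; first exact: continuous_cst_at.
  exact: (C1_on_continuous (@gram_C1 _ _ _ M i k l)).
by apply/funext => y; exact: sqnorm_sum.
Qed.

Definition ginner i (x v w : 'rV[R]_n) : R := (v *m gram i x *m w^T) 0 0.

Lemma ginner_sym i x v w : chart_range i x -> ginner i x v w = ginner i x w v.
Proof.
move=> rx; rewrite /ginner.
have -> : v *m gram i x *m w^T = (w *m gram i x *m v^T)^T by rewrite !trmx_mul trmxK gram_sym// mulmxA.
by rewrite mxE.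
Qed.

Lemma sqnorm_sub i x v w t : chart_range i x ->
  sqnorm i x (v - t *: w) = sqnorm i x v - 2 * t * ginner i x v w + t ^+ 2 * sqnorm i x w.
Proof.
move=> rx; have sym := ginner_sym v w rx; move: sym; rewrite /sqnorm /ginner.
have -> : (v - t *: w)^T = v^T - t *: w^T by rewrite linearB linearZ.
have -> : (v - t *: w) *m gram i x = v *m gram i x - t *: (w *m gram i x).
  by rewrite mulmxBl -scalemxAl.
rewrite mulmxBl !mulmxBr -!scalemxAl -!scalemxAr.
set A := v *m _ *m v^T; set B := v *m _ *m w^T; set C := w *m _ *m v^T; set D := w *m _ *m w^T.
move=> E; clearbody A B C D; rewrite !mxE -E; ring.
Qed.

Lemma ginner_CS i x v w : chart_range i x ->
  ginner i x v w ^+ 2 <= sqnorm i x v * sqnorm i x w.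
Proof.
move=> rx; have [->|w0] := eqVneq w 0.
  by rewrite /ginner /sqnorm trmx0 !mulmx0 mxE mulr0 expr0n.
have wp : 0 < sqnorm i x w by exact: gram_pos.
have := sqnorm_ge0 (v - (ginner i x v w / sqnorm i x w) *: w) rx.
rewrite sqnorm_sub// => h.
have -> : sqnorm i x v * sqnorm i x w = ginner i x v w ^+ 2 + sqnorm i x w *
   (sqnorm i x v - 2 * (ginner i x v w / sqnorm i x w) * ginner i x v w +
     (ginner i x v w / sqnorm i x w) ^+ 2 * sqnorm i x w).
  by field; rewrite gt_eqF.
by rewrite lerDl mulr_ge0// ltW.
Qed.

(** The k-th coordinate of [v] is its inner product with the k-th row of the inverse Gram matrix,
    whose squared norm is the diagonal entry; then Cauchy-Schwarz. *)
Lemma coord_sqnorm_le i (x v : 'rV[R]_n) k : chart_range i x ->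
  v 0 k ^+ 2 <= sqnorm i x v * invmx (gram i x) k k.
Proof.
move=> rx; pose w := (basis_vec k : 'rV[R]_n) *m invmx (gram i x).
have ug := gram_unit rx.
have -> : v 0 k = ginner i x v w.
  rewrite /ginner /w trmx_mul invmx_gram_sym// mulmxA mulmxK//.
  by rewrite /basis_vec trmx_delta -colE mxE.
apply: (le_trans (ginner_CS _ _ rx)); rewrite le_eqVlt; apply/orP; left; apply/eqP; congr (_ * _).
rewrite /sqnorm /w mulmxKV// trmx_mul invmx_gram_sym// mulmxA /basis_vec -rowE trmx_delta -colE.
by rewrite !mxE.
Qed.

(** By continuity the entries of the Gram matrix and of its inverse grow by at most 1 in absolute
    value near [x]. The former bound the Riemannian norm from above, the latter bound the
    coordinates through [coord_sqnorm_le]. *)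
Lemma norm_comparison i (x : 'rV[R]_n) : chart_range i x ->
  exists r C, [/\ 0 < r, 0 < C & forall y, `|y - x| <= r -> chart_range i y /\
    forall v, Num.sqrt (sqnorm i y v) <= C * `|v| /\ `|v| <= C * Num.sqrt (sqnorm i y v)].
Proof.
move=> rx.
pose C1 := \sum_l \sum_k (`|gram i x k l| + 1); pose C2 := \sum_k (`|invmx (gram i x) k k| + 1).
have C10 : 0 <= C1 by apply: sumr_ge0 => l _; apply: sumr_ge0 => k _; rewrite addr_ge0.
have C20 : 0 <= C2 by apply: sumr_ge0 => k _; rewrite addr_ge0.
have nb (f : 'rV[R]_n -> R) : {for x, continuous f} -> \forall y \near x, `|f y| <= `|f x| + 1.
  move=> /cvgrPdist_le/(_ 1 ltr01); apply: filterS => y h.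
  by have := ler_normB (f x) (f x - f y); rewrite opprB addrC subrK; lra.
have : \forall y \near x, chart_range i y /\ forall kl : 'I_n * 'I_n,
    `|gram i y kl.1 kl.2| <= `|gram i x kl.1 kl.2| + 1 /\
    `|invmx (gram i y) kl.1 kl.2| <= `|invmx (gram i x) kl.1 kl.2| + 1.
  have h1 : \forall y \near x, chart_range i y.
    by apply: open_nbhs_nbhs; split=> //; exact: range_open.
  apply: filterS2 h1 _ => [y h1 h2|]; first exact: (conj h1 h2).
  apply: (@filter_forall _ _ (fun kl y => `|gram i y kl.1 kl.2| <= `|gram i x kl.1 kl.2| + 1 /\
    `|invmx (gram i y) kl.1 kl.2| <= `|invmx (gram i x) kl.1 kl.2| + 1) _ (nbhs_filter x)) => -[k l] /=.
  apply: filterS2 (nb _ (C1_on_continuous (@gram_C1 _ _ _ M i k l) rx))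
    (nb _ (C1_on_continuous (@invmx_gram_C1 _ _ _ M i k l) rx)) => y h2 h3; exact: (conj h2 h3).
move=> /nbhs_ballP[r /= r0 hr].
(* Thanks to the summand 1 the square of this constant dominates both [C1] and [C2]. The radius is
   halved so that the closed ball lies in the open one. *)
exists (r / 2), (C1 + C2 + 1); split; [by rewrite divr_gt0|by rewrite ltr_wpDl// addr_ge0|].
move=> y yx; have yb : ball x r y.
  by rewrite -ball_normE /ball_/= distrC (le_lt_trans yx)// ltr_pdivrMr// ltr_pMr// ltr1n.
have [ry hy] := hr y yb; split=> // v; have sv := sqnorm_ge0 v ry.
split.
  have h : sqnorm i y v <= C1 * `|v| ^+ 2.
    rewrite sqnorm_sum /C1 mulr_suml; apply: ler_sum => l _; rewrite !mulr_suml.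
    apply: ler_sum => k _; have [h1 _] := hy (k, l); move: h1 => /= h1.
    apply: (le_trans (ler_norm _)); rewrite !normrM.
    apply: (@le_trans _ _ (`|v| * (`|gram i x k l| + 1) * `|v|)).
      by rewrite ler_pM ?mulr_ge0 ?coord_norm_le// ler_pM ?coord_norm_le.
    by rewrite expr2 [`|v| * _]mulrC mulrA.
  rewrite -[leRHS]ger0_norm ?mulr_ge0 ?addr_ge0// -sqrtr_sqr ler_wsqrtr//.
  apply: (le_trans h); rewrite exprMn ler_wpM2r ?sqr_ge0//; nra.
apply: row_norm_le => [|k]; first by rewrite mulr_ge0 ?sqrtr_ge0 ?addr_ge0.
have C0 : 0 <= C1 + C2 + 1 by rewrite !addr_ge0.
rewrite -sqrtr_sqr -[X in X * _](ger0_norm C0) -[X in X * _]sqrtr_sqr -sqrtrM ?sqr_ge0//.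
apply: ler_wsqrtr; apply: (le_trans (coord_sqnorm_le v k ry)); rewrite mulrC ler_wpM2r//.
have [_ /= h1] := hy (k, k).
have h2 : `|invmx (gram i x) k k| + 1 <= C2.
  by rewrite /C2 (bigD1 k)//= lerDl sumr_ge0// => l _; rewrite addr_ge0.
have := ler_norm (invmx (gram i y) k k); nra.
Qed.

End Segments.

Lemma compact_norm_sub_le (R : realType) (n : nat) (x : 'rV[R]_n) (r : R) :
  compact [set y : 'rV[R]_n | `|y - x| <= r].
Proof.
apply: bounded_closed_compact.
  exists (r + `|x|); split; first exact: num_real.
  move=> s rs y /= yB; apply: (le_trans _ (ltW rs)).
  by rewrite -[y](subrK x); apply: (le_trans (ler_normD _ _)); rewrite lerD2r.
rewrite (_ : [set y | _] = (fun y : 'rV[R]_n => `|y - x|) @^-1` [set t | t <= r])//.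
apply: closed_comp; last exact: closed_le.
move=> y _; apply: (@continuous_comp _ _ _ (fun y : 'rV[R]_n => y - x) (fun y => `|y|)).
  by apply: continuousBv_at; [exact: cvg_id|exact: cst_continuous].
exact: norm_continuous.
Qed.

(** * The distance and its topology *)

Section Distance.
Context {R : realType} {n : nat} {P : topologicalType}.
Variable M : riemannianManifold R n P.
Implicit Types (i j : chart_index M) (p q z : P) (gamma : R -> P) (s t : R).
Local Notation joined := (joined M).
Local Notation rdist := (rdist M).

Lemma joined_near p (e : R) : 0 < e -> \forall q \near p, exists2 l, l < e & joined p q l.
Proof.
move=> e0; pose i := chart_at M p; have di : dom i p := dom_chart_at M p.
have rx := dom_chart_range di; set x := chart_map i p in rx.
have [r [C [r0 C0 H]]] := norm_comparison rx.
have d0 : 0 < Num.min r (e / (2 * C)) by rewrite lt_min r0 divr_gt0// mulr_gt0.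
have h1 : \forall q \near p, dom i q by apply: open_nbhs_nbhs; split=> //; exact: dom_open.
have h2 : \forall q \near p, `|x - chart_map i q| < Num.min r (e / (2 * C)).
  by have /cvgrPdist_lt := @chart_map_continuous _ _ _ M i p di; apply.
apply: filterS2 h1 h2 => q dq; rewrite distrC lt_min => /andP[hr he].
have Hs s : 0 <= s <= 1 -> chart_range i (x + s *: (chart_map i q - x)) /\
    Num.sqrt (sqnorm i (x + s *: (chart_map i q - x)) (chart_map i q - x)) <= e / 2.
  move=> /andP[s0 s1].
  have [|ry hy] := H (x + s *: (chart_map i q - x)).
    rewrite addrC addKr normrZ ger0_norm//; apply: le_trans (ltW hr).
    by rewrite ler_piMl.
  split=> //; apply: (le_trans (hy _).1).
  by move: he; rewrite ltr_pdivlMr ?mulr_gt0// => he; lra.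
have [l le] := joined_segment Hs.
rewrite subrKC /x !chart_mapK// => J; exists l => //.
by rewrite (le_lt_trans le)// ltr_pdivrMr// ltr_pMr// ltr1n.
Qed.

(** The set of points joined to [p] is open and closed, since nearby points are joined to each
    other, and the manifold is connected. *)
Lemma joined_exists p q : exists l, joined p q l.
Proof.
pose A := [set q | exists l, joined p q l].
have oA : open A.
  rewrite openE => z [l jl]; apply: filterS (joined_near z ltr01) => w [l' _ jl'].
  by exists (l + l'); exact: joined_concat jl jl'.
have cA : closed A.
  rewrite -[A]setCK; apply: open_closedC; rewrite openE => z nz.
  apply: filterS (joined_near z ltr01) => w [l' _ jl'] [l jl]; apply: nz.
  by exists (l + l'); exact: joined_concat jl (joined_sym jl').
have AT : A = setT.
  apply: (manifold_connected M); first by exists p; exists 0; exact: joined_refl.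
    by exists A; rewrite ?setTI.
  by exists A; rewrite ?setTI.
by have : A q by rewrite AT.
Qed.

(** The set of lengths is nonempty and bounded below, so [fine] in the definition of the distance
    loses nothing and the distance is a real infimum. *)
Lemma rdist_inf p q : has_inf [set l | joined p q l] /\ rdist p q = inf [set l | joined p q l].
Proof.
have H : has_inf [set l | joined p q l].
  split; first by have [l jl] := joined_exists p q; exists l.
  by exists 0 => l /joined_ge0.
split=> //; rewrite /Defs.rdist.
have -> : [set curve_length M gamma | gamma in
    [set gamma | [/\ C1_curve M gamma, gamma 0 = p & gamma 1 = q]]] = EFin @` [set l | joined p q l].
  apply/seteqP; split=> [_ [g [/C1_curveE Cg g0 g1] <-]|_ [l [g [Cg g0 g1 El]] <-]].
    have [L aL] := arclength_exists Cg.
    have [g' [_ _ _ _]] := arclength_joined Cg aL.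
    have E : curve_length M g = (L 1 - L 0)%:E.
      by apply: curve_lengthE => // t /andP[? ?]; apply: aL; apply/andP; split; lra.
    by exists (L 1 - L 0) => //; exists g; split.
  by exists g => //; split=> //; exact/C1_curveE.
by rewrite ereal_inf_EFin//; case: H.
Qed.

Lemma rdist_lt p q (e : R) : rdist p q < e <-> exists2 l, l < e & joined p q l.
Proof.
have [hi ->] := rdist_inf p q; split=> [lte|[l le jl]].
  have d0 : 0 < e - inf [set l | joined p q l] by rewrite subr_gt0.
  by have [l jl] := inf_adherent d0 hi; rewrite subrKC => le; exists l.
by apply: le_lt_trans le; apply: ge_inf => //; case: hi.
Qed.

Lemma rdist_le p q l : joined p q l -> rdist p q <= l.
Proof.
by move=> jl; have [hi ->] := rdist_inf p q; apply: ge_inf => //; case: hi.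
Qed.

Lemma rdist_ge0 p q : 0 <= rdist p q.
Proof.
rewrite leNgt; apply/negP => /rdist_lt[l l0 /joined_ge0].
by rewrite leNgt l0.
Qed.

Lemma rdistxx p : rdist p p = 0.
Proof. by apply/eqP; rewrite eq_le rdist_ge0 rdist_le//; exact: joined_refl. Qed.

Lemma rdist_sym p q : rdist p q = rdist q p.
Proof.
have H p' q' : rdist p' q' <= rdist q' p'.
  rewrite leNgt; apply/negP => /rdist_lt[l le jl].
  by move: le; rewrite ltNge rdist_le//; exact: joined_sym.
by apply/eqP; rewrite eq_le !H.
Qed.

Lemma rdist_triangle p q z : rdist p z <= rdist p q + rdist q z.
Proof.
apply/ler_addgt0Pr => e e0.
have /rdist_lt[l1 le1 j1] : rdist p q < rdist p q + e / 2 by rewrite ltrDl divr_gt0.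
have /rdist_lt[l2 le2 j2] : rdist q z < rdist q z + e / 2 by rewrite ltrDl divr_gt0.
by apply: (le_trans (rdist_le (joined_concat j1 j2))); lra.
Qed.

Lemma rdist_dist p q z : `|rdist p q - rdist p z| <= rdist q z.
Proof.
have h1 := rdist_triangle p z q; have h2 := rdist_triangle p q z.
by rewrite [rdist z q]rdist_sym in h1; rewrite ler_norml; apply/andP; split; lra.
Qed.

Lemma rdist_near p (e : R) : 0 < e -> \forall q \near p, rdist p q < e.
Proof. by move=> e0; apply: filterS (joined_near p e0) => q h; apply/rdist_lt. Qed.

Lemma rdist_continuous p : continuous (rdist p).
Proof.
apply: continuous_pointwise => q; apply/cvgrPdist_lt => e e0.
by apply: filterS (rdist_near q e0) => z; apply: le_lt_trans; exact: rdist_dist.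
Qed.

Lemma open_rball p (r : R) : open (rball M p r).
Proof.
rewrite (_ : rball M p r = rdist p @^-1` [set s | s < r])//.
by apply: open_comp => [q _|]; [exact: rdist_continuous|exact: open_lt].
Qed.

(** The length space property: a curve of length l < a + b is cut at an arc length between l - b and
    min (a, l), unless l < b, when the starting point itself serves. *)
Lemma rdist_between p q (a b : R) : 0 < a -> 0 < b -> rdist p q < a + b ->
  exists w, rdist p w < a /\ rdist w q < b.
Proof.
move=> a0 b0 /rdist_lt[l lab jl]; have l0 := joined_ge0 jl.
have [lb|lb] := ltP l b.
  by exists p; rewrite rdistxx; split=> //; apply/rdist_lt; exists l.
have [c [c0 cl ca cb]] : exists c, [/\ 0 <= c, c <= l, c < a & l - c < b].
  have [al|al] := leP a l.
    by exists ((l - b + a) / 2); split; lra.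
  by exists ((l - b + l) / 2); split; lra.
have [|w [j1 j2]] := joined_split jl (c := c); first by rewrite c0.
by exists w; split; apply/rdist_lt; [exists c|exists (l - c)].
Qed.

(* The first exit of a curve from a coordinate ball bounds its length from below. *)
Lemma rdist_near_compact p : exists2 d, 0 < d & exists2 K, compact K & forall q, rdist p q < d -> K q.
Proof.
pose i := chart_at M p; have di : dom i p := dom_chart_at M p.
have rx := dom_chart_range di; set x := chart_map i p in rx.
have [r [C [r0 C0 H]]] := norm_comparison rx.
pose B := [set y : 'rV[R]_n | `|y - x| <= r].
have cB : compact B by exact: compact_norm_sub_le.
pose K := param i @` B.
have cK : compact K.
  apply: continuous_compact => //; apply: continuous_in_subspaceT => y; rewrite inE => yB.
  by apply: param_continuous_range; have [] := H y yB.
exists (r / C); first by rewrite divr_gt0.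
exists K => // q /rdist_lt[l ld jl]; have l0 := joined_ge0 jl.
have [g [L [Cg aL g0 g1 lE]]] := joinedP jl.
apply: contrapT => nKq.
pose U := dom i `&` [set z | `|x - chart_map i z| < r].
have UK z : U z -> K z.
  move=> [dz hz]; exists (chart_map i z); last by rewrite chart_mapK.
  by rewrite /B/= distrC ltW.
have oU : open U.
  rewrite openE => z [dz /= hz].
  have h1 : \forall w \near z, dom i w by apply: open_nbhs_nbhs; split=> //; exact: dom_open.
  have h2 : \forall w \near z, `|x - chart_map i w| < r.
    have cz : {for z, continuous (fun w => `|x - chart_map i w|)}.
      apply: (@continuous_comp _ _ _ (fun w => x - chart_map i w) (fun y : 'rV[R]_n => `|y|)).
        by apply: continuousBv_at; [exact: cst_continuous|exact: chart_map_continuous].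
      exact: norm_continuous.
    by apply: (cz [set s | s < r]); apply: open_nbhs_nbhs; split=> //; exact: open_lt.
  exact: filterI h1 h2.
pose T := `[0, 1]%classic `&` g @^-1` (~` U).
have cg : continuous g := Cg.1.
have cT : compact T.
  apply: compact_closedI; first exact: segment_compact.
  by apply: closed_comp => [t _|]; [exact: cg|exact: open_closedC].
have T1 : T 1.
  by split; [rewrite /= in_itv/= ler01 lexx|rewrite /= g1 => /UK].
have [ts] : exists2 ts, ts \in T & forall t, t \in T -> ts <= t.
  apply: (@compact_EVT_min R R id T) => //; first by exists 1.
  exact: (continuous_subspaceT (fun x => @cvg_id _ (nbhs x))).
rewrite inE => -[]; rewrite /= in_itv/= => /andP[ts0 ts1] nUts tsmin.
have below t : 0 <= t -> t < ts -> U (g t).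
  move=> t0 tts; apply: contrapT => nU.
  have : ts <= t by apply: tsmin; rewrite inE; split=> //=; rewrite in_itv/= t0 ltW// (lt_le_trans tts).
  by rewrite leNgt tts.
have Up : U p by split=> //=; rewrite subrr normr0.
have ts_gt0 : 0 < ts.
  by rewrite lt_def ts0 andbT; apply/eqP => E; apply: nUts; rewrite E g0.
(* The exit point still belongs to [K]: otherwise the open complement of [K] would contain slightly
   earlier points, which lie in [U] and so in [K]. Being outside [U], it then has coordinates on the
   sphere of radius [r]. *)
have Kts : K (g ts).
  apply: contrapT => nK.
  have oKC : open (~` K) by apply: closed_openC; exact: compact_closed (manifold_hausdorff M) cK.
  have : nbhs ts (g @^-1` (~` K)) by apply: cg; apply: open_nbhs_nbhs.
  move=> /nbhs_ballP[e /= e0 he].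
  pose t := Num.max 0 (ts - e / 2).
  have tts : t < ts by rewrite gt_max ts_gt0/=; lra.
  have t0 : 0 <= t by rewrite le_max lexx.
  have tb : ball ts e t.
    rewrite -ball_normE /ball_/= gtr0_norm ?subr_gt0//.
    have : ts - e / 2 <= t by rewrite le_max lexx orbT.
    lra.
  by have /= := he t tb; apply; apply: UK; exact: below.
have [y yB yE] := Kts.
have ry : chart_range i y by have [] := H y yB.
have [dy cy] := chart_range_param ry.
have dts : dom i (g ts) by rewrite -yE.
have cts : chart_map i (g ts) = y by rewrite -yE cy.
have ynorm : `|y - x| = r.
  apply/eqP; rewrite eq_le yB/= leNgt; apply/negP => h; apply: nUts; split=> //=.
  by rewrite cts distrC.
have inB t : 0 <= t <= ts -> dom i (g t) /\ B (chart_map i (g t)).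
  move=> /andP[t0]; rewrite le_eqVlt => /predU1P[->|tts]; first by rewrite cts.
  by have [dt /= ht] := below t t0 tts; split=> //; rewrite /B/= distrC ltW.
have dL t : 0 <= t <= ts -> is_derive t 1 (fun t => C * L t) (C * speed M g t).
  move=> /andP[t0 tts]; have dLt : is_derive t 1 L (speed M g t).
    by apply: aL; apply/andP; split; lra.
  by apply: is_derive_eq; rewrite /= -![_ *: _]/(_ * _); ring.
have dF t k : 0 <= t <= ts ->
    is_derive t 1 (fun s => chart_map i (g s) 0 k) (velocity i g t 0 k).
  move=> tt; have [dt _] := inB t tt; rewrite velocityE//; split=> //.
  by apply: diff_derivable; have [] := Cg.2 i k t dt.
have vb t k : 0 <= t <= ts -> `|velocity i g t 0 k| <= C * speed M g t.
  move=> tt; have [dt Bt] := inB t tt; rewrite (speed_chart Cg dt).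
  apply: (le_trans (coord_norm_le _ _)).
  by have [_ /(_ (velocity i g t))[]] := H _ Bt.
have Llen : L ts - L 0 <= l.
  have dL1 t : ts <= t <= 1 -> is_derive t 1 L (speed M g t).
    by move=> /andP[? ?]; apply: aL; apply/andP; split; lra.
  have dz t : ts <= t <= 1 -> is_derive t 1 (cst 0 : R -> R) 0 by move=> _; exact: is_derive_cst.
  have := is_derive_le ts1 dz dL1 (fun t _ => speed_ge0 M g t).
  by rewrite /= lE; lra.
(* Up to the exit no coordinate moves by more than [C] times the length travelled, whereas the curve
   reaches the sphere of radius [r]; this contradicts l < r / C. *)
have : r <= C * l.
  rewrite -ynorm; apply: row_norm_le => [|k].
    by rewrite mulr_ge0// ltW.
  have E0 : chart_map i (g 0) 0 k = x 0 k by rewrite g0.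
  have h1 := is_derive_le ts0 (fun t tt => dF t k tt) dL
    (fun t tt => le_trans (ler_norm _) (vb t k tt)).
  have dN t : 0 <= t <= ts -> is_derive t 1 (fun s => - chart_map i (g s) 0 k) (- velocity i g t 0 k).
    by move=> tt; have ? := dF t k tt; exact: is_deriveN.
  have hN t : 0 <= t <= ts -> - velocity i g t 0 k <= C * speed M g t.
    by move=> tt; apply: le_trans (vb t k tt); rewrite -normrN; exact: ler_norm.
  have h2 := is_derive_le ts0 dN dL hN.
  have hC : C * (L ts - L 0) <= C * l by rewrite ler_pM2l.
  rewrite !mxE ler_norml; move: h1 h2; rewrite cts E0 => h1 h2.
  by apply/andP; split; lra.
by rewrite leNgt mulrC -ltr_pdivlMr// ld.
Qed.

End Distance.

(** * Hopf-Rinow *)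

Section HopfRinow.
Context {R : realType} {n : nat} {P : ptopologicalType}.
Variable M : riemannianManifold R n P.
Implicit Types (p q z : P).
Local Notation rdist := (rdist M).
Local Notation rball := (rball M).

Definition in_compact (A : set P) := exists2 K, compact K & A `<=` K.

Lemma in_compact_finite_union (s : seq P) (A : P -> set P) :
  (forall p, p \in s -> in_compact (A p)) ->
  in_compact [set q | exists2 p, p \in s & A p q].
Proof.
elim: s => [|p s IH] H; first by exists set0; [exact: compact0|move=> q []].
have [K cK sK] : in_compact (A p) by apply: H; rewrite mem_head.
have [K' cK' sK'] := IH (fun p0 ps => H p0 (mem_behead (s := p :: s) ps)).
exists (K `|` K'); first exact: compactU.
move=> q [p']; rewrite inE => /orP[/eqP->|p's] Aq; first by left; exact: sK.
by right; apply: sK'; exists p'.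
Qed.

Lemma rball_net p (s e : R) : 0 < e -> in_compact (rball p s) ->
  exists2 D : seq P, (forall q, q \in D -> rball p s q) &
    forall z, rball p s z -> exists2 q, q \in D & rdist q z < e.
Proof.
move=> e0 [K cK sK]; pose B := rball p s.
have cB : compact (K `&` closure B) by apply: compact_closedI => //; exact: closed_closure.
have cov : cover_compact (K `&` closure B) by rewrite -compact_cover.
have := cov P B (fun q => rball q e).
case=> [q Bq|z [Kz clz]|D' D'B D'cov].
- exact: open_rball.
- have [w [Bw wz]] := clz _ (rdist_near M z e0); exists w => //.
  by rewrite /Defs.rball/= rdist_sym.
exists (finmap.enum_fset D') => [q qD|z Bz].
  by have := D'B q qD; rewrite inE.
have [q /= qD qz] := D'cov z (conj (sK z Bz) (subset_closure Bz)).
by exists q.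
Qed.

(* A length space: the ball of radius s + e/3 lies within e/2 of the ball of radius s. *)
Lemma rball_not_in_compact p (r e : R) : 0 < e -> ~ in_compact (rball p r) ->
  exists2 q, rball p r q & ~ in_compact (rball q e).
Proof.
move=> e0 nr; apply: contrapT => H.
have Hq q : rball p r q -> in_compact (rball q e).
  by move=> pq; apply: contrapT => nq; apply: H; exists q.
have r0 : 0 < r.
  rewrite ltNge; apply/negP => r0; apply: nr; exists set0; first exact: compact0.
  by move=> q; rewrite /Defs.rball/= => h; have := rdist_ge0 M p q; lra.
(* The radius grows by e/3 at a time until it reaches [r]. A point of the next ball is within e/2 of
   the current one, and so within e/2 + e/3 < e of a finite net of it. *)
suff K k : in_compact (rball p (Num.min r (e / 3 * k.+1%:R))).
  apply: nr; have [k hk] : exists k, r <= e / 3 * k.+1%:R.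
    exists (Num.truncn (r / (e / 3))).
    by rewrite mulrC -ler_pdivrMr ?divr_gt0// ltW// truncnS_gt.
  by have := K k; rewrite min_l.
elim: k => [|k [K cK sK]].
  have [K cK sK] : in_compact (rball p e) by apply: Hq; rewrite /Defs.rball/= rdistxx.
  exists K => // q hq; apply: sK; move: hq; rewrite /Defs.rball/= lt_min => /andP[_].
  by rewrite mulr1; lra.
have e30 : 0 < e / 3 by rewrite divr_gt0.
set s := Num.min r _ in sK.
have s0 : 0 < s by rewrite lt_min r0 mulr_gt0.
have sr : s <= r by rewrite ge_min lexx.
have [D DB Dnet] := rball_net e30 (ex_intro2 _ _ K cK sK).
have [K' cK' sK'] := @in_compact_finite_union D (fun q => rball q e)
  (fun q qD => Hq q (lt_le_trans (DB q qD) sr)).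
exists K' => // z; rewrite /Defs.rball/= lt_min => /andP[zr zk].
have zs : rdist p z < s + e / 2.
  rewrite /s; case: (leP r (e / 3 * k.+1%:R)) => h; first by lra.
  move: zk; rewrite -[X in _ * X]natr1 mulrDr mulr1; lra.
have e20 : 0 < e / 2 by rewrite divr_gt0.
have [w [pw wz]] := rdist_between s0 e20 zs.
have [q qD qw] := Dnet w pw.
apply: sK'; exists q => //; rewrite /Defs.rball/=.
by have := rdist_triangle M q w z; lra.
Qed.

(** A ball that is not relatively compact contains the centre of another such ball of half the
    radius. The centres obtained by iteration form a Cauchy sequence; near its limit small balls are
    relatively compact, yet they contain the late bad balls. *)
Theorem hopf_rinow p (r : R) : rcomplete M -> in_compact (rball p r).
Proof.
move=> cM; apply: contrapT => npr.
pose bad (a : P * R) := ~ in_compact (rball a.1 a.2).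
have r0 : 0 < r.
  rewrite ltNge; apply/negP => r0; apply: npr; exists set0; first exact: compact0.
  by move=> q; rewrite /Defs.rball/= => h; have := rdist_ge0 M p q; lra.
have step (k : nat) q : exists z, ~ in_compact (rball q (r / 2 ^+ k)) ->
    rdist q z < r / 2 ^+ k /\ ~ in_compact (rball z (r / 2 ^+ k.+1)).
  have [nq|] := pselect (~ in_compact (rball q (r / 2 ^+ k))); last by exists q.
  have ek : 0 < r / 2 ^+ k.+1 by rewrite divr_gt0// exprn_gt0.
  by have [z h1 h2] := rball_not_in_compact ek nq; exists z.
have [f hf] := choice (fun kq : nat * P => step kq.1 kq.2).
pose x := fix x (k : nat) := if k is k'.+1 then f (k', x k') else p.
have xbad k : ~ in_compact (rball (x k) (r / 2 ^+ k)).
  elim: k => [|k IH]; first by rewrite expr0 divr1.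
  by have [] := hf (k, x k) IH.
have xstep k : rdist (x k) (x k.+1) < r / 2 ^+ k by have [] := hf (k, x k) (xbad k).
have xdist k m : rdist (x k) (x (k + m)%N) <= 2 * r / 2 ^+ k.
  (* Keeping the remaining geometric tail makes the bound inductive. *)
  suff : rdist (x k) (x (k + m)%N) <= 2 * r / 2 ^+ k - 2 * r / 2 ^+ (k + m).
    have : 0 <= 2 * r / 2 ^+ (k + m) by rewrite divr_ge0 ?mulr_ge0 ?exprn_ge0// ltW.
    lra.
  elim: m => [|m IH]; first by rewrite addn0 subrr rdistxx.
  rewrite addnS; have h1 := rdist_triangle M (x k) (x (k + m)%N) (x (k + m).+1).
  have h2 := xstep (k + m)%N.
  have -> : 2 * r / 2 ^+ (k + m).+1 = r / 2 ^+ (k + m).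
    by rewrite exprS; field; rewrite expf_neq0.
  have : 2 * r / 2 ^+ (k + m) = 2 * (r / 2 ^+ (k + m)) by rewrite mulrA.
  lra.
have cvg0 : (fun k => 2 * r / 2 ^+ k) @ \oo --> (0 : R).
  have h : `|2^-1 : R| < 1 by rewrite ger0_norm; lra.
  rewrite (_ : (fun k => _) = geometric (2 * r) 2^-1); first exact: cvg_geometric.
  by apply/funext => k; rewrite /geometric/= exprVn.
have [z xz] : exists z, rdist z (x k) @[k --> \oo] --> (0 : R).
  apply: cM => e e0.
  have /cvgrPdist_lt/(_ (e / 2)) := cvg0; rewrite divr_gt0// => /(_ isT)[N _ hN].
  exists N => k l Nk Nl.
  have := hN N (leqnn N); rewrite /= sub0r normrN ger0_norm; last first.
    by rewrite divr_ge0 ?mulr_ge0 ?exprn_ge0// ltW.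
  move=> hNe; have h1 := xdist N (k - N)%N; have h2 := xdist N (l - N)%N.
  rewrite !subnKC// in h1 h2.
  have h3 := rdist_triangle M (x k) (x N) (x l).
  rewrite [rdist (x k) (x N)]rdist_sym in h3; lra.
have [d d0 [K cK hK]] := rdist_near_compact M z.
have /cvgrPdist_lt/(_ (d / 2)) := xz; rewrite divr_gt0// => /(_ isT)[N1 _ hN1].
have /cvgrPdist_lt/(_ (d / 2)) := cvg0; rewrite divr_gt0// => /(_ isT)[N2 _ hN2].
pose k := maxn N1 N2; apply: (xbad k); exists K => // q kq; apply: hK.
have := hN1 k (leq_maxl _ _); have := hN2 k (leq_maxr _ _).
rewrite /= !sub0r !normrN !ger0_norm ?rdist_ge0//; last first.
  by rewrite divr_ge0 ?mulr_ge0 ?exprn_ge0// ltW.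
have : r / 2 ^+ k <= 2 * r / 2 ^+ k.
  by rewrite -mulrA ler_peMl ?divr_ge0 ?exprn_ge0 ?(ltW r0)// ler1n.
move: kq; rewrite /Defs.rball/=.
have := rdist_triangle M z (x k) q; lra.
Qed.

End HopfRinow.

(** * The Riemannian volume in a chart *)

Section WeightedTransfer.
Local Open Scope ereal_scope.
Context d1 d2 (T1 : measurableType d1) (T2 : measurableType d2) (R : realType).
Variables (mu : {measure set T1 -> \bar R}) (nu : {measure set T2 -> \bar R}).
Variables (phi : T1 -> T2) (w : T1 -> R) (D : set T2).
Hypotheses (mphi : measurable_fun setT phi) (mw : measurable_fun setT w).
Hypotheses (w0 : forall x, (0 <= w x)%R) (mD : measurable D).
Hypothesis nuE : forall A, measurable A -> A `<=` D ->
  nu A = \int[mu]_x (\1_A (phi x) * w x)%:E.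

Import HBNNSimple.

(** The volume is prescribed on sets. The resulting change of variables passes to simple functions
    by linearity, and below to nonnegative functions by monotone convergence and to signed ones
    through their two parts. *)
Lemma nnsfun_transfer (g : {nnsfun T2 >-> R}) :
  \int[nu]_(x in D) (g x)%:E = \int[mu]_x (g (phi x) * \1_D (phi x) * w x)%:E.
Proof.
have mB r : measurable (g @^-1` [set r]) by rewrite -[X in measurable X]setTI; exact: measurable_funP.
have mphiB (B : set T2) : measurable B -> measurable_fun setT (fun x => \1_B (phi x) : R).
  by move=> mB'; apply: (@measurableT_comp _ _ _ _ _ _ (\1_B : T2 -> R)) => //; exact: measurable_indic.
transitivity (\sum_(r \in range g) \int[nu]_(x in D) (r * \1_(g @^-1` [set r]) x)%:E).
  under eq_integral do rewrite fimfunE -fsumEFin//.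
  rewrite ge0_integral_fsum//.
  - by move=> r; apply/measurable_EFinP; apply: measurable_funM => //; exact: measurable_indic.
  - by move=> r x _; rewrite nnfun_muleindic_ge0.
transitivity (\sum_(r \in range g) \int[mu]_x (r * (\1_(g @^-1` [set r]) (phi x) * \1_D (phi x) * w x))%:E).
  apply: eq_fsbigr => r /set_mem [x _ gx].
  have r0 : (0 <= r)%R by rewrite -gx; exact: fun_ge0.
  rewrite integralZl_indic_nnsfun//.
  rewrite integral_indic// nuE; [|exact: measurableI|exact: subIsetr].
  rewrite -ge0_integralZl_EFin//.
  - apply: eq_integral => y _; rewrite -EFinM; congr EFin; congr (_ * _)%R.
    by rewrite indicI.
  - by move=> y _; rewrite lee_fin mulr_ge0.
  - apply/measurable_EFinP; apply: measurable_funM => //.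
    by apply: mphiB; exact: measurableI.
rewrite -ge0_integral_fsum//.
- apply: eq_integral => x _; rewrite fsumEFin// [g (phi x)]fimfunE -mulrA mulr_fsuml.
  by congr EFin; apply: eq_fsbigr => r _; rewrite !mulrA.
- move=> r; apply/measurable_EFinP; apply: measurable_funM => //; apply: measurable_funM => //.
  by apply: measurable_funM; exact: mphiB.
- move=> r x _; rewrite lee_fin indicE; case: (boolP (phi x \in g @^-1` [set r])) => [/set_mem <-|_].
    by rewrite /= mulr_ge0// ?fun_ge0// !mulr_ge0.
  by rewrite /= !mul0r mulr0.
Qed.

Lemma ge0_integral_transfer (f : T2 -> R) : measurable_fun setT f ->
  (forall x, (0 <= f x)%R) -> (forall x, ~ D x -> f x = 0%R) ->
  \int[nu]_x (f x)%:E = \int[mu]_x (f (phi x) * w x)%:E.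
Proof.
move=> mf f0 fD.
have mEf : measurable_fun D (EFin \o f) by apply/measurable_EFinP; exact: measurable_funS mf.
have Ef0 x : D x -> 0 <= (EFin \o f) x by rewrite /= lee_fin.
pose f_ := nnsfun_approx mD mEf.
have mphiD : measurable_fun setT (fun x => \1_D (phi x) : R).
  by apply: (@measurableT_comp _ _ _ _ _ _ (\1_D : T2 -> R)) => //; exact: measurable_indic.
have mfphi n : measurable_fun setT (fun x => f_ n (phi x)).
  exact: (measurableT_comp (measurable_funP (f_ n)) mphi).
transitivity (\int[nu]_(x in D) (f x)%:E).
  rewrite [RHS]integral_mkcond; apply: eq_integral => x _; rewrite patchE.
  by case: ifPn => // /negP nD; rewrite fD// => Dx; apply: nD; exact: mem_set.
transitivity (limn (fun n => \int[nu]_(x in D) (f_ n x)%:E)).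
  rewrite -monotone_convergence//.
  - by apply: eq_integral => y /[!inE] yD; apply/esym/cvg_lim => //; exact: cvg_nnsfun_approx.
  - by move=> n; exact/measurable_EFinP/measurable_funTS.
  - by move=> n y _; rewrite lee_fin.
  - by move=> y _ m n mn; rewrite lee_fin; exact/lefP/nd_nnsfun_approx.
rewrite (_ : (fun n => _) = fun n => \int[mu]_x (f_ n (phi x) * \1_D (phi x) * w x)%:E); last first.
  by apply/funext => n; exact: nnsfun_transfer.
rewrite -monotone_convergence//.
- apply: eq_integral => x _; apply/cvg_lim => //.
  have [Dx|nDx] := pselect (D (phi x)).
    rewrite (_ : (fun n => _) = fun n => (f_ n (phi x))%:E * (w x)%:E).
      by rewrite EFinM; apply: cvgeZr => //; exact: cvg_nnsfun_approx.
    by apply/funext => n; rewrite indicE mem_set//= mulr1 EFinM.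
  rewrite fD// mul0r (_ : (fun n => _) = cst 0); first exact: cvg_cst.
  by apply/funext => n; rewrite indicE memNset//= mulr0 mul0r.
- by move=> n; apply/measurable_EFinP; apply: measurable_funM => //; exact: measurable_funM.
- by move=> n y _; rewrite lee_fin !mulr_ge0.
- move=> y _ m n mn; rewrite lee_fin ler_wpM2r// ler_wpM2r//.
  exact/lefP/nd_nnsfun_approx.
Qed.

Lemma integral_transfer (f : T2 -> R) : measurable_fun setT f ->
  (forall x, ~ D x -> f x = 0%R) ->
  \int[nu]_x (f x)%:E = \int[mu]_x (f (phi x) * w x)%:E.
Proof.
move=> mf fD; rewrite integralE [RHS]integralE.
have mP : measurable_fun setT (fun x => Num.max (f x) 0%R) by exact: measurable_maxr.
have mN : measurable_fun setT (fun x => Num.max (- f x)%R 0%R).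
  by apply: measurable_maxr => //; exact: measurable_funN.
have E1 : \int[nu]_x ((fun x => (f x)%:E)^\+ x) = \int[nu]_x (Num.max (f x) 0%R)%:E.
  by apply: eq_integral => x _; rewrite funeposE EFin_max.
have E2 : \int[nu]_x ((fun x => (f x)%:E)^\- x) = \int[nu]_x (Num.max (- f x)%R 0%R)%:E.
  by apply: eq_integral => x _; rewrite funenegE EFin_max.
have E3 : \int[mu]_x ((fun x => (f (phi x) * w x)%:E)^\+ x) = \int[mu]_x (Num.max (f (phi x)) 0%R * w x)%:E.
  by apply: eq_integral => x _; rewrite funeposE -EFin_max maxr_pMl// mul0r.
have E4 : \int[mu]_x ((fun x => (f (phi x) * w x)%:E)^\- x) = \int[mu]_x (Num.max (- f (phi x))%R 0%R * w x)%:E.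
  by apply: eq_integral => x _; rewrite funenegE -EFinN -EFin_max maxr_pMl// mul0r mulNr.
have HP := ge0_integral_transfer mP.
have HN := ge0_integral_transfer mN.
rewrite E1 E2 E3 E4 HP ?HN// => x; try by rewrite le_max lexx orbT.
- by move=> nD; rewrite fD// oppr0 maxxx.
- by move=> nD; rewrite fD// maxxx.
Qed.

End WeightedTransfer.

Section ChartVolume.
Context {R : realType} {n : nat} {P : ptopologicalType}.
Variable M : riemannianManifold R n P.
Variable vol : {measure set (borel P) -> \bar R}.
Hypothesis hvol : is_riemannian_volume M vol.
Variable mu : {measure set (borel 'rV[R]_n) -> \bar R}.
Hypothesis mu_int : forall f, measurable_fun setT (f : borel 'rV[R]_n -> \bar R) ->
  (forall x, 0 <= f x)%E -> integral_rV f = (\int[mu]_x f x)%E.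
Variable i : chart_index M.

(** Total and Borel: outside the chart range the density below is 0, so the arbitrary value [point]
    never contributes. *)
Definition param_ext (y : 'rV[R]_n) : P := if y \in chart_range i then param i y else point.

Definition density_ext (y : 'rV[R]_n) : R :=
  if y \in chart_range i then Num.sqrt (\det (gram i y)) else 0.

Lemma param_ext_measurable : measurable_fun setT (param_ext : borel 'rV[R]_n -> borel P).
Proof.
apply: patch_borel; first exact: range_open.
by move=> y ry; exact: param_continuous_range.
Qed.

Lemma sqrt_det_gram_C1 : C1_on (chart_range i) (fun y => Num.sqrt (\det (gram i y))).
Proof.
apply: C1_on_sqrt => [|y ry|]; [exact: range_open|exact: det_gram_gt0|].
by apply: C1_on_det => [|k l]; [exact: range_open|exact: gram_C1].
Qed.

Lemma density_ext_measurable : measurable_fun setT (density_ext : borel 'rV[R]_n -> R).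
Proof.
apply: patch_borelR; first exact: range_open.
by move=> y ry; exact: (C1_on_continuous sqrt_det_gram_C1).
Qed.

Lemma density_ext_ge0 y : 0 <= density_ext y.
Proof. by rewrite /density_ext; case: ifP => // _; exact: sqrtr_ge0. Qed.

Lemma vol_chart (A : set (borel P)) : measurable A -> A `<=` dom i ->
  vol A = (\int[mu]_y (\1_A (param_ext y) * density_ext y)%:E)%E.
Proof.
move=> mA Ai; rewrite (hvol mA Ai) -mu_int.
- congr integral_rV; apply/funext => y; congr EFin; rewrite /param_ext /density_ext.
  case: ifPn => [/set_mem ry|/negP nry].
    congr (_ * _); rewrite !indicE; congr ((_ : bool)%:R); apply/idP/idP => /set_mem h; apply/mem_set.
      by have [p Ap <-] := h; rewrite chart_mapK//; exact: Ai.
    by exists (param i y) => //; have [_] := chart_range_param ry.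
  rewrite mulr0 indicE memNset ?mul0r// => -[p Ap E]; apply: nry; apply/mem_set.
  by exists p => //; exact: Ai.
- apply/measurable_EFinP; apply: measurable_funM; last exact: density_ext_measurable.
  apply: (@measurableT_comp _ _ _ _ _ _ (\1_A : borel P -> R)); first exact: measurable_indic.
  exact: param_ext_measurable.
- by move=> y; rewrite lee_fin mulr_ge0// density_ext_ge0.
Qed.

Lemma integral_chart (f : P -> R) : measurable_fun setT (f : borel P -> R) ->
  (forall p, ~ dom i p -> f p = 0) ->
  \int[vol]_p f p = \int[mu]_y (f (param_ext y) * density_ext y).
Proof.
move=> mf f0; congr fine.
apply: (@integral_transfer _ _ (borel 'rV[R]_n) (borel P) R mu vol param_ext density_ext (dom i)) => //.
- exact: param_ext_measurable.
- exact: density_ext_measurable.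
- exact: density_ext_ge0.
- by apply: borel_open; exact: dom_open.
- exact: vol_chart.
Qed.

End ChartVolume.

(** * The weighted soliton equation *)

Section Soliton.
Context {R : realType} {n : nat} {P : ptopologicalType}.
Variable M : riemannianManifold R n P.
Variables (c : R) (u : P -> R).
Hypothesis hu : translating_soliton_graph M c u.
Variable lam : R.
Implicit Types (i : chart_index M) (p : P) (x y : 'rV[R]_n) (theta : P -> R).

Let smooth_u : smooth_fun M u := hu.1.

Lemma soliton_C1P : C1P M u.
Proof. by move=> i; apply: smooth_on_C1; [exact: range_open|exact: smooth_u]. Qed.

(** In the notation of the overview, this and the next three functions are e^(- lam u), W, S and the
    inner product of X with grad theta. *)
Definition weight p : R := expR (- lam * u p).
Definition slope p : R := Num.sqrt (1 + dpair M u u p).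
Definition source p : R := weight p * (- c + lam * dpair M u u p) / slope p.
Definition flow theta p : R := weight p / slope p * dpair M u theta p.

Lemma slope_gt0 p : 0 < slope p.
Proof. by rewrite sqrtr_gt0 ltr_pwDl// dpair_ge0. Qed.

Lemma weight_gt0 p : 0 < weight p.
Proof. exact: expR_gt0. Qed.

Lemma slope_factorE i y : chart_range i y -> slope_factor i u y = slope (param i y).
Proof.
move=> ry; rewrite /slope_factor /slope (sqnorm_grad u ry).
by rewrite (dpair_param soliton_C1P soliton_C1P ry).
Qed.

Lemma weight_C1P : C1P M weight.
Proof.
move=> i; apply: C1_on_expR; first exact: range_open.
apply: C1_onM; [exact: range_open|exact: C1_on_cst|exact: soliton_C1P].
Qed.

Lemma slope_continuous : continuous slope.
Proof.
apply: continuous_pointwise => p; apply: (@continuous_comp_at R P _ Num.sqrt); last exact: sqrt_continuous.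
apply: continuousD_at; first exact: continuous_cst_at.
by apply: dpair_continuous; exact: soliton_C1P.
Qed.

Lemma source_continuous : continuous source.
Proof.
apply: continuous_pointwise => p; apply: continuousM_at.
  apply: continuousM_at; first exact: (C1P_continuous weight_C1P).
  apply: continuousD_at; first exact: continuous_cst_at.
  apply: continuousM_at; first exact: continuous_cst_at.
  by apply: dpair_continuous; exact: soliton_C1P.
by apply: continuousV_at; [rewrite gt_eqF// slope_gt0|exact: slope_continuous].
Qed.

Lemma flow_continuous theta : C1P M theta -> continuous (flow theta).
Proof.
move=> Ct; apply: continuous_pointwise => p; apply: continuousM_at.
  apply: continuousM_at; first exact: (C1P_continuous weight_C1P).
  by apply: continuousV_at; [rewrite gt_eqF// slope_gt0|exact: slope_continuous].
by apply: dpair_continuous; [exact: soliton_C1P|].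
Qed.

Definition chart_field i (k : 'I_n) y : R := (slope_factor i u y)^-1 * grad i u y 0 k.

Lemma grad_C1 i k : C1_on (chart_range i) (fun y => grad i u y 0 k).
Proof.
rewrite (_ : (fun y => _) = fun y => \sum_l 'D_(basis_vec l) (u \o param i) y * invmx (gram i y) l k).
  apply: C1_on_sum => [|l _]; first exact: range_open.
  apply: C1_onM; [exact: range_open| |exact: invmx_gram_C1].
  by apply: smooth_on_C1; [exact: range_open|apply: smooth_on_partial; exact: smooth_u].
by apply/funext => y; rewrite /grad mxE; apply: eq_bigr => l _; rewrite mxE.
Qed.

Lemma gpair_grad i b y : gpair i u b y = \sum_k grad i u y 0 k * 'D_(basis_vec k) (b \o param i) y.
Proof. by rewrite /gpair mxE; apply: eq_bigr => k _; rewrite [X in _ * X]mxE [X in _ * X]mxE. Qed.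

Lemma slope_factor_C1 i : C1_on (chart_range i) (slope_factor i u).
Proof.
apply: (@C1_on_near _ _ _ (fun y => Num.sqrt (1 + gpair i u u y))).
- exact: range_open.
- by move=> y ry; rewrite /slope_factor sqnorm_grad.
- apply: C1_on_sqrt => [|y ry|]; first exact: range_open.
    by rewrite ltr_pwDl// gpair_ge0.
  apply: C1_onD; [exact: range_open|exact: C1_on_cst|].
  rewrite (_ : gpair i u u = fun y => \sum_k grad i u y 0 k * 'D_(basis_vec k) (u \o param i) y).
    apply: C1_on_sum => [|k _]; first exact: range_open.
    apply: C1_onM; [exact: range_open|exact: grad_C1|].
    by apply: smooth_on_C1; [exact: range_open|apply: smooth_on_partial; exact: smooth_u].
  by apply/funext => y; exact: gpair_grad.
Qed.

Lemma chart_field_C1 i k : C1_on (chart_range i) (chart_field i k).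
Proof.
apply: C1_onM; [exact: range_open| |exact: grad_C1].
apply: C1_onV; [exact: range_open| |exact: slope_factor_C1].
by move=> y ry; rewrite slope_factorE// gt_eqF// slope_gt0.
Qed.

Lemma chart_field_sum i b y : chart_range i y ->
  \sum_k chart_field i k y * 'D_(basis_vec k) (b \o param i) y =
  (slope (param i y))^-1 * gpair i u b y.
Proof.
move=> ry; rewrite gpair_grad mulr_sumr; apply: eq_bigr => k _.
by rewrite /chart_field slope_factorE// mulrA.
Qed.

(** The components of X in the chart. *)
Definition wfield i (k : 'I_n) y : R := weight (param i y) * chart_field i k y.

Lemma wfield_C1 i k : C1_on (chart_range i) (wfield i k).
Proof. by apply: C1_onM; [exact: range_open|exact: weight_C1P|exact: chart_field_C1]. Qed.

Lemma chart_soliton i y : chart_range i y ->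
  \sum_k 'D_(basis_vec k) (fun z => Num.sqrt (\det (gram i z)) * chart_field i k z) y =
  Num.sqrt (\det (gram i y)) * (c / slope (param i y)).
Proof.
move=> ry; have := hu.2 i y ry; rewrite /divergence slope_factorE// => <-.
rewrite mulrA divff ?mul1r; last by rewrite gt_eqF// sqrtr_gt0 det_gram_gt0.
apply: eq_bigr => k _; congr ('D_(basis_vec k) _ y); apply/funext => z.
by rewrite /chart_field [in RHS]mxE.
Qed.

(** This is div (theta X) = <X, grad theta> - theta S, multiplied by the density. The soliton
    equation contributes c e^(- lam u) / W and the derivative of the weight - lam e^(- lam u) |grad
    u|^2 / W; together they are - S. *)
Lemma chart_divergence i theta y : C1P M theta -> chart_range i y ->
  \sum_k 'D_(basis_vec k) (fun z => theta (param i z) * Num.sqrt (\det (gram i z)) * wfield i k z) y =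
  Num.sqrt (\det (gram i y)) * (flow theta (param i y) - theta (param i y) * source (param i y)).
Proof.
move=> Ct ry; set s := Num.sqrt _; set p := param i y.
have Cu := soliton_C1P.
have oR : open (chart_range i) by exact: range_open.
have der (f : 'rV[R]_n -> R) k : C1_on (chart_range i) f -> derivable f y (basis_vec k).
  by move=> Cf; apply: diff_derivable; have [] := Cf y ry.
have Cw : C1_on (chart_range i) (weight \o param i) by exact: weight_C1P.
have Cti := Ct i.
have dw k : 'D_(basis_vec k) (weight \o param i) y =
    - lam * weight p * 'D_(basis_vec k) (u \o param i) y.
  have CU : C1_on (chart_range i) (cst (- lam) \* (u \o param i)).
    by apply: C1_onM; [exact: oR|exact: C1_on_cst|exact: Cu].
  rewrite -[weight \o param i]/(expR \o (cst (- lam) \* (u \o param i))) derive_comp1//.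
  - have -> : 'D_1 expR ((cst (- lam) \* (u \o param i)) y) = weight p by exact: derive_val.
    rewrite (deriveM (derivable_cst _ _ _) (der _ k (Cu i))) derive_cst.
    by rewrite /GRing.scale/= mulr0 addr0 mulrAC.
  - by have [] := CU y ry.
have E k : 'D_(basis_vec k) (fun z => theta (param i z) * Num.sqrt (\det (gram i z)) * wfield i k z) y =
  theta p * weight p * 'D_(basis_vec k) (fun z => Num.sqrt (\det (gram i z)) * chart_field i k z) y +
  s * (theta p * (- lam * weight p) * (chart_field i k y * 'D_(basis_vec k) (u \o param i) y) +
     weight p * (chart_field i k y * 'D_(basis_vec k) (theta \o param i) y)).
  have -> : (fun z => theta (param i z) * Num.sqrt (\det (gram i z)) * wfield i k z) =
    ((theta \o param i) \* (weight \o param i)) \* (fun z => Num.sqrt (\det (gram i z)) * chart_field i k z).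
    by apply/funext => z; rewrite /wfield/=; ring.
  have C1 : C1_on (chart_range i) ((theta \o param i) \* (weight \o param i)) by apply: C1_onM; [exact: oR|exact: Cti|exact: Cw].
  have C2 : C1_on (chart_range i) (fun z => Num.sqrt (\det (gram i z)) * chart_field i k z).
    by apply: C1_onM; [exact: oR|exact: sqrt_det_gram_C1|exact: chart_field_C1].
  rewrite (deriveM (der _ k C1) (der _ k C2)) (deriveM (der _ k Cti) (der _ k Cw)) dw.
  rewrite /GRing.scale/= -/p -/s; ring.
rewrite (eq_bigr _ (fun k _ => E k)) big_split/= -mulr_sumr chart_soliton// -/s -/p.
rewrite -mulr_sumr big_split/= -!mulr_sumr !chart_field_sum// -/p.
rewrite -!dpair_param// -/p /flow /source.
by field; rewrite gt_eqF// slope_gt0.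
Qed.

End Soliton.

(** * Testing with a Lipschitz function *)

(** Integrability accompanies the sign because additivity of the integral asks for it. *)
Definition nonneg_mean d (T : measurableType d) (R : realType)
    (mu : {measure set T -> \bar R}) (f : T -> R) :=
  mu.-integrable setT (EFin \o f) /\ 0 <= \int[mu]_x f x.

Section NonnegMean.
Context d (T : measurableType d) (R : realType) (mu : {measure set T -> \bar R}).
Implicit Types f g : T -> R.

Lemma nonneg_mean_cst0 : nonneg_mean mu (fun=> 0).
Proof.
split; first exact: integrable0.
by rewrite Rintegral_ge0.
Qed.

Lemma nonneg_meanD f g : nonneg_mean mu f -> nonneg_mean mu g ->
  nonneg_mean mu (fun x => f x + g x).
Proof.
move=> [f1 f0] [g1 g0]; split; first exact: (integrableD _ f1 g1).
by rewrite RintegralD// addr_ge0.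
Qed.

Lemma nonneg_mean_sum (I : finType) (F : I -> T -> R) :
  (forall i, nonneg_mean mu (F i)) -> nonneg_mean mu (fun x => \sum_i F i x).
Proof.
move=> HF; elim: (index_enum I) => [|i s IH].
  rewrite (_ : (fun x => _) = fun=> 0); first exact: nonneg_mean_cst0.
  by apply/funext => x; rewrite big_nil.
rewrite (_ : (fun x => _) = fun x => F i x + \sum_(j <- s) F j x); first exact: nonneg_meanD.
by apply/funext => x; rewrite big_cons.
Qed.

Lemma nonneg_mean_le f g : nonneg_mean mu f -> mu.-integrable setT (EFin \o g) ->
  (forall x, f x <= g x) -> nonneg_mean mu g.
Proof.
move=> [f1 f0] g1 fg; split=> //; apply: (le_trans f0).
by apply: le_Rintegral => // x _; exact: fg.
Qed.

End NonnegMean.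

Lemma compact_product_integrable (T : ptopologicalType) (R : realType)
    (mu : {measure set (borel T) -> \bar R}) (B K U : set T) (phi g : T -> R) (C : R) :
  measurable (B : set (borel T)) -> (mu B < +oo)%E -> B `<=` K -> compact K -> K `<=` U -> open U ->
  (forall x, U x -> {for x, continuous g}) ->
  measurable_fun setT (phi : borel T -> R) -> (forall x, `|phi x| <= C) ->
  (forall x, ~ B x -> phi x * (g \_ U) x = 0) ->
  mu.-integrable setT (EFin \o (fun x => phi x * (g \_ U) x : R)).
Proof.
move=> mB muB BK cK KU oU cg mphi phiC z.
have [c c0 hc] := compact_continuous_bounded cK (fun x Kx => cg x (KU x Kx)).
have C0 : 0 <= C by apply: le_trans (phiC point).
apply: (@bounded_support_integrable _ _ _ mu B (C * c)) => //.
- by apply: measurable_funM => //; exact: patch_borelR.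
- move=> x; have [Bx|nBx] := pselect (B x); last by rewrite z// normr0 mulr_ge0.
  by rewrite normrM ler_pM// patchE mem_set ?hc//; [exact: BK|apply/KU/BK].
Qed.

Section ByParts.
Context {R : realType} {n : nat} (mu : {measure set (borel 'rV[R]_n) -> \bar R}).
Hypothesis mu_fin : forall M : R, (mu [set x : 'rV[R]_n | (`|x| <= M)%R] < +oo)%E.
Hypothesis mu_shift : forall (v : 'rV[R]_n) (A : set (borel 'rV[R]_n)),
  measurable A -> mu ((fun x : 'rV[R]_n => x + v) @^-1` A) = mu A.
Variables (phi ell : 'rV[R]_n -> R) (C : R).
Hypothesis mphi : measurable_fun setT (phi : borel 'rV[R]_n -> R).
Hypothesis mell : measurable_fun setT (ell : borel 'rV[R]_n -> R).
Hypotheses (phiC : forall x, `|phi x| <= C) (ellC : forall x, `|ell x| <= C).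
Variables (U K : set 'rV[R]_n).
Hypotheses (oU : open U) (cK : compact K) (KU : K `<=` U).

Let mK : measurable (K : set (borel 'rV[R]_n)).
Proof. by apply: borel_closed; apply: compact_closed => //; exact: norm_hausdorff. Qed.

Lemma compact_norm_le : exists M : R, forall x, K x -> `|x| <= M.
Proof.
have [M [_ hM]] := compact_bounded cK; exists (`|M| + 1) => x Kx.
by apply: (hM (`|M| + 1) _ x) => //; rewrite (le_lt_trans (ler_norm M))// ltrDl.
Qed.

Lemma measure_compact_lty : (mu K < +oo)%E.
Proof.
have [M hM] := compact_norm_le; apply: le_lt_trans (mu_fin M).
by apply: le_measure; rewrite ?inE//; apply: borel_closed; exact: closed_norm_le.
Qed.

Lemma patch_product_integrable (psi g : 'rV[R]_n -> R) :
  measurable_fun setT (psi : borel 'rV[R]_n -> R) -> (forall x, `|psi x| <= C) ->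
  (forall x, U x -> {for x, continuous g}) -> (forall x, U x -> ~ K x -> g x = 0) ->
  mu.-integrable setT (EFin \o (fun x => psi x * (g \_ U) x : R)).
Proof.
move=> mpsi psiC cg g0.
apply: (@compact_product_integrable _ _ mu K K U psi g C) => //; first exact: measure_compact_lty.
move=> x nKx; rewrite patchE; case: ifPn => [/set_mem Ux|_]; last by rewrite mulr0.
by rewrite g0// mulr0.
Qed.

(** Integration by parts along a constant vector, localized to [K]. The Lipschitz bound of [phi] is
    split into a factor [ell] depending on the point and a factor [kappa] depending on the
    direction, so that several directions can share one [ell]. *)
Lemma by_parts_nonneg (F : 'rV[R]_n -> R) (v : 'rV[R]_n) (kappa delta : R) :
  0 < delta -> C1_on U F -> (forall x, U x -> ~ K x -> F x = 0) ->
  (forall t y, 0 < t < delta -> K y -> `|phi (y - t *: v) - phi y| <= t * (kappa * ell y)) ->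
  nonneg_mean mu (fun y => phi y * ((fun z => 'D_v F z) \_ U) y + ell y * ((fun z => kappa * `|F z|) \_ U) y).
Proof.
move=> delta0 CF F0 H.
have clK : closed K by apply: compact_closed => //; exact: norm_hausdorff.
have [CFU DFU] := C1_on_restrict oU clK KU F0 CF.
have [M hM] := compact_norm_le.
have FU0 x : ~ K x -> (F \_ U) x = 0.
  by move=> nK; rewrite patchE; case: ifPn => // /set_mem Ux; rewrite F0.
have i1 : mu.-integrable setT (EFin \o (fun x => ell x * ((fun z => kappa * `|F z|) \_ U) x : R)).
  apply: patch_product_integrable => // [x Ux|x Ux nK]; last by rewrite F0// normr0 mulr0.
  apply: continuousM_at; first exact: continuous_cst_at.
  by apply: continuous_comp; [exact: (C1_on_continuous CF)|exact: norm_continuous].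
have i2 : mu.-integrable setT (EFin \o (fun x => phi x * ((fun z => 'D_v F z) \_ U) x : R)).
  apply: patch_product_integrable => // [x Ux|x Ux nK]; first exact: (CF x Ux).2.
  have oUK : open (U `&` ~` K) by apply: openI => //; exact: closed_openC.
  rewrite (near_derive v oUK (conj Ux nK) (g := cst 0)) ?derive_cst//.
  by move=> y [Uy nKy]; rewrite F0.
split; first exact: (integrableD _ i2 i1).
rewrite RintegralD// -lerBlDr sub0r.
have -> : \int[mu]_x (phi x * ((fun z => 'D_v F z) \_ U) x) = \int[mu]_x (phi x * 'D_v (F \_ U) x).
  by apply: eq_Rintegral => x _; rewrite DFU.
apply: (@integral_by_parts_ge _ _ mu mu_fin mu_shift phi (F \_ U) _ v M C delta) => //.
- by move=> x hx; apply: FU0 => /hM; rewrite leNgt hx.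
- move=> t y td; have [Ky|nKy] := pselect (K y).
    have Uy := KU Ky; rewrite !patchE mem_set//.
    have -> : t * (ell y * (kappa * `|F y|)) = t * (kappa * ell y) * `|F y| by ring.
    by rewrite ler_wpM2r// H.
  rewrite FU0// normr0 mulr0 patchE; case: ifPn => [/set_mem Uy|_]; last by rewrite !mulr0.
  by rewrite F0// normr0 !mulr0.
Qed.

Lemma divergence_nonneg (f h : 'rV[R]_n -> R) (X : 'I_n -> 'rV[R]_n -> R) (x0 : 'rV[R]_n)
    (kappa0 delta : R) (kappa : 'I_n -> R) :
  0 < delta -> C1_on U f -> (forall x, U x -> ~ K x -> f x = 0) -> (forall x, 0 <= f x) ->
  (forall k, C1_on U (X k)) -> (forall x, U x -> {for x, continuous h}) -> (forall x, 0 <= ell x) ->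
  (forall t y, 0 < t < delta -> K y ->
     `|phi (y - t *: \row_k X k x0) - phi y| <= t * (kappa0 * ell y)) ->
  (forall k t y, 0 < t < delta -> K y ->
     `|phi (y - t *: basis_vec k) - phi y| <= t * (kappa k * ell y)) ->
  (forall y, K y -> kappa0 + \sum_k kappa k * `|X k y - X k x0| <= h y) ->
  nonneg_mean mu (fun y =>
    phi y * ((fun z => \sum_k 'D_(basis_vec k) (fun w => f w * X k w) z) \_ U) y +
    ell y * ((fun z => h z * f z) \_ U) y).
Proof.
move=> delta0 Cf f0 f_ge0 CX ch ell0 H0 Hk Hh.
pose E k y := X k y - X k x0; pose V0 := \row_k X k x0 : 'rV[R]_n.
have CE k : C1_on U (E k).
  by apply: (C1_onD oU (CX k)); exact: (@C1_on_cst _ _ _ (- X k x0)).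
have N0 := by_parts_nonneg delta0 Cf f0 H0.
have NE k : nonneg_mean mu (fun y => phi y * ((fun z => 'D_(basis_vec k) (f \* E k) z) \_ U) y +
    ell y * ((fun z => kappa k * `|(f \* E k) z|) \_ U) y).
  apply: (by_parts_nonneg delta0) => [||t y td Ky]; [exact: C1_onM| |exact: Hk].
  by move=> x Ux nK /=; rewrite f0// mul0r.
have := nonneg_meanD N0 (nonneg_mean_sum NE).
move=> /nonneg_mean_le; apply.
  have i1 : mu.-integrable setT (EFin \o (fun x => phi x *
      ((fun z => \sum_k 'D_(basis_vec k) (fun w => f w * X k w) z) \_ U) x : R)).
    apply: patch_product_integrable => // x Ux.
      by apply: continuous_sumr => k; exact: (C1_onM oU Cf (CX k) Ux).2.
    move=> nK; rewrite big1// => k _.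
    have oUK : open (U `&` ~` K).
      by apply: openI => //; apply: closed_openC; apply: compact_closed => //; exact: norm_hausdorff.
    rewrite (near_derive _ oUK (conj Ux nK) (g := cst 0)) ?derive_cst//.
    by move=> y [Uy nKy]; rewrite f0// mul0r.
  have i2 : mu.-integrable setT (EFin \o (fun x => ell x * ((fun z => h z * f z) \_ U) x : R)).
    apply: patch_product_integrable => // x Ux; last by move=> nK; rewrite f0// mulr0.
    by apply: continuousM_at; [exact: ch|exact: (C1_on_continuous Cf)].
  exact: (integrableD _ i1 i2).
move=> y; rewrite !patchE; case: ifPn => [/set_mem Uy|nUy]; last first.
  by rewrite !mulr0 !addr0 add0r big1// => k _; rewrite !patchE (negbTE nUy) !mulr0 addr0.
have der k : 'D_(basis_vec k) (fun w => f w * X k w) y =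
    X k x0 * 'D_(basis_vec k) f y + 'D_(basis_vec k) (f \* E k) y.
  have df : derivable f y (basis_vec k) by apply: diff_derivable; have [] := Cf y Uy.
  have dE : derivable (f \* E k) y (basis_vec k).
    by apply: diff_derivable; have [] := C1_onM oU Cf (CE k) Uy.
  have -> : (fun w => f w * X k w) = (cst (X k x0) \* f) \+ (f \* E k).
    by apply/funext => w /=; rewrite /E; ring.
  have dc : derivable (cst (X k x0) : 'rV[R]_n -> R) y (basis_vec k) by exact: derivable_cst.
  have dcf : derivable (cst (X k x0) \* f) y (basis_vec k) := derivableM dc df.
  rewrite (deriveD dcf dE) (deriveM dc df) derive_cst.
  by rewrite /GRing.scale/= mulr0 addr0.
have dV : 'D_V0 f y = \sum_k X k x0 * 'D_(basis_vec k) f y.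
  by rewrite derive_sum_basis; [apply: eq_bigr => k _; rewrite mxE|have [] := Cf y Uy].
rewrite (eq_bigr _ (fun k _ => der k)) [in leRHS]big_split/= -dV.
have -> : \sum_i (phi y * ((fun z => 'D_(basis_vec i) (f \* E i) z) \_ U) y +
    ell y * ((fun z => kappa i * `|(f \* E i) z|) \_ U) y) =
  phi y * \sum_k 'D_(basis_vec k) (f \* E k) y + ell y * ((\sum_k kappa k * `|E k y|) * f y).
  rewrite mulr_suml !mulr_sumr -big_split; apply: eq_bigr => k _ /=.
  by rewrite !patchE mem_set// normrM (ger0_norm (f_ge0 y)); ring.
rewrite (ger0_norm (f_ge0 y)).
have [Ky|nKy] := pselect (K y); last by rewrite (f0 y)// !mulr0 !addr0 mulrDr.
(* The two integrands differ by [ell * f] times the slack in the bound by [h]. *)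
have := Hh y Ky; rewrite -subr_ge0 => hh.
rewrite -subr_ge0; apply: le_trans (mulr_ge0 (mulr_ge0 (ell0 y) hh) (f_ge0 y)) _.
by rewrite le_eqVlt; apply/orP; left; apply/eqP; rewrite /E; ring.
Qed.

End ByParts.

Lemma near_lt {R : realType} {T : topologicalType} (f g : T -> R) (x : T) :
  {for x, continuous f} -> {for x, continuous g} -> f x < g x -> \forall y \near x, f y < g y.
Proof.
move=> cf cg fg; have cB := continuousB_at cg cf.
have fg0 : 0 < g x - f x by rewrite subr_gt0.
have h : \forall y \near x, 0 < g y - f y by exact: (cvgr_gt (g x - f x)).
by apply: filterS h => y; rewrite subr_gt0.
Qed.

(** * The exponential cutoff and the estimate in one chart *)

Section Cutoff.
Context {R : realType}.
Implicit Types a b d k x : R.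

Lemma expR_sub1_norm x : `|x| <= 1 / 2 -> `|expR x - 1| <= 2 * `|x|.
Proof.
move=> x12; have h1 := expR_ge1Dx x; have h2 := expR_ge1Dx (- x).
have e0 := expR_gt0 x; have E : expR x * expR (- x) = 1 by rewrite -expRD subrr expR0.
have h3 : expR x * (1 - x) <= 1 by rewrite -[leRHS]E ler_wpM2l// ltW.
have xx : - `|x| <= x <= `|x| by rewrite -ler_norml.
case/andP: xx => xa xb; case: (ger0P x) x12 xa xb => x0 x12 xa xb; rewrite ler_norml; apply/andP; split; nra.
Qed.

Lemma max0_dist a b : `|Num.max 0 a - Num.max 0 b| <= `|a - b|.
Proof.
have h1 := ler_norm (a - b); have h2 := ler_norm (b - a); rewrite distrC in h2.
rewrite /Num.max; case: ifPn; case: ifPn; rewrite -?leNgt => hb ha;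
  rewrite ler_norml; apply/andP; split; lra.
Qed.

(** The factor 2 comes from linearizing the exponential for kap d <= 1/2. If b >= rad + 1, then a >=
    rad because d <= 1, and both truncated values vanish. *)
Lemma expR_cutoff_dist (kap rad a b d : R) : 0 < kap -> `|a - b| <= d -> d <= 1 -> kap * d <= 1 / 2 ->
  `|Num.max 0 (expR (- kap * a) - expR (- kap * rad)) - Num.max 0 (expR (- kap * b) - expR (- kap * rad))| <=
  d * (if b < rad + 1 then 2 * kap * expR (- kap * b) else 0).
Proof.
move=> kap0 abd d1 kd.
have d0 : 0 <= d by apply: le_trans abd.
have mono x y : x <= y -> expR (- kap * y) <= expR (- kap * x).
  by move=> xy; rewrite ler_expR !mulNr lerN2 ler_wpM2l// ltW.
case: ltP => hb.
  apply: le_trans (max0_dist _ _) _.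
  have E : expR (- kap * a) = expR (- kap * b) * expR (kap * (b - a)) by rewrite -expRD; congr expR; ring.
  have -> : expR (- kap * a) - expR (- kap * rad) - (expR (- kap * b) - expR (- kap * rad)) =
     expR (- kap * b) * (expR (kap * (b - a)) - 1) by rewrite E; ring.
  rewrite normrM gtr0_norm ?expR_gt0//.
  have hk : `|kap * (b - a)| <= kap * d by rewrite normrM (gtr0_norm kap0) ler_pM2l// distrC.
  have h := expR_sub1_norm (le_trans hk kd).
  have -> : d * (2 * kap * expR (- kap * b)) = expR (- kap * b) * (2 * (kap * d)) by ring.
  by rewrite ler_pM2l ?expR_gt0//; apply: le_trans h _; rewrite ler_pM2l.
have ha : rad <= a by move: abd; rewrite ler_norml => /andP[? ?]; lra.
have hb' : rad <= b by lra.
by rewrite !max_l ?subr_le0 ?mono// subrr normr0 mulr0.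
Qed.

End Cutoff.

Section LocalStep.
Context {R : realType} {n : nat} {P : ptopologicalType}.
Variable M : riemannianManifold R n P.
Variables (c : R) (u : P -> R).
Hypothesis hu : translating_soliton_graph M c u.
Hypothesis c0 : c < 0.
Variable vol : {measure set (borel P) -> \bar R}.
Hypothesis hvol : is_riemannian_volume M vol.
Variables (o : P) (lam kap rad : R).
Hypotheses (kap0 : 0 < kap) (lam0 : 0 < lam) (kaplam : (4 * kap) ^+ 2 <= - c * lam).
Hypothesis vol_fin : (vol (rball M o (rad + 1)) < +oo)%E.
Hypothesis ball_compact : in_compact (rball M o (rad + 1)).
Implicit Types (i : chart_index M) (p q : P) (x y : 'rV[R]_n) (theta : P -> R).

Let bigball := rball M o (rad + 1).
Local Notation weightu := (weight u lam).
Local Notation slopeu := (slope M u).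
Local Notation sourceu := (source M c u lam).
Local Notation flowu := (flow M u lam).

Definition cutoff p : R := Num.max 0 (expR (- kap * rdist M o p) - expR (- kap * rad)).
(** A bound for the increments of [cutoff] per unit of distance; see [expR_cutoff_dist] for the
    factor 2 and the radius rad + 1. *)
Definition wall : P -> R := (fun p => 2 * kap * expR (- kap * rdist M o p)) \_ bigball.
(** A bound for |X|. Against the slope 2 kap the first term yields S / 2, which can be absorbed; the
    second one serves for the part of the slope that [cutoff] does not control. *)
Definition cap p : R := Num.min (sourceu p / (4 * kap)) (2 * weightu p).

Lemma source_gt0 p : 0 < sourceu p.
Proof.
rewrite /source divr_gt0 ?slope_gt0// mulr_gt0 ?weight_gt0//.
by rewrite ltr_pwDl ?oppr_gt0// mulr_ge0 ?dpair_ge0// ltW.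
Qed.

(** The left-hand side is |X|. With a = - c and t = |grad u|, the bound by S / (4 kap) says 4 kap t
    < a + lam t^2, and the other one follows from t < W. Strictness leaves the room in which X is
    frozen in [local_flux_ge0]. *)
Lemma flow_speed_lt_cap p : weightu p / slopeu p * Num.sqrt (dpair M u u p) < cap p.
Proof.
have w0 : 0 < weightu p := weight_gt0 u lam p.
have s0 : 0 < slopeu p := slope_gt0 M u p.
have d0 : 0 <= dpair M u u p := dpair_ge0 M u p.
have t0 : 0 <= Num.sqrt (dpair M u u p) by exact: sqrtr_ge0.
have E : Num.sqrt (dpair M u u p) ^+ 2 = dpair M u u p by rewrite sqr_sqrtr.
have st : Num.sqrt (dpair M u u p) < slopeu p by rewrite ltr_sqrt ltr_pwDl// ltr01.
rewrite lt_min; apply/andP; split; last first.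
  rewrite -mulrA (mulrC _^-1) (mulrC 2) ltr_pM2l//.
  by rewrite ltr_pdivrMr//; lra.
rewrite ltr_pdivlMr; last by rewrite mulr_gt0.
rewrite /source.
set t := Num.sqrt _ in t0 E st *; clearbody t.
have -> : weightu p / slopeu p * t * (4 * kap) = weightu p * (4 * kap * t) / slopeu p by ring.
rewrite ltr_pM2r ?invr_gt0// ltr_pM2l// -E.
have a0 : 0 < - c by rewrite oppr_gt0.
(* The quadratic in t is completed to a square; the remaining coefficient is positive because (4
   kap)^2 <= a lam < 4 a lam. The case t = 0 is settled by a > 0. *)
have K : 4 * - c * (- c + lam * t ^+ 2 - 4 * kap * t) =
   (2 * - c - 4 * kap * t) ^+ 2 + (4 * (- c * lam) - (4 * kap) ^+ 2) * t ^+ 2 by ring.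
have [t00|tn0] := eqVneq t 0; first by rewrite t00 expr0n/= !mulr0 addr0.
have tp : 0 < t by rewrite lt_def tn0.
rewrite -subr_gt0 -(pmulr_rgt0 _ (_ : 0 < 4 * - c)); last by rewrite mulr_gt0.
rewrite K ltr_wpDl ?sqr_ge0// mulr_gt0 ?exprn_gt0// subr_gt0.
apply: le_lt_trans kaplam _; rewrite ltr_pMl ?mulr_gt0//; lra.
Qed.

Lemma cutoff_continuous : continuous cutoff.
Proof.
apply: continuous_pointwise => p; apply: continuous_max; first exact: continuous_cst_at.
apply: continuousB_at; last exact: continuous_cst_at.
apply: (@continuous_comp_at R P _ expR); last exact: continuous_expR.
by apply: continuousM_at; [exact: continuous_cst_at|exact: rdist_continuous].
Qed.

Lemma cutoff_ge0 p : 0 <= cutoff p.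
Proof. by rewrite /cutoff le_max lexx. Qed.

Lemma expR_kap_le1 p : expR (- kap * rdist M o p) <= 1.
Proof. by rewrite -expR0 ler_expR mulNr oppr_le0 mulr_ge0 ?rdist_ge0// ltW. Qed.

Lemma cutoff_le1 p : `|cutoff p| <= 1.
Proof.
rewrite ger0_norm ?cutoff_ge0// /cutoff ge_max ler01/=.
have := expR_kap_le1 p; have := expR_gt0 (- kap * rad); lra.
Qed.

Lemma cutoff_out p : ~ bigball p -> cutoff p = 0.
Proof.
move=> /negP; rewrite -leNgt => h.
by rewrite /cutoff max_l// subr_le0 ler_expR !mulNr lerN2 ler_wpM2l ?ltW//; lra.
Qed.

Lemma wall_ge0 p : 0 <= wall p.
Proof. by rewrite /wall patchE; case: ifPn => // _; rewrite !mulr_ge0 ?expR_ge0// ltW. Qed.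

Lemma wall_le p : `|wall p| <= 2 * kap.
Proof.
rewrite ger0_norm ?wall_ge0// /wall patchE; case: ifPn => _; last by rewrite mulr_ge0// ltW.
by rewrite ler_piMr ?expR_kap_le1// mulr_ge0// ltW.
Qed.

Lemma wall_out p : ~ bigball p -> wall p = 0.
Proof. by move=> np; rewrite /wall patchE memNset. Qed.

Lemma bigball_open : open bigball.
Proof. exact: open_rball. Qed.

Lemma wall_measurable : measurable_fun setT (wall : borel P -> R).
Proof.
apply: patch_borelR; first exact: bigball_open.
move=> p _; apply: continuousM_at; first exact: continuous_cst_at.
apply: (@continuous_comp_at R P _ expR); last exact: continuous_expR.
by apply: continuousM_at; [exact: continuous_cst_at|exact: rdist_continuous].
Qed.

Lemma cap_continuous : continuous cap.
Proof.
apply: continuous_pointwise => p; apply: continuous_min.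
  by apply: continuousM_at; [exact: (source_continuous hu)|exact: continuous_cst_at].
by apply: continuousM_at; [exact: continuous_cst_at|exact: (C1P_continuous (weight_C1P hu lam))].
Qed.

Lemma bigball_integrable (psi g : P -> R) (C : R) :
  measurable_fun setT (psi : borel P -> R) -> (forall p, `|psi p| <= C) ->
  (forall p, ~ bigball p -> psi p = 0) -> continuous g ->
  vol.-integrable setT (EFin \o (fun p => psi p * g p : R)).
Proof.
move=> mpsi psiC psi0 cg; have [K cK BK] := ball_compact.
have := @compact_product_integrable P R vol bigball K setT psi g C.
rewrite (_ : g \_ setT = g); last by apply/funext => p; rewrite patchE mem_set.
apply=> //; first exact: borel_open bigball_open.
- exact: openT.
- by move=> p _; exact: cg.
- by move=> p np; rewrite psi0// mul0r.
Qed.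

Lemma cutoff_lipschitz p q (d : R) : `|rdist M o p - rdist M o q| <= d -> d <= 1 -> kap * d <= 1 / 2 ->
  `|cutoff p - cutoff q| <= d * wall q.
Proof.
move=> h d1 kd; have := expR_cutoff_dist rad kap0 h d1 kd.
rewrite /wall patchE; case: ltP => hq; first by rewrite mem_set.
by rewrite memNset//; apply/negP; rewrite -leNgt.
Qed.

Lemma cutoff_measurable : measurable_fun setT (cutoff : borel P -> R).
Proof. by apply: continuous_borelR; exact: cutoff_continuous. Qed.

(** With phi the cutoff: phi div (theta X) plus a bound for |grad phi| |theta X| when theta >= 0, so
    that formally its integral is nonnegative. It is linear in theta, which allows gluing. *)
Definition flux theta p : R :=
  cutoff p * (flowu theta p - theta p * sourceu p) + wall p * (cap p * theta p).

Lemma flux_integrable theta : C1P M theta -> vol.-integrable setT (EFin \o flux theta).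
Proof.
move=> Ct; have ct := C1P_continuous Ct.
have i1 : vol.-integrable setT (EFin \o (fun p => cutoff p * (flowu theta p - theta p * sourceu p) : R)).
  apply: (bigball_integrable cutoff_measurable cutoff_le1 cutoff_out).
  apply: continuous_pointwise => p; apply: continuousB_at; first exact: (flow_continuous hu).
  by apply: continuousM_at; [exact: ct|exact: (source_continuous hu)].
have i2 : vol.-integrable setT (EFin \o (fun p => wall p * (cap p * theta p) : R)).
  apply: (bigball_integrable wall_measurable wall_le wall_out).
  by apply: continuous_pointwise => p; apply: continuousM_at; [exact: cap_continuous|exact: ct].
exact: (integrableD _ i1 i2).
Qed.

Lemma cutoff_chart i y v (r kappa t : R) :
  (forall z, `|z - y| <= r -> chart_range i z /\ Num.sqrt (sqnorm i z v) <= kappa) ->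
  0 <= t -> t * `|v| <= r -> t * kappa <= 1 -> kap * (t * kappa) <= 1 / 2 ->
  `|cutoff (param i (y - t *: v)) - cutoff (param i y)| <= t * kappa * wall (param i y).
Proof.
move=> H t0 tv tk1 tk2; apply: cutoff_lipschitz => //.
have seg s : 0 <= s <= 1 -> chart_range i (y + s *: (- (t *: v))) /\
    Num.sqrt (sqnorm i (y + s *: (- (t *: v))) (- (t *: v))) <= t * kappa.
  move=> /andP[s0 s1].
  have [|rz hz] := H (y + s *: (- (t *: v))).
    rewrite addrC addKr normrZ normrN normrZ (ger0_norm s0) (ger0_norm t0).
    by apply: le_trans tv; rewrite ler_piMl// mulr_ge0.
  split=> //; rewrite [X in sqnorm i _ X](_ : _ = (- t) *: v); last by rewrite scaleNr.
  rewrite sqnormZ sqrrN sqrtrM ?sqr_ge0// sqrtr_sqr (ger0_norm t0).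
  by rewrite ler_wpM2l.
have [l lk jl] := joined_segment seg.
by apply: le_trans (rdist_dist _ _ _ _) _; rewrite rdist_sym; apply: le_trans (rdist_le jl) lk.
Qed.

(** In a small enough coordinate ball the norms are comparable and the oscillation of X fits into
    the gap between |X| at the centre and [cap]. The radius is fixed before theta, so that a bump
    can be fitted to it. *)
Lemma local_flux_ge0 p0 : let i := chart_at M p0 in exists2 rho : R, 0 < rho &
  (forall y, `|y - chart_map i p0| <= rho -> chart_range i y) /\
  forall theta, C1P M theta -> (forall p, 0 <= theta p) ->
    (forall p, theta p != 0 -> dom i p /\ `|chart_map i p - chart_map i p0| <= rho) ->
    0 <= \int[vol]_p flux theta p.
Proof.
move=> i; set x0 := chart_map i p0.
have dp0 : dom i p0 := dom_chart_at M p0.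
have rx0 : chart_range i x0 := dom_chart_range dp0.
pose X := @wfield R n P M u lam i; pose V0 : 'rV[R]_n := \row_k X k x0.
have V0cap : Num.sqrt (sqnorm i x0 V0) < cap p0.
  have -> : V0 = (weightu p0 / slopeu p0) *: grad i u x0.
    apply/rowP => k; rewrite [in LHS]mxE [in RHS]mxE /X /wfield /chart_field (slope_factorE hu)// /x0 chart_mapK//.
    by rewrite mulrA.
  have w0 : 0 <= weightu p0 / slopeu p0 by rewrite divr_ge0// ltW ?weight_gt0 ?slope_gt0.
  rewrite sqnormZ sqrtrM ?sqr_ge0// sqrtr_sqr ger0_norm// sqnorm_grad//.
  rewrite -(dpair_param (soliton_C1P hu) (soliton_C1P hu))// /x0 chart_mapK//.
  exact: flow_speed_lt_cap.
(* The midpoint of the gap: its lower half is for the variation of the metric, which changes the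
   norm of [V0], its upper half for the oscillation of X and of [cap]. *)
pose kappa0 := (Num.sqrt (sqnorm i x0 V0) + cap p0) / 2.
have kV : Num.sqrt (sqnorm i x0 V0) < kappa0 by rewrite /kappa0; lra.
have kC : kappa0 < cap p0 by rewrite /kappa0; lra.
have kappa00 : 0 < kappa0 by apply: le_lt_trans kV; exact: sqrtr_ge0.
have [r1 [C [r10 C0 HC]]] := norm_comparison rx0.
pose kappa k : R := C * `|basis_vec k : 'rV[R]_n|.
have N1 : \forall y \near x0, Num.sqrt (sqnorm i y V0) < kappa0.
  apply: (@near_lt R _ (fun y : 'rV[R]_n => Num.sqrt (sqnorm i y V0)) (fun=> kappa0) x0) => //; last exact: continuous_cst_at.
  apply: (@continuous_comp_at R _ (fun y : 'rV[R]_n => sqnorm i y V0) Num.sqrt); last exact: sqrt_continuous.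
  exact: sqnorm_continuous.
have N2 : \forall y \near x0, kappa0 + \sum_k kappa k * `|X k y - X k x0| < cap (param i y).
  apply: (@near_lt R _ (fun y : 'rV[R]_n => kappa0 + \sum_k kappa k * `|X k y - X k x0|)
    (fun y => cap (param i y)) x0); last first.
  - by rewrite big1 ?addr0 => [|k _]; rewrite ?subrr ?normr0 ?mulr0// /x0 chart_mapK.
  - by apply: continuous_comp; [exact: param_continuous_range|exact: cap_continuous].
  apply: continuousD_at; first exact: continuous_cst_at.
  apply: continuous_sumr => k; apply: continuousM_at; first exact: continuous_cst_at.
  apply: (@continuous_comp_at R _ _ Num.norm); last exact: norm_continuous.
  apply: continuousB_at; last exact: continuous_cst_at.
  exact: (C1_on_continuous (wfield_C1 hu lam (i := i) k)).
have /nbhs_ballP[e /= e0 He] : \forall y \near x0, Num.sqrt (sqnorm i y V0) < kappa0 /\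
    kappa0 + \sum_k kappa k * `|X k y - X k x0| < cap (param i y).
  by apply: filterS2 N1 N2.
(* Points of [K] translated by at most [rho] stay within 2 rho of [x0], strictly inside the ball of
   radius 3 rho where all bounds hold. *)
pose rho := Num.min r1 e / 3.
have me0 : 0 < Num.min r1 e by rewrite lt_min r10.
have rho0 : 0 < rho by rewrite divr_gt0.
have rho3 : 3 * rho = Num.min r1 e by rewrite /rho mulrC divfK.
have near_le z : `|z - x0| <= 2 * rho -> `|z - x0| <= r1 /\ ball x0 e z.
  have h1 : Num.min r1 e <= r1 by rewrite ge_min lexx.
  have h2 : Num.min r1 e <= e by rewrite ge_min lexx orbT.
  move=> h; split; first by lra.
  by rewrite -ball_normE/= distrC; lra.
exists rho => //; split=> [y hy|theta Ct theta0 supp].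
  have [|h1 _] := near_le y; first by apply: le_trans hy _; lra.
  by have [] := HC y h1.
have [mu [mu_fin mu_int mu_shift]] := @lebesgue_rV_exists R n.
pose U := chart_range i; pose K := [set y : 'rV[R]_n | `|y - x0| <= rho].
have KU : K `<=` U.
  by move=> y Ky; have [|h1 _] := near_le y; [apply: le_trans Ky _; lra|have [] := HC y h1].
have cK : compact K by exact: compact_norm_sub_le.
pose pe := param_ext i; have peE y : U y -> pe y = param i y.
  by move=> Uy; rewrite /pe /param_ext mem_set.
pose phi := (cutoff \o pe : 'rV[R]_n -> R); pose ell := (wall \o pe : 'rV[R]_n -> R).
pose N := kappa0 + \sum_k kappa k + `|V0| + \sum_k `|basis_vec k : 'rV[R]_n| + 1.
have sk0 : 0 <= \sum_k kappa k by apply: sumr_ge0 => k _; rewrite mulr_ge0// ltW.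
have sb0 : 0 <= \sum_k `|basis_vec k : 'rV[R]_n| by apply: sumr_ge0.
have V00 : 0 <= `|V0| by [].
have N0 : 0 < N by rewrite /N; lra.
(* [N] dominates the vectors and Lipschitz constants in use. For 0 < t < delta, t N < rho keeps the
   translates in the good ball, while t N < 1 and kap t N < 1/2 are the smallness conditions of
   [cutoff_chart]. *)
pose delta := Num.min (rho / N) (Num.min (1 / N) (1 / 2 / (kap * N))).
have delta0 : 0 < delta by rewrite !lt_min !divr_gt0// mulr_gt0.
have lip v kv : `|v| <= N -> 0 <= kv <= N ->
    (forall z, `|z - x0| <= 2 * rho -> chart_range i z /\ Num.sqrt (sqnorm i z v) <= kv) ->
    forall t y, 0 < t < delta -> K y -> `|phi (y - t *: v) - phi y| <= t * (kv * ell y).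
  move=> vN /andP[kv0 kvN] H t y /andP[t0]; rewrite !lt_min => /and3P[h1 h2 h3] Ky.
  have tN : t * N < rho by rewrite -ltr_pdivlMr.
  have tN1 : t * N < 1 by rewrite -ltr_pdivlMr.
  have tN2 : kap * (t * N) < 1 / 2 by rewrite mulrCA -ltr_pdivlMr// mulr_gt0.
  have tv : t * `|v| <= rho by apply/ltW/le_lt_trans/tN; rewrite ler_pM2l.
  have tk : t * kv <= t * N by rewrite ler_pM2l.
  have H' z : `|z - y| <= rho -> chart_range i z /\ Num.sqrt (sqnorm i z v) <= kv.
    move=> zy; apply: H; rewrite (_ : z - x0 = (z - y) + (y - x0)); last by rewrite addrA subrK.
    by apply: le_trans (ler_normD _ _) _; rewrite (_ : 2 * rho = rho + rho) ?lerD//; ring.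
  have Uyt : U (y - t *: v).
    by have [] // := H' (y - t *: v); rewrite addrC addKr normrN normrZ gtr0_norm.
  rewrite /phi /ell/= !peE//; last exact: KU.
  rewrite mulrA; apply: (cutoff_chart H') => //; first exact: ltW.
    by apply: le_trans tk _; exact: ltW.
  by apply: le_trans (ltW tN2); rewrite ler_pM2l.
have single k : kappa k <= \sum_j kappa j /\ `|basis_vec k : 'rV[R]_n| <= \sum_j `|basis_vec j : 'rV[R]_n|.
  split; rewrite (bigD1 k)//= lerDl sumr_ge0// => j _; rewrite mulr_ge0// ltW//.
have lip0 : forall t y, 0 < t < delta -> K y -> `|phi (y - t *: V0) - phi y| <= t * (kappa0 * ell y).
  apply: lip; [by rewrite /N; lra|by rewrite /N; lra|move=> z /near_le[h1 h2]].
  by have [? _] := HC z h1; have [/ltW ? _] := He z h2.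
have lipk k : forall t y, 0 < t < delta -> K y ->
    `|phi (y - t *: basis_vec k) - phi y| <= t * (kappa k * ell y).
  have [s1 s2] := single k; have kk0 : 0 <= kappa k by rewrite mulr_ge0// ltW.
  apply: lip; [by rewrite /N; lra|by rewrite /N; lra|move=> z /near_le[h1 h2]].
  by have [? /(_ (basis_vec k))[? _]] := HC z h1.
(* The volume density joins the scalar factor, so that the sum of the coordinate derivatives of
   [f * X k] is div (theta X) times the density. *)
pose f y := theta (param i y) * Num.sqrt (\det (gram i y)).
have mpe := param_ext_measurable i.
have mphi : measurable_fun setT (phi : borel 'rV[R]_n -> R) by exact: (measurableT_comp cutoff_measurable mpe).
have mell : measurable_fun setT (ell : borel 'rV[R]_n -> R) by exact: (measurableT_comp wall_measurable mpe).
have phiC y : `|phi y| <= 1 + 2 * kap by apply: le_trans (cutoff_le1 _) _; rewrite lerDl mulr_ge0// ltW.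
have ellC y : `|ell y| <= 1 + 2 * kap by apply: le_trans (wall_le _) _; rewrite lerDr.
have Cf : C1_on U f.
  by apply: C1_onM; [exact: range_open|exact: Ct|exact: sqrt_det_gram_C1].
have oU : open U by exact: range_open.
have fK y : U y -> ~ K y -> f y = 0.
  move=> Uy nK; rewrite /f; have [->|/supp[_]] := eqVneq (theta (param i y)) 0; first by rewrite mul0r.
  by have [_ ->] := chart_range_param Uy => /nK.
have ccap y : U y -> {for y, continuous (fun y => cap (param i y))}.
  move=> Uy; apply: continuous_comp; [exact: param_continuous_range|exact: cap_continuous].
have hcap y : K y -> kappa0 + \sum_k kappa k * `|X k y - X k x0| <= cap (param i y).
  move=> Ky; have [|_ hb] := near_le y; first by apply: le_trans Ky _; lra.
  by have [_ /ltW] := He y hb.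
have [_ D] := @divergence_nonneg R n mu mu_fin mu_shift phi ell (1 + 2 * kap) mphi mell phiC ellC U K oU cK KU
   f (fun y => cap (param i y)) X x0 kappa0 delta kappa delta0 Cf fK
   (fun y => mulr_ge0 (theta0 _) (sqrtr_ge0 _))
   (fun k => wfield_C1 hu lam (i := i) k) ccap (fun y => wall_ge0 (pe y)) lip0 lipk hcap.
have KP : closed (param i @` K).
  apply: compact_closed; first exact: manifold_hausdorff M.
  apply: continuous_compact => //; apply: continuous_in_subspaceT => y; rewrite inE => Ky.
  by apply: param_continuous_range; exact: KU.
have theta_out p : ~ (param i @` K) p -> theta p = 0.
  move=> nK; have [//|/supp[dp hp]] := eqVneq (theta p) 0.
  by exfalso; apply: nK; exists (chart_map i p); rewrite ?chart_mapK.
have flux_out p : ~ dom i p -> flux theta p = 0.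
  move=> nd; have nK : ~ (param i @` K) p.
    by move=> [y Ky E]; apply: nd; rewrite -E; have [] := chart_range_param (KU y Ky).
  rewrite /flux /flow theta_out// (@dpair_near0 _ _ _ M u theta (~` (param i @` K)) 0)//; last exact: closed_openC.
  ring.
rewrite (integral_chart hvol mu_int (i := i))//; last first.
  by have /integrableP[/measurable_EFinP] := flux_integrable Ct.
suff -> : \int[mu]_y (flux theta (pe y) * density_ext i y) = \int[mu]_x (phi x *
      ((fun z => \sum_k 'D_(basis_vec k) (fun w => f w * X k w) z) \_ U) x +
      ell x * ((fun z => cap (param i z) * f z) \_ U) x) by [].
apply: eq_Rintegral => y _; rewrite /density_ext !patchE; case: ifPn => [/set_mem Uy|nUy].
  rewrite (chart_divergence hu lam Ct Uy) /phi /ell/= peE// /flux /f; ring.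
by rewrite !mulr0 addr0.
Qed.

End LocalStep.

(** * Bumps on the manifold and gluing of the charts *)

Section Bumps.
Context {R : realType} {n : nat} {P : ptopologicalType}.
Variable M : riemannianManifold R n P.
Implicit Types (i : chart_index M) (p q : P) (x y : 'rV[R]_n).

Definition chart_bump i x (rho : R) p : R :=
  if `[< dom i p >] then bump x rho (chart_map i p) else 0.

Lemma chart_bumpE i x rho p : dom i p -> chart_bump i x rho p = bump x rho (chart_map i p).
Proof. by move=> dp; rewrite /chart_bump asboolT. Qed.

Lemma chart_bump_01 i x rho p : 0 <= chart_bump i x rho p <= 1.
Proof. by rewrite /chart_bump; case: ifP => _; [exact: bump_01|rewrite lexx ler01]. Qed.

Lemma chart_bump_neq0 i x rho p : 0 < rho -> chart_bump i x rho p != 0 ->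
  dom i p /\ `|chart_map i p - x| <= rho.
Proof.
move=> rho0; rewrite /chart_bump; case: asboolP => [dp|_]; last by rewrite eqxx.
by move=> b0; split=> //; apply: contraNT b0; rewrite -ltNge => /ltW /(bump0 rho0) ->.
Qed.

(** The support lies in the image of a compact coordinate ball, which is closed since P is
    Hausdorff. Hence the extension by zero vanishes in a neighbourhood of every point outside the
    chart. *)
Lemma chart_bump_C1P i x (rho : R) : 0 < rho ->
  (forall y, `|y - x| <= rho -> chart_range i y) -> C1P M (chart_bump i x rho).
Proof.
move=> rho0 Hr j.
pose K := [set y : 'rV[R]_n | `|y - x| <= rho].
have cK : compact K by exact: compact_norm_sub_le.
have KP : closed (param i @` K).
  apply: compact_closed; first exact: manifold_hausdorff M.
  apply: continuous_compact => //; apply: continuous_in_subspaceT => y; rewrite inE => Ky.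
  by apply: param_continuous_range; exact: Hr.
move=> y ry; have [dy|ndy] := pselect (dom i (param j y)).
  have oy : overlap j i y by apply/overlapP.
  apply: (@C1_on_near _ _ (overlap j i) (bump x rho \o transition j i)) oy; first exact: open_overlap.
    by move=> z /overlapP[_ dz]; rewrite /= chart_bumpE.
  apply: (@C1_on_comp_row _ _ _ _ setT) => //; [exact: open_overlap|move=> k|exact: bump_C1].
  exact: transition_C1.
pose O := chart_range j `&` param j @^-1` (~` (param i @` K)).
have oO : open O.
  rewrite openE => z [rz nz].
  have h1 : \forall w \near z, chart_range j w by apply: open_nbhs_nbhs; split=> //; exact: range_open.
  have h2 : \forall w \near z, (~` (param i @` K)) (param j w).
    by apply: (param_continuous_range rz); apply: open_nbhs_nbhs; split=> //; exact: closed_openC.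
  by apply: filterS2 h1 h2.
apply: (@C1_on_near _ _ O (cst 0)) => //.
- move=> z [rz nz] /=; apply/esym/eqP; apply: contrapT => /negP /(chart_bump_neq0 rho0)[dz hz].
  by apply: nz; exists (chart_map i (param j z)); rewrite ?chart_mapK.
- exact: C1_on_cst.
- by split=> // -[z Kz E]; apply: ndy; rewrite -E; have [] := chart_range_param (Hr z Kz).
Qed.

End Bumps.

Section Estimate.
Context {R : realType} {n : nat} {P : ptopologicalType}.
Variable M : riemannianManifold R n P.
Variables (c : R) (u : P -> R).
Hypothesis hu : translating_soliton_graph M c u.
Hypothesis c0 : c < 0.
Variable vol : {measure set (borel P) -> \bar R}.
Hypothesis hvol : is_riemannian_volume M vol.
Variables (o : P) (lam kap rad : R).
Hypotheses (kap0 : 0 < kap) (lam0 : 0 < lam) (kaplam : (4 * kap) ^+ 2 <= - c * lam).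
Hypothesis vol_fin : (vol (rball M o (rad + 1)) < +oo)%E.
Hypothesis ball_compact : in_compact (rball M o (rad + 1)).
Implicit Types (i : chart_index M) (p q : P) (x y : 'rV[R]_n) (theta : P -> R).

Local Notation bigball := (rball M o (rad + 1)).
Local Notation flowu := (flow M u lam).
Local Notation sourceu := (source M c u lam).
Local Notation fluxu := (flux M c u o lam kap rad).

Lemma fluxD theta1 theta2 p : C1P M theta1 -> C1P M theta2 ->
  fluxu (theta1 \+ theta2) p = fluxu theta1 p + fluxu theta2 p.
Proof. by move=> C1 C2; rewrite /flux /flow dpairDr//=; ring. Qed.

(** The free factor [eta] is what makes the notion stable: [localizer_or] applies it to products of
    [eta] with another localizing factor. *)
Definition localizer theta := [/\ C1P M theta, forall p, 0 <= theta p <= 1 &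
  forall eta, C1P M eta -> (forall p, 0 <= eta p) -> 0 <= \int[vol]_p fluxu (eta \* theta) p].

Lemma localizer0 : localizer (cst 0).
Proof.
split=> [|p|eta Ce _]; [exact: C1P_cst|by rewrite lexx ler01|].
rewrite (_ : \int[vol]_p _ = 0)//.
rewrite (_ : (fun p => _) = cst 0) ?Rintegral_cst0//; last first.
  apply/funext => p; rewrite /flux /flow (@dpair_near0 _ _ _ M u _ setT 0)//=; first ring.
  - exact: openT.
  - by move=> q _ /=; rewrite mulr0.
by rewrite /Rintegral integral0.
Qed.

(** The combination is 1 - (1 - theta1) (1 - theta2), equal to 1 wherever one of the two is. It
    takes the place of a partition of unity: its flux splits into those of eta theta1 and of (eta (1
    - theta1)) theta2. *)
Lemma localizer_or theta1 theta2 : localizer theta1 -> localizer theta2 ->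
  localizer (theta1 \+ (cst 1 \- theta1) \* theta2).
Proof.
move=> [C1 b1 H1] [C2 b2 H2].
have C1' : C1P M (cst 1 \- theta1).
  have -> : cst 1 \- theta1 = cst 1 \+ cst (-1) \* theta1 by apply/funext => p /=; ring.
  exact: (C1P_D (@C1P_cst _ _ _ M 1) (C1P_M (@C1P_cst _ _ _ M (-1)) C1)).
have C12 : C1P M (theta1 \+ (cst 1 \- theta1) \* theta2).
  exact: (C1P_D C1 (C1P_M C1' C2)).
split=> // [p|eta Ce eta0].
  by have /andP[? ?] := b1 p; have /andP[? ?] := b2 p; apply/andP; split=> /=; nra.
have Ca : C1P M (eta \* theta1) by exact: C1P_M.
have Ce' : C1P M (eta \* (cst 1 \- theta1)) by exact: C1P_M.
have Cb : C1P M ((eta \* (cst 1 \- theta1)) \* theta2) by exact: C1P_M.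
have i1 := flux_integrable hu lam kap0 vol_fin ball_compact Ca.
have i2 := flux_integrable hu lam kap0 vol_fin ball_compact Cb.
have -> : \int[vol]_p fluxu (eta \* (theta1 \+ (cst 1 \- theta1) \* theta2)) p =
   \int[vol]_p (fluxu (eta \* theta1) p + fluxu ((eta \* (cst 1 \- theta1)) \* theta2) p).
  apply: eq_Rintegral => p _; rewrite -fluxD//; congr (fluxu _ p).
  by apply/funext => q /=; ring.
rewrite RintegralD// addr_ge0//; first exact: H1.
by apply: H2 => // p /=; rewrite mulr_ge0// subr_ge0; have /andP[] := b1 p.
Qed.

Lemma localizer_near p0 : exists2 theta, localizer theta &
  exists U, [/\ open U, U p0 & forall p, U p -> theta p = 1].
Proof.
have [rho rho0 [Hr H]] := local_flux_ge0 hu c0 hvol kap0 lam0 kaplam vol_fin ball_compact p0.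
set i := chart_at M p0 in Hr H; set x0 := chart_map i p0 in Hr H.
have Cb := chart_bump_C1P rho0 Hr.
have dp0 : dom i p0 := dom_chart_at M p0.
exists (chart_bump i x0 rho).
  split=> // [p|eta Ce eta0]; first exact: chart_bump_01.
  apply: H => [|p|p] /=; first exact: C1P_M.
    by rewrite mulr_ge0//; have /andP[] := chart_bump_01 i x0 rho p.
  by rewrite mulf_eq0 negb_or => /andP[_]; exact: chart_bump_neq0.
exists (dom i `&` [set p | `|chart_map i p - x0| < rho / 2]); split.
- rewrite openE => p [dp hp].
  have h1 : \forall q \near p, dom i q by apply: open_nbhs_nbhs; split=> //; exact: dom_open.
  have h2 : \forall q \near p, `|chart_map i q - x0| < rho / 2.
    apply: (@near_lt R _ (fun q => `|chart_map i q - x0|) (fun=> rho / 2)) => //; last exact: continuous_cst_at.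
    apply: continuous_comp; last exact: norm_continuous.
    by apply: continuousBv_at; [exact: chart_map_continuous|exact: cst_continuous].
  by apply: filterS2 h1 h2.
- by split=> //=; rewrite subrr normr0 divr_gt0.
- by move=> p [dp hp]; rewrite chart_bumpE// bump1// ltW.
Qed.

Lemma localizer_compact (K : set P) : compact K -> exists2 theta, localizer theta &
  exists U, [/\ open U, K `<=` U & forall p, U p -> theta p = 1].
Proof.
move=> cK.
have [th Hth] := choice (fun p => let: ex_intro2 theta h1 h2 := localizer_near p in
  (ex_intro (fun th => localizer th /\ _) theta (conj h1 h2))).
have [V HV] := choice (fun p => (Hth p).2).
have cov : cover_compact K by rewrite -compact_cover.
have [p _|z Kz|D' _ D'cov] := cov P setT V; [by have [] := HV p|by exists z; have [] := HV z|].
suff [theta Lt H] : exists2 theta, localizer theta & forall q p, q \in finmap.enum_fset D' -> V q p -> theta p = 1.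
  exists theta => //; exists (\bigcup_(q in [set` finmap.enum_fset D']) V q); split.
  - by apply: bigcup_open => q _; have [] := HV q.
  - by move=> z /D'cov[q /= qD qz]; exists q.
  - by move=> p [q qD]; exact: H.
elim: (finmap.enum_fset D') => [|q s [theta Lt IH]].
  by exists (cst 0) => //; exact: localizer0.
exists (th q \+ (cst 1 \- th q) \* theta); first by apply: localizer_or => //; have [] := Hth q.
move=> q' p; rewrite inE => /orP[/eqP->|qs] Vp /=.
  by have [_ _ ->] := HV q; rewrite // subrr mul0r addr0.
by rewrite (IH q' p qs Vp) mulr1 addrC subrK.
Qed.

Lemma cutoff_source_integrable :
  vol.-integrable setT (EFin \o (fun p => cutoff M o kap rad p * sourceu p : R)).
Proof.
apply: (bigball_integrable vol_fin ball_compact (C := 1)).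
- exact: cutoff_measurable.
- by move=> p; exact: cutoff_le1.
- by move=> p; exact: cutoff_out.
- exact: (source_continuous hu).
Qed.

Lemma wall_cap_integrable :
  vol.-integrable setT (EFin \o (fun p => wall M o kap rad p * cap M c u lam kap p : R)).
Proof.
apply: (bigball_integrable vol_fin ball_compact (C := 2 * kap)).
- exact: wall_measurable.
- by move=> p; exact: wall_le.
- by move=> p; exact: wall_out.
- exact: (cap_continuous hu).
Qed.

Lemma ball_weight_integrable :
  vol.-integrable setT (EFin \o (fun p => \1_bigball p * weight u lam p : R)).
Proof.
have mB : measurable (bigball : set (borel P)) by apply: borel_open; exact: open_rball.
apply: (bigball_integrable vol_fin ball_compact (C := 1)).
- exact: measurable_indic.
- by move=> p; rewrite indicE; case: (p \in _); rewrite ?normr1 ?normr0.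
- by move=> p nB; rewrite indicE memNset.
- exact: (C1P_continuous (weight_C1P hu lam)).
Qed.

(** A localizer equal to 1 on a neighbourhood of a compact set containing the ball is tested with
    eta = 1. On the ball its gradient vanishes, and outside the ball [cutoff] and [wall] vanish, so
    theta disappears. *)
Lemma source_le_wall : \int[vol]_p (cutoff M o kap rad p * sourceu p) <=
  \int[vol]_p (wall M o kap rad p * cap M c u lam kap p).
Proof.
have [K cK BK] := ball_compact.
have [theta [Ct _ H] [U [oU KU tU]]] := localizer_compact cK.
have C1 : C1P M (cst 1) by exact: C1P_cst.
have := H (cst 1) C1 (fun p => ler01).
have i1 := cutoff_source_integrable.
have i2 := wall_cap_integrable.
rewrite -subr_ge0 -RintegralB//; congr (0 <= _); apply: eq_Rintegral => p _.
rewrite /flux/=; have [Bp|nBp] := pselect (bigball p); last first.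
  by rewrite cutoff_out// wall_out//; ring.
have Up : U p by apply/KU/BK.
rewrite /flow (@dpair_near0 _ _ _ M u _ U 1)//=; last by move=> q Uq; rewrite tU// mul1r.
by rewrite tU//; ring.
Qed.

(** On the ball the slope bound is at most 2 kap (phi + e^(- kap rad)). Against phi, [cap] is
    bounded by S / (4 kap), which gives half of the left-hand side; against the constant it is
    bounded by 2 e^(- lam u). Absorbing the half doubles 4 kap to 8 kap. *)
Lemma source_le_weight : \int[vol]_p (cutoff M o kap rad p * sourceu p) <=
  8 * kap * expR (- kap * rad) * \int[vol]_p (\1_bigball p * weight u lam p).
Proof.
pose A := \int[vol]_p (cutoff M o kap rad p * sourceu p).
pose W := \int[vol]_p (\1_bigball p * weight u lam p).
pose k := 4 * kap * expR (- kap * rad).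
have i1 := cutoff_source_integrable.
have i2 := wall_cap_integrable.
have i3 := ball_weight_integrable.
have i1' : vol.-integrable setT (EFin \o (fun p => 2^-1 * (cutoff M o kap rad p * sourceu p) : R)).
  exact: (integrableZl measurableT 2^-1 i1).
have i3' : vol.-integrable setT (EFin \o (fun p => k * (\1_bigball p * weight u lam p) : R)).
  exact: (integrableZl measurableT k i3).
have H : A <= 2^-1 * A + k * W.
  apply: le_trans source_le_wall _.
  have E1 := @RintegralZl _ _ _ vol setT _ 2^-1 measurableT i1.
  have E2 := @RintegralZl _ _ _ vol setT _ k measurableT i3.
  rewrite /A /W -E1 -E2 -RintegralD//.
  apply: le_Rintegral => //; first exact: (integrableD _ i1' i3').
  move=> p _; have [Bp|nBp] := pselect (bigball p); last first.
    by rewrite wall_out// cutoff_out// indicE memNset// !mul0r !mulr0 addr0.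
  rewrite /wall patchE indicE mem_set// mul1r.
  set e := expR _; set a := cutoff _ _ _ _ _.
  have ea : e <= a + expR (- kap * rad) by rewrite -lerBlDr /a /cutoff le_max lexx orbT.
  have a0 : 0 <= a by exact: cutoff_ge0.
  have cap0 : 0 <= cap M c u lam kap p.
    rewrite le_min; apply/andP; split; last by rewrite mulr_ge0// ltW// weight_gt0.
    by apply/ltW/divr_gt0; [exact: source_gt0|rewrite mulr_gt0].
  have c1 : 4 * kap * cap M c u lam kap p <= sourceu p.
    by rewrite mulrC -ler_pdivlMr ?mulr_gt0// /cap ge_min lexx.
  have c2 : cap M c u lam kap p <= 2 * weight u lam p by rewrite /cap ge_min lexx orbT.
  rewrite /k; move: (cap _ _ _ _ _ _) cap0 c1 c2 => h h0 c1 c2; have E0 := expR_gt0 (- kap * rad).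
  move: (expR (- kap * rad)) ea E0 => E ea E0.
  apply: (@le_trans _ _ (2 * kap * (a + E) * h)).
    by rewrite ler_wpM2r// ler_wpM2l// mulr_ge0// ltW.
  have -> : 2 * kap * (a + E) * h = 2^-1 * (a * (4 * kap * h)) + 2 * kap * E * h by field.
  apply: lerD; first by rewrite ler_wpM2l// ler_wpM2l.
  have -> : 4 * kap * E * weight u lam p = 2 * kap * E * (2 * weight u lam p) by ring.
  by rewrite ler_wpM2l// !mulr_ge0// ltW.
rewrite -/A -/W (_ : 8 * kap * expR (- kap * rad) = 2 * k); last by rewrite /k; ring.
lra.
Qed.

End Estimate.

(** * Choice of the parameters *)

Section Exponents.
Context {R : realType}.
Implicit Types sigma s k b C rad : R.

(** A budget in units of s T. The gain kap rad is 1/4; R0 + 1 <= rad / 2 costs at most 1/8; the two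
    terms with lam cost (2 C + 4 b) k T, at most 1/32; the volume term costs 1/32, because (rad +
    1)^e <= 4 rad^e for 0 <= e <= 2. There remains 1/16. *)
Lemma exponent_gap sigma s k C b R0 rad : 0 <= sigma < 2 -> 0 < s -> 0 <= k -> 0 <= C -> 0 <= b ->
  0 <= R0 -> (2 * C + 4 * b) * k <= s / 32 -> 1 <= rad -> 2 * (R0 + 1) <= rad ->
  forall T lam kap, T = rad `^ (2 - sigma) -> lam = k * rad `^ (2 - 2 * sigma) ->
  kap = s / 4 * rad `^ (1 - sigma) -> s / 16 * T <= kap * (rad - R0) - kap -
    (2 * lam * C + lam * (b * (rad + 1) `^ sigma) + s / 128 * (rad + 1) `^ (2 - sigma)).
Proof.
move=> /andP[s0 s2] sp k0 C0 b0 R00 Nk rad1 radR T lam kap TE lamE kapE.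
have radp : 0 < rad by lra.
have PD e f : rad `^ (e + f) = rad `^ e * rad `^ f by rewrite powRD// (gt_eqF radp) implybT.
have T0 : 0 <= T by rewrite TE powR_ge0.
have P0 : 0 <= rad `^ (2 - 2 * sigma) by exact: powR_ge0.
have kapT : kap * rad = s / 4 * T.
  rewrite kapE -mulrA; congr (_ * _); rewrite TE -[X in _ * X = _](powRr1 (ltW radp)).
  by rewrite -PD; congr (_ `^ _); ring.
(* Here rad >= 1 and 2 - 2 sigma <= 2 - sigma. *)
have lamT : lam <= k * T by rewrite lamE TE ler_wpM2l// ler_powR//; lra.
have lam0 : 0 <= lam by rewrite lamE mulr_ge0.
have pow4 e : 0 <= e <= 2 -> (rad + 1) `^ e <= 4 * rad `^ e.
  move=> /andP[e0 e2]; apply: (@le_trans _ _ ((2 * rad) `^ e)).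
    by apply: ge0_ler_powR => //; rewrite ?nnegrE; lra.
  rewrite powRM//; last exact: ltW.
  rewrite ler_wpM2r ?powR_ge0//.
  have -> : 4 = 2 `^ (2%:R) :> R by rewrite powR_mulrn//; ring.
  by rewrite ler_powR//; lra.
have h1 : lam * (b * (rad + 1) `^ sigma) <= 4 * b * k * T.
  have -> : 4 * b * k * T = lam * (b * (4 * rad `^ sigma)).
    have -> : T = rad `^ (2 - 2 * sigma) * rad `^ sigma.
      by rewrite TE -PD; congr (_ `^ _); ring.
    by rewrite lamE; ring.
  by rewrite ler_wpM2l// ler_wpM2l// pow4// s0 ltW.
have h2 : (rad + 1) `^ (2 - sigma) <= 4 * T by rewrite TE; apply: pow4; apply/andP; split; lra.
have kap0 : 0 <= kap by rewrite kapE mulr_ge0 ?powR_ge0// divr_ge0// ltW.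
have h3 : kap * (R0 + 1) <= s / 8 * T.
  have : kap * (2 * (R0 + 1)) <= s / 4 * T by rewrite -kapT ler_wpM2l.
  lra.
have h4 : lam * C <= k * T * C by rewrite ler_wpM2r.
have h5 : (2 * C + 4 * b) * k * T <= s / 32 * T by rewrite ler_wpM2r.
have h6 : s / 128 * (rad + 1) `^ (2 - sigma) <= s / 128 * (4 * T) by rewrite ler_wpM2l// divr_ge0// ltW.
have -> : kap * (rad - R0) - kap = s / 4 * T - kap * (R0 + 1) by rewrite -kapT; ring.
lra.
Qed.

Lemma powR_unbounded (e t : R) : 0 < e -> exists r0, forall r, r0 <= r -> t <= r `^ e.
Proof.
move=> e0; exists ((Num.max 1 t) `^ e^-1) => r hr.
have m0 : 0 <= Num.max 1 t by rewrite le_max ler01.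
apply: (@le_trans _ _ (Num.max 1 t)); first by rewrite le_max lexx orbT.
rewrite -[leLHS](powRr1 m0) -[X in _ `^ X](mulVf (lt0r_neq0 e0)) powRrM.
by apply: ge0_ler_powR; rewrite ?nnegrE ?powR_ge0// ?(le_trans (powR_ge0 _ _) hr)// ltW.
Qed.

(** The hypotheses force X >= 1, so e^X <= 2 (e^X - 1). The prefactor [kap] is swallowed by e^kap,
    which is why the gap subtracts [kap]; finally g <= e^g. *)
Lemma exponential_comparison (q kap X Y g : R) : 0 < q -> 0 <= kap ->
  0 <= Y -> g <= X - kap - Y -> 1 <= g ->
  q * (expR X - 1) <= 8 * kap * expR Y -> q * g <= 16.
Proof.
move=> q0 kap0 Y0 gX g1 H.
have eX : expR X <= 2 * (expR X - 1).
  have := expR_ge1Dx X; lra.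
have h1 : q * expR X <= 16 * expR (kap + Y).
  apply: (@le_trans _ _ (q * (2 * (expR X - 1)))); first by rewrite ler_wpM2l// ltW.
  have hk : kap <= expR kap by have := expR_ge1Dx kap; lra.
  have : kap * expR Y <= expR kap * expR Y by rewrite ler_wpM2r// expR_ge0.
  by rewrite expRD; lra.
have h2 : q * expR (X - kap - Y) <= 16.
  rewrite -(ler_pM2r (expR_gt0 (kap + Y))) -mulrA -expRD.
  by rewrite (_ : X - kap - Y + (kap + Y) = X) //; ring.
apply: le_trans h2; rewrite ler_wpM2l ?(ltW q0)//.
apply: (le_trans _ (_ : expR g <= _)); last by rewrite ler_expR.
by have := expR_ge1Dx g; lra.
Qed.

End Exponents.

(** * Volume growth and the contradiction *)

Section Growth.
Context {R : realType} {n : nat} {P : ptopologicalType}.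
Variable M : riemannianManifold R n P.
Variable vol : {measure set (borel P) -> \bar R}.

(** Convergence to 0 in the extended reals makes the quotient eventually finite. This excludes the
    volumes 0 and +oo, whose logarithms are infinite. *)
Lemma volume_growth (o : P) (sigma eps : R) : 0 < eps ->
  (lne (vol (rball M o r)) * ((r `^ (2 - sigma))^-1)%:E)%E @[r --> +oo%R] --> 0%E ->
  exists r0, forall r, r0 <= r -> exists v : R,
    [/\ vol (rball M o r) = v%:E, 0 < v & v <= expR (eps * r `^ (2 - sigma))].
Proof.
move=> eps0 /fine_cvgP[hfin /cvgrPdist_lt/(_ eps eps0) hlim].
have pos : \forall r \near +oo%R, (0 : R) < r by exists 0; split.
have : \forall r \near +oo%R, exists v : R,
    [/\ vol (rball M o r) = v%:E, 0 < v & v <= expR (eps * r `^ (2 - sigma))].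
  apply: filterS3 pos hfin hlim => r r0 hf /=; rewrite sub0r normrN.
  have p0 : 0 < r `^ (2 - sigma) by exact: powR_gt0.
  have i0 : 0 < (r `^ (2 - sigma))^-1 by rewrite invr_gt0.
  have vge : (0 <= vol (rball M o r))%E by [].
  move: hf vge; case: (vol (rball M o r)) => [v| |]// hf.
    rewrite lee_fin le_eqVlt => /orP[/eqP v0|v0].
      by move: hf; rewrite -v0 le0_lneNy// gt0_mulNye// lte_fin.
    rewrite lne_EFin//= => /(le_lt_trans (ler_norm _)); rewrite ltr_pdivrMr// => h.
    by exists v; split=> //; rewrite -[leLHS](lnK v0) ler_expR ltW.
  by move: hf; rewrite /= gt0_mulye// lte_fin.
(* The filter at infinity provides a strict inequality, hence r1 + 1. *)
move=> [r1 [_ H]]; exists (r1 + 1) => r hr; apply: H; lra.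
Qed.

End Growth.

Section Comparison.
Context {R : realType} {n : nat} {P : ptopologicalType}.
Variable M : riemannianManifold R n P.
Variables (c : R) (u : P -> R).
Hypothesis hu : translating_soliton_graph M c u.
Hypothesis c0 : c < 0.
Variable vol : {measure set (borel P) -> \bar R}.
Hypothesis hvol : is_riemannian_volume M vol.
Variable o : P.

(** On the left the integral is restricted to the fixed ball of radius [R0], where the cutoff and
    the weight are bounded below, W is bounded above and the nonnegative term lam |grad u|^2 is
    dropped. On the right the lower bound for [u] is taken at its worst, at radius rad + 1. *)
Lemma scale_estimate (lam kap rad R0 C b sigma Wm v0 v1 : R) :
  0 < kap -> 0 < lam -> (4 * kap) ^+ 2 <= - c * lam -> in_compact (rball M o (rad + 1)) ->
  R0 <= rad -> 0 <= b -> 0 <= sigma ->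
  (forall p, - C - b * rdist M o p `^ sigma <= u p) ->
  (forall p, rball M o R0 p -> u p <= C /\ slope M u p <= Wm) ->
  vol (rball M o R0) = v0%:E -> vol (rball M o (rad + 1)) = v1%:E ->
  (expR (- kap * R0) - expR (- kap * rad)) * (expR (- lam * C) * - c / Wm) * v0 <=
  8 * kap * expR (- kap * rad) * (expR (lam * (C + b * (rad + 1) `^ sigma)) * v1).
Proof.
move=> kap0 lam0 kaplam bc R0rad b0 s0 lower upper V0 V1.
have vfin : (vol (rball M o (rad + 1)) < +oo)%E by rewrite V1 ltry.
have mB r : measurable (rball M o r : set (borel P)) by apply: borel_open; exact: open_rball.
have v0fin : (vol (rball M o R0) < +oo)%E by rewrite V0 ltry.
have I0 : vol.-integrable setT (EFin \o (fun p => \1_(rball M o R0) p : R)).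
  exact: integrable_indic_fin.
have I1 : vol.-integrable setT (EFin \o (fun p => \1_(rball M o (rad + 1)) p : R)).
  exact: integrable_indic_fin.
have E r w : vol (rball M o r) = w%:E -> \int[vol]_p (\1_(rball M o r) p : R) = w.
  by move=> h; rewrite /Rintegral integral_indic// setIT h.
have i1 := cutoff_source_integrable hu lam kap0 vfin bc.
have i2 := ball_weight_integrable hu lam vfin bc.
have H := source_le_weight hu c0 hvol kap0 lam0 kaplam vfin bc.
apply: le_trans (le_trans _ H) _.
- rewrite -(E _ _ V0) -RintegralZl//; apply: le_Rintegral => //.
    exact: (integrableZl measurableT _ I0).
  move=> p _; rewrite indicE; have [Bp|nBp] := pselect (rball M o R0 p); last first.
    rewrite memNset// mulr0 mulr_ge0 ?cutoff_ge0// ltW// source_gt0//.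
  rewrite mem_set// mulr1; have [uC sW] := upper p Bp.
  have sp := slope_gt0 M u p.
  apply: ler_pM.
  + by rewrite subr_ge0 ler_expR !mulNr lerN2 ler_wpM2l// ltW.
  + by rewrite divr_ge0 ?mulr_ge0 ?expR_ge0 ?oppr_ge0 ?ltW//; apply: lt_le_trans sW.
  + rewrite /cutoff le_max lerB ?orbT// ler_expR !mulNr lerN2 ler_wpM2l ?(ltW kap0)//.
    exact: ltW.
  rewrite /source; apply: ler_pM.
  + by rewrite mulr_ge0 ?expR_ge0 ?oppr_ge0 ?ltW.
  + by rewrite invr_ge0; apply: le_trans sW; exact: ltW.
  + apply: ler_pM; rewrite ?expR_ge0 ?oppr_ge0 ?(ltW c0)//.
      by rewrite /weight ler_expR !mulNr lerN2 ler_wpM2l// ltW.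
    by rewrite lerDl mulr_ge0 ?dpair_ge0// ltW.
  + by rewrite lef_pV2// posrE//; apply: lt_le_trans sW.
- apply: ler_wpM2l; first by rewrite !mulr_ge0 ?expR_ge0// ltW.
  rewrite -(E _ _ V1) -RintegralZl//; apply: le_Rintegral => //.
    exact: (integrableZl measurableT _ I1).
  move=> p _; rewrite indicE; have [Bp|nBp] := pselect (rball M o (rad + 1) p); last first.
    by rewrite memNset// mul0r mulr0.
  rewrite mem_set// mul1r mulr1 /weight ler_expR mulNr -mulrN ler_wpM2l ?(ltW lam0)//.
  have hp : rdist M o p `^ sigma <= (rad + 1) `^ sigma.
    apply: ge0_ler_powR; rewrite ?nnegrE ?rdist_ge0//; last exact: ltW.
    by apply: le_trans (ltW Bp); exact: rdist_ge0.
  have := lower p; have : b * rdist M o p `^ sigma <= b * (rad + 1) `^ sigma by rewrite ler_wpM2l.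
  lra.
Qed.

(** On the exceptional compact set continuity provides [C]. Replacing beta by its absolute value
    makes the bound decrease with the distance whatever the sign of beta. *)
Lemma lower_bound (sigma beta : R) : lies_above_at_infinity M o sigma beta u ->
  exists2 C, 0 <= C & forall p, - C - `|beta| * rdist M o p `^ sigma <= u p.
Proof.
move=> [K cK hK]; have cu := C1P_continuous (soliton_C1P hu).
have [C C0 hC] := compact_continuous_bounded cK (fun p _ => cu p).
exists C => // p; have pw := powR_ge0 (rdist M o p) sigma.
have bp : 0 <= `|beta| * rdist M o p `^ sigma by rewrite mulr_ge0.
have [/hC|nK] := pselect (K p); first by rewrite ler_norml => /andP[? _]; lra.
apply: le_trans (hK p nK); have : beta * rdist M o p `^ sigma <= `|beta| * rdist M o p `^ sigma.
  by rewrite ler_wpM2r// ler_norm.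
lra.
Qed.

End Comparison.

Theorem theorem10p2 (R : realType) (n : nat) (P : ptopologicalType)
  (M : riemannianManifold R n P) (hcomplete : rcomplete M)
  (vol : {measure set (borel P) -> \bar R})
  (hvol : is_riemannian_volume M vol)
  (o : P) (sigma : R) (hsigma : 0 <= sigma < 2)
  (hgrowth :
    (lne (vol (rball M o r)) * ((r `^ (2 - sigma))^-1)%:E)%E @[r --> +oo%R]
      --> 0%E) :
  forall beta : R,
    ~ exists (c : R) (u : P -> R),
        [/\ c < 0, translating_soliton_graph M c u &
            lies_above_at_infinity M o sigma beta u].
Proof.
move=> beta [c [u [c0 hu hlies]]].
have /andP[s0 s2] := hsigma.
have bc r : in_compact (rball M o r) by exact: hopf_rinow.
have [C1 C10 lower] := lower_bound hu hlies.
have a0 : 0 < - c by rewrite oppr_gt0.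
have [r1 grow1] := volume_growth ltr01 hgrowth.
(* The growth bound with [eps] = 1 serves to find a fixed ball of finite positive volume. *)
pose R0 := Num.max r1 0; have R00 : 0 <= R0 by rewrite le_max lexx orbT.
have R0r1 : r1 <= R0 by rewrite /R0 le_max lexx.
have [v0 [V0 v00 _]] := grow1 R0 R0r1.
have [K cK BK] := bc R0.
have cu := C1P_continuous (soliton_C1P hu); have cs := slope_continuous hu.
have [C2 C20 hC2] := compact_continuous_bounded cK (fun p _ => cu p).
have [Wm Wm0 hWm] := compact_continuous_bounded cK (fun p _ => cs p).
pose C := C1 + C2; have C0 : 0 <= C by rewrite addr_ge0.
pose b := `|beta|; have b0 : 0 <= b by exact: normr_ge0.
pose W := Wm + 1; have W0 : 0 < W by rewrite ltr_wpDl.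
have {}lower p : - C - b * rdist M o p `^ sigma <= u p by have := lower p; rewrite /C /b; lra.
have upper p : rball M o R0 p -> u p <= C /\ slope M u p <= W.
  move=> /BK Kp; have := hC2 p Kp; have := hWm p Kp; rewrite !ler_norml => /andP[_ h1] /andP[_ h2].
  by rewrite /C /W; split; lra.
(* [k] and [s] satisfy [s ^+ 2 = - c * k] and [N * k = s / 32]. *)
pose N := 2 * C + 4 * b + 1; have N0 : 0 < N by rewrite /N; lra.
pose s := - c / (32 * N); pose k := - c / (32 * N) ^+ 2.
have N32 : 0 < 32 * N by rewrite mulr_gt0.
have sp : 0 < s by rewrite divr_gt0.
have kp : 0 < k by rewrite divr_gt0// exprn_gt0.
have Nk : (2 * C + 4 * b) * k <= s / 32.
  have -> : s / 32 = N * k by rewrite /s /k; field; rewrite gt_eqF.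
  by rewrite ler_wpM2r ?(ltW kp)// /N; lra.
have eps0 : 0 < s / 128 by rewrite divr_gt0.
have [r2 grow2] := volume_growth eps0 hgrowth.
pose q := v0 * - c / W; have q0 : 0 < q by rewrite divr_gt0// mulr_gt0.
have e0 : 0 < 2 - sigma by rewrite subr_gt0.
(* The number 17 beats the bound 16 of [exponential_comparison]: a gap of at least 1 + 17 / q would
   give q + 17 <= 16. *)
have [r3 big] := powR_unbounded (16 / s * (1 + 17 / q)) e0.
pose rad := Num.max (Num.max r2 r3) (2 * (R0 + 1)).
have rad2 : r2 <= rad + 1 by apply: (@le_trans _ _ rad); rewrite ?lerDl// !le_max lexx.
have rad3 : r3 <= rad by rewrite !le_max lexx orbT.
have radR : 2 * (R0 + 1) <= rad by rewrite le_max lexx orbT.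
have rad1 : 1 <= rad by lra.
have radp : 0 < rad by lra.
have [v1 [V1 v10 v1le]] := grow2 _ rad2.
pose T := rad `^ (2 - sigma); pose lam := k * rad `^ (2 - 2 * sigma).
pose kap := s / 4 * rad `^ (1 - sigma).
have gap := exponent_gap hsigma sp (ltW kp) C0 b0 R00 Nk rad1 radR (erefl T) (erefl lam) (erefl kap).
have lam0 : 0 < lam by rewrite mulr_gt0// powR_gt0.
have kap0 : 0 < kap by rewrite mulr_gt0 ?powR_gt0// divr_gt0.
have kaplam : (4 * kap) ^+ 2 <= - c * lam.
  have E : rad `^ (2 - 2 * sigma) = (rad `^ (1 - sigma)) ^+ 2.
    by rewrite -powR_mulrn ?powR_ge0// -powRrM; congr (_ `^ _); ring.
  rewrite le_eqVlt; apply/orP; left; apply/eqP; rewrite /lam /kap E /s /k.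
  by field; rewrite gt_eqF.
have R0rad : R0 <= rad by lra.
have := scale_estimate hu c0 hvol kap0 lam0 kaplam (bc _) R0rad b0 s0 lower upper V0 V1.
set Y := 2 * lam * C + lam * (b * (rad + 1) `^ sigma) + s / 128 * (rad + 1) `^ (2 - sigma) in gap.
(* Division by e^(- kap rad - lam C) isolates the exponent kap (rad - R0) on the left and collects
   [Y] on the right, where the volume [v1] is replaced by its exponential bound. *)
move=> H; have {}H : q * (expR (kap * (rad - R0)) - 1) <= 8 * kap * expR Y.
  rewrite -(ler_pM2r (expR_gt0 (- kap * rad - lam * C))).
  have -> : q * (expR (kap * (rad - R0)) - 1) * expR (- kap * rad - lam * C) =
     (expR (- kap * R0) - expR (- kap * rad)) * (expR (- lam * C) * - c / W) * v0.
    have -> : expR (- kap * R0) = expR (kap * (rad - R0)) * expR (- kap * rad).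
      by rewrite -expRD; congr expR; ring.
    by rewrite expRD [- lam * C]mulNr /q; ring.
  apply: (le_trans H).
  have -> : 8 * kap * expR Y * expR (- kap * rad - lam * C) = 8 * kap * expR (- kap * rad) *
      (expR (lam * (C + b * (rad + 1) `^ sigma)) * expR (s / 128 * (rad + 1) `^ (2 - sigma))).
    have -> : Y = lam * C + lam * (C + b * (rad + 1) `^ sigma) + s / 128 * (rad + 1) `^ (2 - sigma).
      by rewrite /Y; ring.
    rewrite expRD [expR (_ - _)]expRD [expR (lam * C + _)]expRD [expR (- (lam * C))]expRN.
    by field; rewrite gt_eqF// expR_gt0.
  apply: ler_wpM2l.
    by apply: mulr_ge0; [apply: mulr_ge0 => //; exact: ltW|exact: expR_ge0].
  by rewrite ler_wpM2l ?expR_ge0.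
have TT : 1 + 17 / q <= s / 16 * T.
  have := big rad rad3; rewrite -/T => h.
  have : s / 16 * (16 / s * (1 + 17 / q)) <= s / 16 * T by rewrite ler_wpM2l// divr_ge0// ltW.
  by rewrite mulrA (_ : s / 16 * (16 / s) = 1) ?mul1r//; field; rewrite gt_eqF.
have q17 : 0 < 17 / q by rewrite divr_gt0.
have Y0 : 0 <= Y.
  have p1 : 0 <= (rad + 1) `^ sigma by exact: powR_ge0.
  have p2 : 0 <= (rad + 1) `^ (2 - sigma) by exact: powR_ge0.
  rewrite /Y addr_ge0//; last by rewrite mulr_ge0// ltW.
  have lam0' := ltW lam0; clearbody lam.
  by rewrite addr_ge0 ?mulr_ge0.
have g1 : 1 <= s / 16 * T by lra.
have := exponential_comparison q0 (ltW kap0) Y0 gap g1 H.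
have : q * (1 + 17 / q) <= q * (s / 16 * T) by rewrite ler_wpM2l// ltW.
rewrite mulrDr mulr1 mulrCA divff ?mulr1 ?gt_eqF//.
lra.
Qed.
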